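(* Let $F$ be a non-Archimedean local field with residue characteristic $p$ and residue field of cardinality $q$, and let $D$ be a central division $F$-algebra of dimension $d^2$. Let $\ell$ be a prime with $\ell\ne p$ and $\ell\nmid d$, and let $E/F$ be a Galois extension of degree $\ell$. Put $D_E=D\otimes_F E$. Let $\mathcal{K}$ be the maximal unramified extension of $\mathbb{Q}_\ell$ in $\overline{\mathbb{Q}}_\ell$, with ring of integers $\mathcal{O}_{\mathcal{K}}$. Let $\pi$ be an absolutely irreducible depth-zero integral $\mathcal{K}$-representation of $D^\times$, written as $\pi=\pi_D(\theta)$ for an admissible tame pair $(K/F,\theta)$ with $\theta$ taking values in $\mathcal{O}_{\mathcal{K}}$. Let $\Pi=\mathrm{bc}_{E/F}(\pi)$, realized over $\mathcal{K}$ as $\pi_{D_E}(\widetilde\theta)=\mathrm{ind}_{J_E}^{D_E^\times}(\Lambda_E)$ with $\widetilde\theta=\theta\circ\mathrm{Nr}_{EK/K}$, and with $\mathrm{Gal}(E/F)$ acting by $(\sigma\cdot f)(g)=f(\sigma^{-1}(g))$. Assume further that $\ell$ does not divide $q^d-1$. Then, for any $\mathcal{O}_{\mathcal{K}}[D_E^\times\rtimes\mathrm{Gal}(E/F)]$-stable lattice $\mathcal{L}$ in $\Pi$, the zeroth Tate cohomology group $\widehat{\mathrm{H}}^0(\sigma,\mathcal{L})$ is irreducible (as an $\overline{\mathbb{F}}_\ell$-representation of $D^\times$), and the first Tate cohomology group $\widehat{\mathrm{H}}^1(\sigma,\mathcal{L})$ is trivial, where $\sigma$ is a generator of $\mathr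m{Gal}(E/F)$.
   Context: Filtration. For a central division algebra $D$ (or a local field), $\mathfrak{o}_D$ is the ring of integers, $\mathfrak{p}_D$ its maximal ideal, and $U_D^1=1+\mathfrak{p}_D$. A smooth irreducible representation of $D^\times$ is of depth zero if $U_D^1$ acts trivially. A finite-length smooth representation is integral if it contains a lattice stable under the group. Since $\ell\nmid d$, $D_E$ is a central division $E$-algebra of dimension $d^2$; $\mathrm{Gal}(E/F)$ acts on $D_E$ through the factor $E$, with fixed points $D$. Admissible tame pairs. A tame pair over $F$ is a finite unramified extension $K/F$ with a smooth character $\theta$ of $K^\times$ trivial on $U_K^1$. It is admissible if the Galois conjugates $\theta^\gamma$, $\gamma\in\mathrm{Gal}(K/F)$, are distinct. Here $[K:F]$ divides $d$. The representation $\pi_D(\theta)$. Fix an $F$-embedding $K\hookrightarrow D$, let $B$ be the centralizer of $K$ in $D$ (a central division $K$-algebra), and put $J=B^\times U_D^1$. Let $\Lambda$ be the character of $J$ given by $\Lambda(bu)=\theta(\mathrm{Nrd}_B(b))$ for $b\in B^\times$, $u\in U_D^1$, where $\mathrm{Nrd}_B:B^\times\to K^\times$ is the reduced norm. Then $\pi_D(\theta)=\mathrm{ind}_J^{D^\times}(\Lambda)$, where $\mathrm{ind}$ is compact induction: smooth functions $f$ with $f(jg)=\Lambda(j)f(g)$, compactly supported modulo $J$, with the group acting by right translation. The representation $\pi_{D_E}(\widetilde\theta)$. Put $EK=E\otimes_F K$ (a field, unramified over $E$) and $\widetilde\theta=\theta\circ\mathrm{Nr}_{EK/K}$. Let $EK\subset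 D_E$ be the embedding induced by $K\subset D$, let $B_E=B\otimes_K EK$ be the centralizer of $EK$ in $D_E$, and put $J_E=B_E^\times U_{D_E}^1$ and $\Lambda_E(bu)=\widetilde\theta(\mathrm{Nrd}_{B_E}(b))$ for $b\in B_E^\times$, $u\in U_{D_E}^1$. Then $\pi_{D_E}(\widetilde\theta)=\mathrm{ind}_{J_E}^{D_E^\times}(\Lambda_E)$. The character $\Lambda_E$ is $\mathrm{Gal}(E/F)$-invariant, so $(\sigma\cdot f)(g)=f(\sigma^{-1}(g))$ defines an action of $\mathrm{Gal}(E/F)$ on $\pi_{D_E}(\widetilde\theta)$, making it a representation of $D_E^\times\rtimes\mathrm{Gal}(E/F)$. Base change. $\mathrm{bc}_{E/F}=\mathrm{JL}_E^{-1}\circ\mathrm{BC}_{E/F}\circ\mathrm{JL}_F$, where $\mathrm{JL}$ is the ($\ell$-adic) local Jacquet-Langlands correspondence and $\mathrm{BC}_{E/F}$ is local base change from $\mathrm{GL}_d(F)$ to $\mathrm{GL}_d(E)$. For $\pi=\pi_D(\theta)$ over $\mathcal{K}$, the base change lift $\Pi$ is taken to be the $\mathcal{K}$-representation $\pi_{D_E}(\widetilde\theta)$ above, consisting of $\mathcal{K}$-valued functions; it is a $\mathcal{K}$-rational structure on $\mathrm{bc}_{E/F}(\pi\otimes_{\mathcal{K}}\overline{\mathbb{Q}}_\ell)$. Tate cohomology. Let $\Gamma=\mathrm{Gal}(E/F)=\langle\sigma\rangle$, cyclic of order $\ell$, and $\mathrm{Nr}=1+\sigma+\cdots+\sigma^{\ell-1}$.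 For an $\mathcal{O}_{\mathcal{K}}[\Gamma]$-module $M$, $\widehat{\mathrm{H}}^0(\sigma,M)=\ker(1-\sigma)/\mathrm{im}(\mathrm{Nr})$ and $\widehat{\mathrm{H}}^1(\sigma,M)=\ker(\mathrm{Nr})/\mathrm{im}(1-\sigma)$. These are vector spaces over $\mathcal{O}_{\mathcal{K}}/\ell\mathcal{O}_{\mathcal{K}}\simeq\overline{\mathbb{F}}_\ell$, and when $M$ is an $\mathcal{O}_{\mathcal{K}}[D_E^\times\rtimes\Gamma]$-module they carry an action of $(D_E^\times)^\sigma=D^\times$. *)

(* Defs.v *)
From HB Require Import structures.
From mathcomp Require Import all_boot all_order all_algebra.
From mathcomp Require Import all_fingroup all_solvable all_field.
From mathcomp Require Import boolp classical_sets functions.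

Set Implicit Arguments.
Unset Strict Implicit.
Unset Printing Implicit Defensive.
Import Order.TTheory GRing.Theory Num.Theory.
Local Open Scope classical_set_scope.
Local Open Scope ring_scope.

(* The value at 0 is junk: only nonzero elements are constrained. *)

Record discrete_valuation (F : fieldType) := DiscreteValuation {
  dval :> F -> int;
  dvalM : forall x y, x != 0 -> y != 0 -> dval (x * y) = dval x + dval y;
  dvalD : forall x y, x != 0 -> y != 0 -> x + y != 0 ->
    Num.min (dval x) (dval y) <= dval (x + y);
  dval_onto : exists2 x, x != 0 & dval x = 1 }.

Section ValuationRing.
Variables (F : fieldType) (v : discrete_valuation F).

Definition val_ge (N : int) : pred F := [pred x | (x == 0) || (N <= v x)].

Lemma dval1 : v 1 = 0.
Proof.
have := dvalM v (oner_neq0 F) (oner_neq0 F); rewrite mulr1 => h.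
by apply: (@addIr _ (v 1)); rewrite -h add0r.
Qed.

Lemma dvalN1 : v (- 1) = 0.
Proof.
have n0 : (- 1 : F) != 0 by rewrite oppr_eq0 oner_eq0.
have := dvalM v n0 n0; rewrite mulrNN mulr1 dval1 => /esym/eqP.
by rewrite -mulr2n mulrn_eq0 /= => /eqP.
Qed.

Lemma val_ge0_subring : subring_closed (val_ge 0).
Proof.
split=> [|x y|x y]; rewrite ?inE /=.
- by rewrite dval1 lexx orbT.
- case: (eqVneq x 0) => [->|x0] /= vx.
    rewrite sub0r oppr_eq0; case: (eqVneq y 0) => //= y0 vy.
    by rewrite -mulN1r (dvalM v) ?oppr_eq0 ?oner_eq0// dvalN1 add0r.
  case: (eqVneq y 0) => [->|y0] /= vy; first by rewrite subr0 vx orbT.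
  case: (eqVneq (x - y) 0) => //= xy0.
  have vNy : v (- y) = v y.
    by rewrite -mulN1r (dvalM v) ?oppr_eq0 ?oner_eq0// dvalN1 add0r.
  apply: le_trans (dvalD v x0 _ xy0); last by rewrite oppr_eq0.
  by rewrite vNy le_min vx.
- case: (eqVneq x 0) => [->|x0] /= vx; first by rewrite mul0r eqxx.
  case: (eqVneq y 0) => [->|y0] /= vy; first by rewrite mulr0 eqxx.
  by rewrite (dvalM v)// addr_ge0 ?orbT.
Qed.
HB.instance Definition _ :=
  GRing.isSubringClosed.Build F (val_ge 0) val_ge0_subring.

Record vring := VRing { vring_val : F; _ : vring_val \in val_ge 0 }.
HB.instance Definition _ := [isSub for vring_val].
HB.instance Definition _ := [Choice of vring by <:].
HB.instance Definition _ := [SubChoice_isSubComNzRing of vring by <:].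
Definition vring_inc : {rmorphism vring -> F} := val.

Definition complete_valuation : Prop :=
  forall u : nat -> F,
    (forall N : int, exists n0, forall m n, (n0 <= m)%N -> (n0 <= n)%N ->
       val_ge N (u m - u n)) ->
    exists x, forall N : int, exists n0, forall n, (n0 <= n)%N ->
       val_ge N (u n - x).

(* The classes of the [s i] are the elements of the residue field. *)
Definition residue_card (q : nat) : Prop :=
  exists s : 'I_q -> vring, forall x : vring,
    exists! i, val_ge 1 (vring_val x - vring_val (s i)).

End ValuationRing.

Record local_field (F : fieldType) (v : discrete_valuation F) (p q : nat) :
    Prop := LocalField {
  lf_complete : complete_valuation v;
  lf_residue_card : residue_card v q;
  lf_prime : prime p;
  lf_residue_char : val_ge v 1 p%:R }.

(* The field of l-adic numbers, as the completion of the rationals. *)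
Record ladic_numbers (Ql : fieldType) (w : discrete_valuation Ql) (l : nat) :
    Prop := LadicNumbers {
  la_val : forall n, (0 < n)%N -> n%:R != 0 :> Ql /\ w n%:R = (logn l n)%:Z;
  la_complete : complete_valuation w;
  la_dense : forall (x : Ql) (N : int), exists r : rat, val_ge w N (x - ratr r) }.

(* Rings of integers. Throughout, o is a ring with a morphism to a field F,
   thought of as the ring of integers of F, and the ring of integers of an
   F-algebra A is the set of elements of A that are integral over o. *)

Definition integers (o : nzRingType) (A : nzRingType) (f : o -> A) : set A :=
  [set x | integralOver f x].

Definition max_ideal (o : nzRingType) (A : unitRingType) (f : o -> A) : set A :=
  [set x | integers f x /\ ~ (x \is a GRing.unit /\ integers f x^-1)].

Definition alg_map (o : comNzRingType) (F : fieldType) (io : {rmorphism o -> F})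
    (A : lalgType F) : {rmorphism o -> A} := in_alg A \o io.

Section IntegerRing.
Variables (R : comNzRingType) (K : fieldType) (f : {rmorphism R -> K}).

Definition integral_pred : {pred K} := fun x => `[< integralOver f x >].

Lemma integral_subring : subring_closed integral_pred.
Proof.
split=> [|x y /asboolP hx /asboolP hy|x y /asboolP hx /asboolP hy];
  apply/asboolP.
- exact: integral1.
- exact: integral_sub.
- exact: integral_mul.
Qed.
HB.instance Definition _ :=
  GRing.isSubringClosed.Build K integral_pred integral_subring.

Record intring := IntRing { intring_val : K; _ : intring_val \in integral_pred }.
HB.instance Definition _ := [isSub for intring_val].
HB.instance Definition _ := [Choice of intring by <:].
HB.instance Definition _ := [SubChoice_isSubComNzRing of intring by <:].
Definition intring_inc : {rmorphism intring -> K} := val.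
End IntegerRing.

(* Since residue fields are finite here, being unramified only means that the
   maximal ideal of K is generated by that of F. *)
Definition unramified (o : comNzRingType) (F : fieldType)
    (io : {rmorphism o -> F}) (K : fieldExtType F) : Prop :=
  forall x : K, max_ideal (alg_map io K) x ->
    exists a : F, exists y : K,
      [/\ max_ideal io a, integers (alg_map io K) y & x = a *: y].

(* The ring of integers of Kc, for an algebraic extension Kc of the field Ql
   with valuation ring vring w. *)
Definition ext_integers (Ql : fieldType) (w : discrete_valuation Ql)
    (Kc : fieldType) (iQ : {rmorphism Ql -> Kc}) : comNzRingType :=
  intring (iQ \o vring_inc w).

Definition ext_integers_inc (Ql : fieldType) (w : discrete_valuation Ql)
    (Kc : fieldType) (iQ : {rmorphism Ql -> Kc}) :
    {rmorphism ext_integers w iQ -> Kc} := intring_inc (iQ \o vring_inc w).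

(* Kc is (isomorphic to) the compositum in Cl of the finite unramified
   extensions of Ql, where Ql -> Kc -> Cl and Cl is an algebraic closure. *)
Record max_unramified (Ql : fieldType) (w : discrete_valuation Ql)
    (Kc Cl : fieldType) (iQ : {rmorphism Ql -> Kc}) (iK : {rmorphism Kc -> Cl}) :
    Prop := MaxUnramified {
  mu_closed : GRing.closed_field_axiom Cl;
  mu_algebraic : forall x : Cl, algebraicOver (iK \o iQ) x;
  mu_image : forall x : Cl, (exists y, iK y = x) <->
    exists (L : fieldExtType Ql) (h : {rmorphism L -> Cl}),
      [/\ unramified (vring_inc w) L,
          (forall a : Ql, h a%:A = iK (iQ a)) & exists y, h y = x] }.

Record units (R : unitRingType) := Units {
  uval : R; uvalP : uval \is a GRing.unit }.

Section UnitGroup.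
Variable R : unitRingType.
HB.instance Definition _ := [isSub of units R for @uval R].
HB.instance Definition _ := [Choice of units R by <:].

Definition units_one : units R := Units (unitr1 R).
Definition units_mul (x y : units R) : units R :=
  Units (etrans (unitrMl (uval x) (uvalP y)) (uvalP x)).
Definition units_inv (x : units R) : units R :=
  Units (etrans (unitrV (uval x)) (uvalP x)).

Lemma units_mulA : associative units_mul.
Proof. by move=> x y z; apply: val_inj; rewrite /= mulrA. Qed.
Lemma units_mul1 : left_id units_one units_mul.
Proof. by move=> x; apply: val_inj; rewrite /= mul1r. Qed.
Lemma units_mulr1 : right_id units_one units_mul.
Proof. by move=> x; apply: val_inj; rewrite /= mulr1. Qed.
Lemma units_mulV : left_inverse units_one units_inv units_mul.
Proof. by move=> x; apply: val_inj; rewrite /= mulVr// uvalP. Qed.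
Lemma units_mulrV : right_inverse units_one units_inv units_mul.
Proof. by move=> x; apply: val_inj; rewrite /= mulrV// uvalP. Qed.
HB.instance Definition _ := isGroup.Build (units R)
  units_mulA units_mul1 units_mulr1 units_mulV units_mulrV.
End UnitGroup.

Definition units_map (R S : unitRingType) (f : {rmorphism R -> S})
    (x : units R) : units S := Units (rmorph_unit f (uvalP x)).

Lemma units_map1 (R S : unitRingType) (f : {rmorphism R -> S}) :
  units_map f 1%g = 1%g.
Proof. by apply: val_inj; rewrite /= rmorph1. Qed.

Lemma units_mapM (R S : unitRingType) (f : {rmorphism R -> S}) x y :
  units_map f (x * y)%g = (units_map f x * units_map f y)%g.
Proof. by apply: val_inj; rewrite /= rmorphM. Qed.

Section Submodule.
Variables (R : comNzRingType) (V : lmodType R) (S : submodClosed V).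
Record submod := Submod { smval : V; smvalP : smval \in S }.
HB.instance Definition _ := [isSub for smval].
HB.instance Definition _ := [Choice of submod by <:].
HB.instance Definition _ := [SubChoice_isSubLmodule of submod by <:].
End Submodule.

Section SubmoduleMap.
Variables (R : comNzRingType) (V : lmodType R) (S : submodClosed V).
Variables (h : {linear V -> V}) (hS : forall x, x \in S -> h x \in S).
Definition submod_map_fun (x : submod S) : submod S := Submod (hS (smvalP x)).
Lemma submod_map_linear : linear submod_map_fun.
Proof. by move=> a x y; apply: val_inj; rewrite /= !linearP. Qed.
HB.instance Definition _ := GRing.isLinear.Build R (submod S) (submod S) _
  submod_map_fun submod_map_linear.
Definition submod_map : {linear submod S -> submod S} := submod_map_fun.
End SubmoduleMap.

Section QuotientModule.
Variables (R : comNzRingType) (V : lmodType R) (S : submodClosed V).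
Local Open Scope quotient_scope.

(* A submodClosed predicate is not registered as a zmodClosed one. *)
Definition zmod_pred : {pred V} := fun x => x \in S.
Lemma zmod_pred_closed : zmod_closed zmod_pred.
Proof.
split=> [|x y Sx Sy]; first exact: (rpred0 S).
by apply: (rpredD (S := S) Sx); rewrite -scaleN1r; exact: (rpredZ (s := S)).
Qed.
HB.instance Definition _ := GRing.isZmodClosed.Build V zmod_pred zmod_pred_closed.

Definition zmod_cl : zmodClosed V := zmod_pred.

Definition quotmod := Quotient.quot zmod_cl.
HB.instance Definition _ := GRing.Zmodule.on quotmod.
HB.instance Definition _ := EqQuotient.on quotmod.

Definition qproj (x : V) : quotmod := \pi_(quotmod) x.
Definition qrepr (y : quotmod) : V := generic_quotient.repr y.

Lemma qreprK : cancel qrepr qproj. Proof. exact: reprK. Qed.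

Lemma qproj_eq x y : (qproj x = qproj y) <-> x - y \in S.
Proof. by rewrite (Quotient.idealrBE zmod_cl); split=> [/eqP|/eqP]. Qed.

Lemma qprojB x y : qproj (x - y) = qproj x - qproj y.
Proof. exact: (raddfB (\pi_(Quotient.quot zmod_cl))). Qed.

Lemma qprojD x y : qproj (x + y) = qproj x + qproj y.
Proof. exact: (raddfD (\pi_(Quotient.quot zmod_cl))). Qed.

Definition qscale (a : R) (y : quotmod) : quotmod := qproj (a *: qrepr y).

Lemma qscaleE a x : qscale a (qproj x) = qproj (a *: x).
Proof. by apply/qproj_eq; rewrite -scalerBr rpredZ//; apply/qproj_eq; exact: qreprK. Qed.

Lemma qscaleA a b y : qscale a (qscale b y) = qscale (a * b) y.
Proof. by rewrite -[y]qreprK !qscaleE scalerA. Qed.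
Lemma qscale1 : left_id 1 qscale.
Proof. by move=> y; rewrite -[y]qreprK qscaleE scale1r. Qed.
Lemma qscaleDr : right_distributive qscale +%R.
Proof.
by move=> a x y; rewrite -[x]qreprK -[y]qreprK -qprojD !qscaleE scalerDr qprojD.
Qed.
Lemma qscaleDl y : {morph qscale^~ y : a b / a + b}.
Proof. by move=> a b; rewrite -[y]qreprK !qscaleE scalerDl qprojD. Qed.
HB.instance Definition _ := GRing.Zmodule_isLmodule.Build R quotmod
  qscaleA qscale1 qscaleDr qscaleDl.

Lemma qprojZ a x : qproj (a *: x) = a *: qproj x.
Proof. by rewrite -qscaleE. Qed.

Variables (h : {linear V -> V}) (hS : forall x, x \in S -> h x \in S).
Definition quotmod_map_fun (y : quotmod) : quotmod := qproj (h (qrepr y)).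
Lemma quotmod_mapE x : quotmod_map_fun (qproj x) = qproj (h x).
Proof. by apply/qproj_eq; rewrite -linearB hS//; apply/qproj_eq; exact: qreprK. Qed.
Lemma quotmod_map_linear : linear quotmod_map_fun.
Proof.
move=> a x y; rewrite -[x]qreprK -[y]qreprK -qprojZ -qprojD !quotmod_mapE.
by rewrite linearP qprojD qprojZ.
Qed.
HB.instance Definition _ := GRing.isLinear.Build R quotmod quotmod _
  quotmod_map_fun quotmod_map_linear.
Definition quotmod_map : {linear quotmod -> quotmod} := quotmod_map_fun.
End QuotientModule.

Section KernelImage.
Variables (R : comNzRingType) (V : lmodType R) (h : {linear V -> V}).

Definition ker_pred : {pred V} := [pred x | h x == 0].
Lemma ker_submod : submod_closed ker_pred.
Proof.
split=> [|a x y]; rewrite ?inE /= ?linear0//.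
by move=> /eqP hx /eqP hy; rewrite linearP hx hy scaler0 addr0.
Qed.
HB.instance Definition _ := GRing.isSubmodClosed.Build R V ker_pred ker_submod.

Definition im_pred : {pred V} := fun y => `[< exists x, h x = y >].
Lemma im_submod : submod_closed im_pred.
Proof.
split=> [|a x y /asboolP[x' <-] /asboolP[y' <-]]; apply/asboolP.
  by exists 0; rewrite linear0.
by exists (a *: x' + y'); rewrite linearP.
Qed.
HB.instance Definition _ := GRing.isSubmodClosed.Build R V im_pred im_submod.
End KernelImage.

Section Subquotient.
Variables (R : comNzRingType) (V : lmodType R) (A B : submodClosed V).

Definition relpred : {pred submod A} := [pred x | smval x \in B].
Lemma rel_submod : submod_closed relpred.
Proof.
split=> [|a x y]; rewrite !inE /= ?rpred0// => hx hy.
by rewrite rpredD// rpredZ.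
Qed.
HB.instance Definition _ :=
  GRing.isSubmodClosed.Build R (submod A) relpred rel_submod.

(* A / (A n B), that is A / B when B is contained in A. *)
Definition subquot : lmodType R := quotmod relpred.

Definition subquot_class (x : V) (Ax : x \in A) : subquot :=
  qproj relpred (Submod Ax).

Lemma subquotP (y : subquot) :
  exists (x : V) (Ax : x \in A), y = subquot_class Ax.
Proof.
exists (smval (qrepr y)), (smvalP (qrepr y)); rewrite -[LHS]qreprK.
by congr qproj; apply: val_inj.
Qed.

Lemma subquot_class_eq0 (x : V) (Ax : x \in A) :
  subquot_class Ax = 0 <-> x \in B.
Proof.
have -> : 0 = qproj relpred 0 :> subquot by rewrite -[0 in RHS](subrr 0) qprojB subrr.
by rewrite qproj_eq subr0.
Qed.

Lemma subquot_classZ a (x : V) (Ax : x \in A) (Aax : a *: x \in A) :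
  a *: subquot_class Ax = subquot_class Aax.
Proof. by rewrite -qprojZ; congr qproj; apply: val_inj. Qed.

Definition subquot_map (h : {linear V -> V})
    (hA : forall x, x \in A -> h x \in A) (hB : forall x, x \in B -> h x \in B) :
    {linear subquot -> subquot} :=
  @quotmod_map _ _ relpred (submod_map hA) (fun x Bx => hB _ Bx).
End Subquotient.

Record group_rep (R : comNzRingType) (G : groupType) (V : lmodType R) :=
  GroupRep {
    rep_act :> G -> {linear V -> V};
    rep_act1 : forall x, rep_act 1%g x = x;
    rep_actM : forall g h x, rep_act (g * h)%g x = rep_act g (rep_act h x) }.

Section Representation.
Variables (R : comNzRingType) (G : groupType).

Definition rep_stable (V : lmodType R) (rho : group_rep G V)
    (S : submodClosed V) : Prop := forall g x, x \in S -> rho g x \in S.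

Definition rep_irreducible (V : lmodType R) (rho : group_rep G V) : Prop :=
  (exists x : V, x <> 0) /\
  forall S : submodClosed V, rep_stable rho S ->
    (forall x, x \in S -> x = 0) \/ (forall x, x \in S).

Variables (V : lmodType R) (rho : group_rep G V).

Definition submod_rep (S : submodClosed V) (hS : rep_stable rho S) :
  group_rep G (submod S).
Proof.
exists (fun g => submod_map (hS g)) => [x|g h x]; apply: val_inj => /=.
  exact: rep_act1.
exact: rep_actM.
Defined.

Definition subquot_rep (A B : submodClosed V) (hA : rep_stable rho A)
  (hB : rep_stable rho B) : group_rep G (subquot A B).
Proof.
exists (fun g => subquot_map (hA g) (hB g)) => [x|g h x];
  rewrite -[x]qreprK /subquot_map /quotmod_map /= !quotmod_mapE.
- by congr qproj; apply: val_inj => /=; rewrite rep_act1.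
- by move=> y /=; exact: hB.
- by congr qproj; apply: val_inj => /=; rewrite rep_actM.
- by move=> y /=; exact: hB.
- by move=> y /=; exact: hB.
- by move=> y /=; exact: hB.
Defined.

End Representation.

(* Extension of scalars along f, by its universal property: W = S (x)_R V with
   i x = 1 (x) x. *)
Definition base_change (R S : comNzRingType) (f : R -> S) (V : lmodType R)
    (W : lmodType S) (i : V -> W) : Prop :=
  (forall a x y, i (a *: x + y) = f a *: i x + i y) /\
  forall (Q : lmodType S) (h : V -> Q),
    (forall a x y, h (a *: x + y) = f a *: h x + h y) ->
    exists2 k : {linear W -> Q}, (forall x, k (i x) = h x) &
      forall k' : {linear W -> Q}, (forall x, k' (i x) = h x) -> k' =1 k.

Definition rep_abs_irreducible (K : fieldType) (G : groupType) (V : lmodType K)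
    (rho : group_rep G V) : Prop :=
  forall (C : fieldType) (c : {rmorphism K -> C}) (W : lmodType C) (i : V -> W)
      (rhoW : group_rep G W),
    base_change c i -> (forall g x, rhoW g (i x) = i (rho g x)) ->
    rep_irreducible rhoW.

Definition rscal (R S : comNzRingType) (f : {rmorphism R -> S})
  (V : lmodType S) : Type := V.

Section RestrictScalars.
Variables (R S : comNzRingType) (f : {rmorphism R -> S}) (V : lmodType S).
HB.instance Definition _ := GRing.Zmodule.copy (rscal f V) V.
Definition rscal_scale (a : R) (x : rscal f V) : rscal f V := f a *: (x : V).
Lemma rscal_scaleA a b x :
  rscal_scale a (rscal_scale b x) = rscal_scale (a * b) x.
Proof. by rewrite /rscal_scale rmorphM scalerA. Qed.
Lemma rscal_scale1 : left_id 1 rscal_scale.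
Proof. by move=> x; rewrite /rscal_scale rmorph1 scale1r. Qed.
Lemma rscal_scaleDr : right_distributive rscal_scale +%R.
Proof. by move=> a x y; rewrite /rscal_scale scalerDr. Qed.
Lemma rscal_scaleDl x : {morph rscal_scale^~ x : a b / a + b}.
Proof. by move=> a b; rewrite /rscal_scale rmorphD scalerDl. Qed.
HB.instance Definition _ := GRing.Zmodule_isLmodule.Build R (rscal f V)
  rscal_scaleA rscal_scale1 rscal_scaleDr rscal_scaleDl.
End RestrictScalars.

Section RestrictScalarsMap.
Variables (R S : comNzRingType) (f : {rmorphism R -> S}) (V : lmodType S).
Variable h : {linear V -> V}.
Definition rscal_map_fun : rscal f V -> rscal f V := h.
Lemma rscal_map_linear : linear rscal_map_fun.
Proof. by move=> a x y; exact: (linearP h). Qed.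
HB.instance Definition _ := GRing.isLinear.Build R (rscal f V) (rscal f V) _
  rscal_map_fun rscal_map_linear.
Definition rscal_map : {linear rscal f V -> rscal f V} := rscal_map_fun.
End RestrictScalarsMap.

Definition rscal_rep (R S : comNzRingType) (f : {rmorphism R -> S})
  (G : groupType) (V : lmodType S) (rho : group_rep G V) :
  group_rep G (rscal f V).
Proof.
exists (fun g => rscal_map f (rho g)) => [x|g h x].
  exact: (rep_act1 rho x).
exact: (rep_actM rho g h x).
Defined.

Section Lattice.
Variables (O : comNzRingType) (K : fieldType) (f : {rmorphism O -> K}).
Variable V : lmodType K.

Definition free_set (B : set V) : Prop :=
  forall (s : seq V) (c : V -> K), uniq s -> {in s, forall x, B x} ->
    \sum_(x <- s) c x *: x = 0 -> {in s, forall x, c x = 0}.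

Definition lin_span (C : set K) (B : set V) : set V :=
  [set x | exists2 s : seq (K * V), {in s, forall t, C t.1 /\ B t.2} &
             x = \sum_(t <- s) t.1 *: t.2].

(* L is the O-submodule generated by a K-basis of the subspace W. *)
Definition is_lattice (W : set V) (L : submodClosed (rscal f V)) : Prop :=
  exists B : set V, [/\ free_set B, W = lin_span setT B &
    forall x : rscal f V, x \in L <-> lin_span (range f) B x].
End Lattice.

(* Tate cohomology of the cyclic group of order l generated by s; then s^l = 1,
   so that the images below are contained in the kernels. *)

Section Tate.
Variables (O : comNzRingType) (M : lmodType O).
Variables (l : nat) (s : {linear M -> M}).

Definition one_sub_fun (x : M) : M := x - s x.
Lemma one_sub_linear : linear one_sub_fun.
Proof.
move=> a x y; rewrite /one_sub_fun linearP scalerBr opprD.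
by rewrite addrACA.
Qed.
HB.instance Definition _ := GRing.isLinear.Build O M M _
  one_sub_fun one_sub_linear.
Definition one_sub : {linear M -> M} := one_sub_fun.

Definition tate_norm_fun (x : M) : M := \sum_(i < l) iter i s x.
Lemma tate_norm_linear : linear tate_norm_fun.
Proof.
move=> a x y; rewrite /tate_norm_fun scaler_sumr -big_split /=.
by apply: eq_bigr => i _; elim: (nat_of_ord i) => //= n ->; rewrite linearP.
Qed.
HB.instance Definition _ := GRing.isLinear.Build O M M _
  tate_norm_fun tate_norm_linear.
Definition tate_norm : {linear M -> M} := tate_norm_fun.

Definition tate0 : lmodType O := subquot (ker_pred one_sub) (im_pred tate_norm).
Definition tate1 : lmodType O := subquot (ker_pred tate_norm) (im_pred one_sub).

(* Hence tate0 is a module over O / l O, and its O-submodules are its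
   O / l O-submodules. *)
Lemma tate0_torsion (x : tate0) : l%:R *: x = 0.
Proof.
have [y [Ay ->]] := subquotP x.
have sy : s y = y by apply/esym/eqP; rewrite -subr_eq0; exact: Ay.
rewrite (subquot_classZ _ Ay (rpredZ l%:R Ay)); apply/subquot_class_eq0/asboolP.
exists y; rewrite /tate_norm /= /tate_norm_fun (eq_bigr (fun=> y)).
  by rewrite sumr_const card_ord scaler_nat.
by move=> i _; elim: (nat_of_ord i) => //= n ->.
Qed.

Variables (G : groupType) (rho : group_rep G M).
Hypothesis rho_s : forall g x, s (rho g x) = rho g (s x).

Lemma ker_one_sub_stable : rep_stable rho (ker_pred one_sub).
Proof.
move=> g x; rewrite !inE /= /one_sub_fun => /eqP h.
by rewrite rho_s -linearB h linear0.
Qed.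

Lemma im_norm_stable : rep_stable rho (im_pred tate_norm).
Proof.
move=> g x /asboolP[y <-]; apply/asboolP; exists (rho g y).
rewrite /= /tate_norm_fun linear_sum; apply: eq_bigr => i _.
by elim: (nat_of_ord i) => //= n ->.
Qed.

Definition tate0_rep : group_rep G tate0 :=
  subquot_rep ker_one_sub_stable im_norm_stable.
End Tate.

Section Translation.
Variables (G : groupType) (K : fieldType).

Definition rtrans_fun (g : G) (f : G -> K^o) : G -> K^o :=
  fun x => f (x * g)%g.
Lemma rtrans_linear g :
  @GRing.linear_for K (G -> K^o) (G -> K^o) *:%R (rtrans_fun g).
Proof. by []. Qed.
HB.instance Definition _ g := GRing.isLinear.Build K (G -> K^o) (G -> K^o) _
  (rtrans_fun g) (rtrans_linear g).

Definition rtrans : group_rep G (G -> K^o).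
Proof.
exists (fun g => rtrans_fun g : {linear (G -> K^o) -> (G -> K^o)}) => [f|g h f].
  by apply/funext => x; rewrite /= /rtrans_fun mulg1.
by apply/funext => x; rewrite /= /rtrans_fun mulgA.
Defined.
End Translation.

(* Below, A is a central division F-algebra, j embeds K in A, and nrd : A -> K
   is only meaningful on the centralizer B of K, where it is the reduced norm. *)

Section DepthZero.
Variables (o : comNzRingType) (F : fieldType) (io : {rmorphism o -> F}).

Definition U1 (A : falgType F) : set A :=
  [set x | max_ideal (alg_map io A) (x - 1)].

Section Topology.
Variable A : falgType F.

(* The sets [cong a], for a nonzero, form a basis of neighbourhoods of 1. *)
Definition cong (a : F) : set (units A) :=
  [set u | exists2 y, integers (alg_map io A) y & uval u = 1 + a *: y].

Definition open_units (X : set (units A)) : Prop :=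
  forall x, X x -> exists2 a : F, a != 0 & forall u, cong a u -> X (x * u)%g.

Definition compact_units (X : set (units A)) : Prop :=
  forall (I : choiceType) (Y : I -> set (units A)),
    (forall i, open_units (Y i)) -> (forall x, X x -> exists i, Y i x) ->
    exists s : seq I, forall x, X x -> exists2 i, i \in s & Y i x.

Definition smooth_fun (K : Type) (f : units A -> K) : Prop :=
  exists2 a : F, a != 0 & forall g u, cong a u -> f (g * u)%g = f g.

Definition smooth_rep (K : fieldType) (V : lmodType K)
    (rho : group_rep (units A) V) : Prop :=
  forall x, exists2 a : F, a != 0 & forall u, cong a u -> rho u x = x.

Definition depth_zero (K : fieldType) (V : lmodType K)
    (rho : group_rep (units A) V) : Prop :=
  [/\ smooth_rep rho, rep_irreducible rho &
      forall u x, U1 (uval u) -> rho u x = x].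

Definition integral_rep (O : comNzRingType) (K : fieldType)
    (f : {rmorphism O -> K}) (V : lmodType K)
    (rho : group_rep (units A) V) : Prop :=
  exists2 L : submodClosed (rscal f V),
    is_lattice setT L & rep_stable (rscal_rep f rho) L.
End Topology.

(* A character of the multiplicative group, extended to K; its value at 0 is irrelevant. *)
Definition mult_character (K C : fieldType) (theta : K -> C) : Prop :=
  theta 1 = 1 /\
  forall x y, x != 0 -> y != 0 -> theta (x * y) = theta x * theta y.

Definition tame_pair (K : fieldExtType F) (C : fieldType) (theta : K -> C) :
    Prop :=
  [/\ unramified io K, mult_character theta,
      smooth_fun (fun x : units K => theta (uval x)) &
      forall x, U1 x -> theta x = 1].

Definition admissible (K : fieldExtType F) (C : fieldType) (theta : K -> C) :
    Prop :=
  forall g h : {lrmorphism K -> K},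
    (forall x, x != 0 -> theta (g x) = theta (h x)) -> g =1 h.

Section Induction.
Variables (K : fieldExtType F) (A : falgType F) (j : {lrmorphism K -> A}).

Definition centralizer : {vspace A} := 'C(limg (linfun j))%VS.

(* nrd is the reduced norm on B, the centralizer of K, as a central simple
   K-algebra: the determinant of phi, where phi is a morphism of K-algebras from
   B to the n x n matrices over a field extension of K, n^2 = [B : K]. *)
Definition reduced_norm (nrd : A -> K) : Prop :=
  exists (n : nat) (C : fieldType) (c : {rmorphism K -> C}) (phi : A -> 'M[C]_n),
    [/\ (n ^ 2 * \dim {:K})%N = \dim centralizer,
        {in centralizer &, forall x y,
          phi (x + y) = phi x + phi y /\ phi (x * y) = phi x *m phi y},
        (forall k, phi (j k) = (c k)%:M) &
        {in centralizer, forall b, c (nrd b) = \det (phi b)}].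

Variables (nrd : A -> K) (C : fieldType) (chi : K -> C).

Definition J_group : set (units A) :=
  [set x | exists b u, [/\ uval b \in centralizer, U1 (uval u) & x = b * u]%g].

(* The compact induction from J of the character b u |-> chi (nrd b). *)
Definition ind_space : set (units A -> C^o) :=
  [set f | [/\
    (forall b u g, uval b \in centralizer -> U1 (uval u) ->
       f (b * u * g)%g = chi (nrd (uval b)) * f g),
    smooth_fun f &
    exists2 X, compact_units X & forall g, f g != 0 ->
      exists x y, [/\ J_group x, X y & g = x * y]%g]].

(* rho is isomorphic to the representation by right translation on ind_space. *)
Definition ind_iso (V : lmodType C) (rho : group_rep (units A) V) : Prop :=
  exists phi : {linear V -> (units A -> C^o)},
    [/\ injective phi, range phi = ind_space &
      forall g x, phi (rho g x) = rtrans (units A) C g (phi x)].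

End Induction.
End DepthZero.

(* The norm of an extension of fields i : K -> L, as the determinant of
   multiplication in a K-basis of L. *)
Definition field_norm (K L : fieldType) (i : {rmorphism K -> L}) (N : L -> K) :
    Prop :=
  exists (n : nat) (b : 'I_n -> L),
    (forall y, exists! c : 'rV[K]_n, y = \sum_k i (c 0 k) * b k) /\
    forall y, exists2 M : 'M[K]_n,
      forall k, y * b k = \sum_m i (M k m) * b m & N y = \det M.

Definition central_division (F : fieldType) (D : falgType F) (d : nat) : Prop :=
  [/\ GRing.field_axiom D, 'Z({:D})%VS = 1%VS & \dim {:D} = (d ^ 2)%N].

(* The Galois action on D_E = D (x)_F E through the factor E, and on functions
   on its multiplicative group. *)

Section GaloisAction.
Variables (F : fieldType) (E : splittingFieldType F).
Variables (D : falgType F) (DE : falgType E) (iD : {rmorphism D -> DE}).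
Variable gD : gal_of {:E} -> {rmorphism DE -> DE}.

Definition galois_action : Prop :=
  forall g (e : E) x, gD g (e *: iD x) = g e *: iD x.

Variable C : fieldType.

Definition gal_fun_act (g : gal_of {:E}) (f : units DE -> C^o) :
  units DE -> C^o := fun x => f (units_map (gD g^-1%g) x).
Lemma gal_fun_linear g :
  @GRing.linear_for C (units DE -> C^o) (units DE -> C^o) *:%R (gal_fun_act g).
Proof. by []. Qed.
HB.instance Definition _ g := GRing.isLinear.Build C (units DE -> C^o)
  (units DE -> C^o) _ (gal_fun_act g) (gal_fun_linear g).
Definition gal_fun g : {linear (units DE -> C^o) -> (units DE -> C^o)} :=
  gal_fun_act g.

Definition restrict_rep (R : comNzRingType) (V : lmodType R)
  (rho : group_rep (units DE) V) : group_rep (units D) V.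
Proof.
exists (fun g => rho (units_map iD g)) => [x|g h x].
  by rewrite units_map1 rep_act1.
by rewrite units_mapM rep_actM.
Defined.

Hypothesis gDP : galois_action.

Lemma gal_fix g x : units_map (gD g) (units_map iD x) = units_map iD x.
Proof.
apply: val_inj => /=; have := gDP g 1 (uval x).
by rewrite rmorph1 !scale1r.
Qed.

Section OnLattice.
Variables (O : comNzRingType) (f : {rmorphism O -> C}).
Variable L : submodClosed (rscal f (units DE -> C^o)).
Hypothesis L_stable : rep_stable (rscal_rep f (rtrans (units DE) C)) L.
Hypothesis L_gal : forall g x, x \in L -> rscal_map f (gal_fun g) x \in L.

Definition lattice_rep : group_rep (units D) (submod L) :=
  restrict_rep (submod_rep L_stable).

Definition lattice_gal (g : gal_of {:E}) : {linear submod L -> submod L} :=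
  submod_map (L_gal g).

Lemma lattice_gal_rep s g x :
  lattice_gal s (lattice_rep g x) = lattice_rep g (lattice_gal s x).
Proof.
apply: val_inj; apply/funext => y /=.
by rewrite /gal_fun_act /rtrans_fun units_mapM gal_fix.
Qed.

Definition lattice_tate0_rep (l : nat) (s : gal_of {:E}) :
    group_rep (units D) (tate0 l (lattice_gal s)) :=
  tate0_rep l (lattice_gal_rep s).

Definition lattice_tate1 (l : nat) (s : gal_of {:E}) : lmodType O :=
  tate1 l (lattice_gal s).
End OnLattice.
End GaloisAction.

(* Main.v *)
(* The valuation of D_E restricts to that of D, because sigma fixes a
   uniformizer of D_E: either sigma acts nontrivially on the residue field, and
   then the trace of a suitable multiple of a uniformizer P is one, or
   sigma(P) / P reduces to an l-th root of unity coming from D, which is 1 since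
   l is prime to q^d - 1, and then the trace of P is one.
   Let w in D be a root of unity of order q^d - 1 and u a uniformizer with
   u w = w^N u.  Modulo 1 + p, sigma raises the units of D_E to a power n, and
   n = 1 modulo q^d - 1 since sigma fixes w.  The inducing character takes units
   of the centralizer of EK to (q^d - 1)-th roots of unity, so sigma acts
   trivially on Pi; hence H^1 = 0 and H^0 = L / l L.
   Let m be the least positive valuation on the centralizer of K, and
   lambda = theta(Nrd w).  A function f in Pi satisfies
   f(x w) = lambda^(l N^i) f(x) when x has valuation i modulo m.  The
   lambda^(N^i), i < m, are distinct: otherwise some pi(u^i), 0 < i < m, would
   be a nonscalar intertwiner of pi.  As the order of w is prime to l, the
   projectors onto its eigenspaces preserve L up to l L; the eigenspaces are
   lines over the discretely valued field of coefficients, with uniformizer l,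
   and u permutes them transitively, so L / l L is irreducible. *)
Require Import Defs.
From HB Require Import structures.
From mathcomp Require Import all_boot all_order all_algebra.
From mathcomp Require Import all_fingroup all_solvable all_field.
From mathcomp Require Import boolp classical_sets functions.
From mathcomp Require Import zify.

Set Implicit Arguments.
Unset Strict Implicit.
Unset Printing Implicit Defensive.
Import Order.TTheory GRing.Theory Num.Theory.
Local Open Scope classical_set_scope.
Local Open Scope ring_scope.

(** * Valuations on division algebras *)

(** The statement gives rings of integers as sets of integral elements and reduced norms through an
    unspecified splitting, so no valuation is available on [D] or [DE]. One is built on every
    division algebra over [F] from the determinant of right multiplication, and its ring is
    identified with the integral elements. The algebra [DE], a division algebra since [l] is prime
    to [d], is handled by the same results after restriction of scalars to [F]. The structure of [D]
    is proved rather than quoted: [w] and [u] come from limits of powers and from averaging over the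
    cyclic group of [w], whose order [q^d - 1] is congruent to -1 modulo the maximal ideal and hence
    invertible. The reduced norm of [w] is read off a characteristic polynomial having the
    conjugates of [w] as roots, which makes it computable in [D] and in [DE] at once. Coprimality of
    [l] and [q^d - 1] has a further use: the eigenvalues of [w] on Pi are [l]-th powers of the
    [lambda^(N^i)], and it keeps them distinct. Absolute irreducibility enters only there, through
    Schur's lemma over an algebraic closure. *)

Record divval (A : unitRingType) := DivVal {
  dv :> A -> int;
  dv_unit : forall x : A, x != 0 -> x \is a GRing.unit;
  dvM : forall x y : A, x != 0 -> y != 0 -> dv (x * y) = dv x + dv y;
  dvD : forall x y : A, x != 0 -> y != 0 -> x + y != 0 ->
    Num.min (dv x) (dv y) <= dv (x + y);
  dv_onto : exists2 x : A, x != 0 & dv x = 1 }.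

Definition field_dval (F : fieldType) (v : discrete_valuation F) : divval F :=
  DivVal (fun x x0 => etrans (unitfE x) x0) (@dvalM F v) (@dvalD F v)
    (dval_onto v).

Section DValTheory.
Variables (A : unitRingType) (V : divval A).
Implicit Types (x y : A) (N : int).

(** The disjunct [x == 0] stands for an infinite valuation, since the value of [V] at 0 is
    arbitrary. *)
Definition vge N : pred A := [pred x | (x == 0) || (N <= V x)].

Lemma unit_neq0 x : (x \is a GRing.unit) = (x != 0).
Proof.
apply/idP/idP => [|/(dv_unit V)//]; apply: contraTneq => ->.
by rewrite unitr0.
Qed.

Lemma mulf_neq0 x y : x != 0 -> y != 0 -> x * y != 0.
Proof. by rewrite -!unit_neq0 => ux uy; rewrite unitrMl. Qed.

Lemma exp_neq0 x n : x != 0 -> x ^+ n != 0.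
Proof. by rewrite -!unit_neq0 => ux; rewrite unitrX. Qed.

Lemma inv_neq0 x : x != 0 -> x^-1 != 0.
Proof. by rewrite -!unit_neq0 => ux; rewrite unitrV. Qed.

Lemma dmulVf x : x != 0 -> x^-1 * x = 1.
Proof. by rewrite -unit_neq0; exact: mulVr. Qed.

Lemma dmulfV x : x != 0 -> x * x^-1 = 1.
Proof. by rewrite -unit_neq0; exact: mulrV. Qed.

Lemma dv1 : V 1 = 0.
Proof.
by have := dvM V (oner_neq0 A) (oner_neq0 A); rewrite mulr1; move: (V 1); lia.
Qed.

Lemma dvN1 : V (- 1) = 0.
Proof.
have n0 : (- 1 : A) != 0 by rewrite oppr_eq0 oner_eq0.
by have := dvM V n0 n0; rewrite mulrNN mulr1 dv1; move: (V (- 1)); lia.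
Qed.

Lemma dvN x : x != 0 -> V (- x) = V x.
Proof.
by move=> x0; rewrite -mulN1r dvM ?dvN1 ?add0r// oppr_eq0 oner_eq0.
Qed.

Lemma dvV x : x != 0 -> V x^-1 = - V x.
Proof.
by move=> x0; have := dvM V x0 (inv_neq0 x0); rewrite dmulfV// dv1; lia.
Qed.

Lemma dvX x n : x != 0 -> V (x ^+ n) = V x *+ n.
Proof.
move=> x0; elim: n => [|n IH]; first by rewrite expr0 dv1 mulr0n.
by rewrite exprS dvM// ?exp_neq0// IH mulrS.
Qed.

Lemma vge0 N : vge N 0. Proof. by rewrite /vge /= eqxx. Qed.

Lemma vgeE N x : x != 0 -> vge N x = (N <= V x).
Proof. by rewrite /vge /= => /negPf ->. Qed.

Lemma vge_le M N x : M <= N -> vge N x -> vge M x.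
Proof.
have [->|x0] := eqVneq x 0; first by rewrite !vge0.
by rewrite !vgeE//; lia.
Qed.

Lemma vgeN N x : vge N (- x) = vge N x.
Proof. by rewrite /vge /= oppr_eq0; case: eqVneq => //= x0; rewrite dvN. Qed.

Lemma vgeD N x y : vge N x -> vge N y -> vge N (x + y).
Proof.
have [->|x0] := eqVneq x 0; first by rewrite add0r.
have [->|y0] := eqVneq y 0; first by rewrite addr0.
rewrite (vgeE _ x0) (vgeE _ y0) => hx hy; have [->|xy0] := eqVneq (x + y) 0; first exact: vge0.
by rewrite vgeE//; apply: le_trans (dvD V x0 y0 xy0); rewrite le_min hx hy.
Qed.

Lemma vgeB N x y : vge N x -> vge N y -> vge N (x - y).
Proof. by move=> hx hy; apply: vgeD; rewrite ?vgeN. Qed.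

Lemma vgeM M N x y : vge M x -> vge N y -> vge (M + N) (x * y).
Proof.
have [->|x0] := eqVneq x 0; first by rewrite mul0r !vge0.
have [->|y0] := eqVneq y 0; first by rewrite mulr0 !vge0.
by rewrite !vgeE ?mulf_neq0// dvM//; lia.
Qed.

Lemma vge0M x y : vge 0 x -> vge 0 y -> vge 0 (x * y).
Proof. by move=> hx hy; rewrite -[0]addr0; exact: vgeM. Qed.

Lemma vgeMl N x y : vge 0 x -> vge N y -> vge N (x * y).
Proof. by move=> hx hy; rewrite -[N]add0r; exact: vgeM. Qed.

Lemma vgeMr N x y : vge N x -> vge 0 y -> vge N (x * y).
Proof. by move=> hx hy; rewrite -[N]addr0; exact: vgeM. Qed.

Lemma vge1 : vge 0 1.
Proof. by rewrite vgeE ?oner_neq0// dv1. Qed.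

Lemma vgeX x n : vge 0 x -> vge 0 (x ^+ n).
Proof.
by move=> hx; elim: n => [|n IH]; rewrite ?vge1// exprS; exact: vge0M.
Qed.

Lemma vge_sum (I : Type) (r : seq I) (P : pred I) (f : I -> A) N :
  (forall i, P i -> vge N (f i)) -> vge N (\sum_(i <- r | P i) f i).
Proof. by move=> h; apply: (big_ind (fun x => vge N x)) => // [|x y]; [exact: vge0|exact: vgeD]. Qed.

Lemma vge_nat n : vge 0 n%:R.
Proof. by elim: n => [|n IH]; rewrite ?vge0// -natr1; apply: vgeD; rewrite ?vge1. Qed.

Lemma vge_sub_sym N x y : vge N (x - y) = vge N (y - x).
Proof. by rewrite -opprB vgeN. Qed.

Lemma vge_trans N x y z : vge N (x - y) -> vge N (y - z) -> vge N (x - z).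
Proof. by move=> h1 h2; have := vgeD h1 h2; rewrite addrA subrK. Qed.

Lemma vge_all0 x : (forall n : nat, vge n x) -> x = 0.
Proof.
move=> h; apply/eqP/negPn/negP => x0.
by have := h `|V x|%N.+1; rewrite vgeE//; lia.
Qed.

Lemma vge_eq0 N x : (forall n : nat, vge (N + n%:Z) x) -> x = 0.
Proof.
move=> h; apply: vge_all0 => n.
by apply: vge_le (h (n + `|N|)%N); lia.
Qed.

(** Equality case of the ultrametric inequality, applied to [y] as [x + (y - x)] and to [x] as
    [y - (y - x)]. *)
Lemma dv_near x y : x != 0 -> vge (V x + 1) (y - x) -> y != 0 /\ V y = V x.
Proof.
move=> x0; have [/subr0_eq -> //|d0 h] := eqVneq (y - x) 0.
have y0 : y != 0.
  by apply/eqP => y0; move: h; rewrite y0 sub0r vgeN vgeE//; lia.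
split=> //; rewrite vgeE// in h.
have h1 : Num.min (V x) (V (y - x)) <= V y.
  by have := dvD V x0 d0; rewrite addrC subrK; exact.
have nd0 : - (y - x) != 0 by rewrite oppr_eq0.
have h2 : Num.min (V y) (V (y - x)) <= V x.
  rewrite -(dvN d0); have := dvD V y0 nd0.
  by rewrite opprB addrC subrK; exact.
lia.
Qed.

Lemma vunit1 x : vge 1 (x - 1) -> x != 0 /\ V x = 0.
Proof.
by move=> h; have := @dv_near 1 x (oner_neq0 _); rewrite dv1 add0r; exact.
Qed.

Lemma vge_congM N x x' y y' : vge 0 x -> vge 0 y' -> vge N (x - x') ->
  vge N (y - y') -> vge N (x * y - x' * y').
Proof.
move=> hx hy h1 h2.
have -> : x * y - x' * y' = x * (y - y') + (x - x') * y'.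
  by rewrite mulrBr mulrBl addrA subrK.
by apply: vgeD; [exact: vgeMl|exact: vgeMr].
Qed.

Lemma vge_of_cong x y : vge 0 x -> vge 1 (y - x) -> vge 0 y.
Proof.
move=> hx h; rewrite -(subrK x y); apply: vgeD => //.
by apply: vge_le h.
Qed.

Lemma vge_congX N x x' n : 0 <= N -> vge 0 x -> vge N (x - x') ->
  vge N (x ^+ n - x' ^+ n).
Proof.
move=> N0 hx h; have hx' : vge 0 x'.
  have := vgeB hx (vge_le N0 h); by rewrite opprB addrC subrK.
elim: n => [|n IH]; first by rewrite subrr vge0.
by rewrite !exprS; apply: vge_congM => //; exact: vgeX.
Qed.

Lemma dv_unit_conj x y : y != 0 -> forall N, vge N (y * x * y^-1) = vge N x.
Proof.
move=> y0 N; have [->|x0] := eqVneq x 0; first by rewrite mulr0 mul0r.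
by rewrite !vgeE ?mulf_neq0 ?inv_neq0// !dvM ?mulf_neq0 ?inv_neq0// dvV//; congr (_ <= _); lia.
Qed.

Definition vunit x := (x != 0) && (V x == 0).

Lemma vunit_vge x : vunit x -> vge 0 x.
Proof. by case/andP => x0 /eqP h; rewrite vgeE// h. Qed.

Lemma vunit_cases x : vge 0 x -> vunit x \/ vge 1 x.
Proof.
have [->|x0] := eqVneq x 0; first by right; exact: vge0.
rewrite !vgeE// /vunit x0 /= => h.
by have [|] := eqVneq (V x) 0; [left|right; lia].
Qed.

Lemma vunitM x y : vunit x -> vunit y -> vunit (x * y).
Proof.
by move=> /andP[x0 /eqP hx] /andP[y0 /eqP hy]; rewrite /vunit mulf_neq0// dvM// hx hy.
Qed.

Lemma vunitV x : vunit x -> vunit x^-1.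
Proof. by move=> /andP[x0 /eqP hx]; rewrite /vunit inv_neq0// dvV// hx. Qed.

Lemma vunit_1 : vunit 1.
Proof. by rewrite /vunit oner_neq0 dv1 eqxx. Qed.

Lemma vunitX x n : vunit x -> vunit (x ^+ n).
Proof.
by move=> hx; elim: n => [|n IH]; rewrite ?vunit_1// exprS vunitM.
Qed.

Lemma vunit_neq0 x : vunit x -> x != 0. Proof. by case/andP. Qed.

Lemma vunit_U1 x : vge 1 (x - 1) -> vunit x.
Proof. by move=> /vunit1[x0 h]; rewrite /vunit x0 h eqxx. Qed.

Lemma vunit_near x y : vunit x -> vge 1 (y - x) -> vunit y.
Proof.
move=> /andP[x0 /eqP h] hyx; have := @dv_near x y x0.
by rewrite h add0r => /(_ hyx)[y0 e]; rewrite /vunit y0 e eqxx.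
Qed.

Lemma vunit_notP x : vunit x -> ~~ vge 1 x.
Proof. by case/andP => x0 /eqP h; rewrite vgeE// h. Qed.

Lemma dmulIf x y z : x != 0 -> y * x = z * x -> y = z.
Proof. by rewrite -unit_neq0 => /mulIr; exact. Qed.

Lemma dmulfI x y z : x != 0 -> x * y = x * z -> y = z.
Proof. by rewrite -unit_neq0 => /mulrI; exact. Qed.

End DValTheory.

(** Otherwise each [t] fails from some index [f t] on, and none is left at the sum of all [f t]. It
    provides compactness arguments over a finite residue field. *)
Lemma finite_pigeonhole (T : finType) (P : nat -> T -> Prop) :
  (forall C D t, (C <= D)%N -> P D t -> P C t) ->
  (forall C, exists t, P C t) -> exists t, forall C, P C t.
Proof.
move=> mono ex; apply: contrapT => no.
have /choice[f hf] : forall t, exists C, ~ P C t.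
  move=> t; apply: contrapT => nt; apply: no.
  by exists t => C; apply: contrapT => nP; apply: nt; exists C.
have [t ht] := ex (\sum_t f t)%N; apply: (hf t); apply: mono ht.
by rewrite (bigD1 t)//= leq_addr.
Qed.

(** * Determinants over a valued field *)

Section FieldValuation.
Variables (F : fieldType) (V : divval F).

Lemma vge_finite (I : finType) (f : I -> F) :
  exists C : nat, forall i, vge V (- C%:Z) (f i).
Proof.
exists (\sum_i `|V (f i)|)%N => i.
have [->|f0] := eqVneq (f i) 0; first exact: vge0.
rewrite vgeE// (bigD1 i)//=; move: (V (f i)) (\sum_(_ | _) _)%N; lia.
Qed.

Lemma vge_prod (I : Type) (r : seq I) (a : int) (x : I -> F) :
  (forall i, vge V a (x i)) -> vge V (a *+ size r) (\prod_(i <- r) x i).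
Proof.
move=> h; elim: r => [|i r IH]; first by rewrite big_nil mulr0n vge1.
by rewrite big_cons /= mulrS vgeM.
Qed.

Lemma vge_prodB (I : Type) (r : seq I) (a : int) (j : nat) (x y : I -> F) :
  (forall i, vge V a (x i)) -> (forall i, vge V (a + j%:Z) (x i - y i)) ->
  vge V (a *+ size r + j%:Z) (\prod_(i <- r) x i - \prod_(i <- r) y i).
Proof.
move=> hx hd.
have hy i : vge V a (y i).
  have -> : y i = x i - (x i - y i) by rewrite subKr.
  by apply: vgeB => //; apply: vge_le (hd i); lia.
elim: r => [|i r IH]; first by rewrite !big_nil subrr vge0.
rewrite !big_cons /=.
have -> (P Q : F) : x i * P - y i * Q = x i * (P - Q) + (x i - y i) * Q.
  by rewrite mulrBr mulrBl addrA subrK.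
apply: vgeD; first by rewrite mulrS -addrA vgeM.
by rewrite mulrS addrAC; apply: vgeM => //; exact: vge_prod.
Qed.

Lemma vge_sign N (b : nat) (x : F) : vge V N x -> vge V N ((-1) ^+ b * x).
Proof. by move=> h; apply: vgeMl => //; apply: vgeX; rewrite vgeN vge1. Qed.

Lemma vge_det n (a : int) (X : 'M[F]_n) :
  (forall i j, vge V a (X i j)) -> vge V (a *+ n) (\det X).
Proof.
move=> h; apply: vge_sum => s _; apply: vge_sign.
have := @vge_prod _ (enum 'I_n) a (fun i => X i (s i)) (fun i => h _ _).
by rewrite size_enum_ord big_enum.
Qed.

(** Continuity of the determinant with an explicit rate, by telescoping each product of the Leibniz
    formula. *)
Lemma vge_detB n (a : int) (k : nat) (X Y : 'M[F]_n) :
  (forall i j, vge V a (X i j)) -> (forall i j, vge V (a + k%:Z) (X i j - Y i j)) ->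
  vge V (a *+ n + k%:Z) (\det X - \det Y).
Proof.
move=> h h'; rewrite /determinant -sumrB; apply: vge_sum => s _.
rewrite -mulrBr; apply: vge_sign.
have := @vge_prodB _ (enum 'I_n) a k (fun i => X i (s i)) (fun i => Y i (s i))
  (fun i => h _ _) (fun i => h' _ _).
by rewrite size_enum_ord !big_enum.
Qed.

End FieldValuation.

Section LocalFieldFacts.
Variables (F : fieldType) (v : discrete_valuation F) (p q : nat).
Hypothesis hF : local_field v p q.
Local Notation V := (field_dval v).

Lemma local_limit (u : nat -> F) :
  (forall k : nat, vge V k%:Z (u k.+1 - u k)) ->
  exists x, forall k : nat, vge V k%:Z (x - u k).
Proof.
move=> h.
have hd (k m : nat) : vge V k%:Z (u (k + m)%N - u k).
  elim: m => [|m IH]; first by rewrite addn0 subrr vge0.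
  apply: vge_trans IH; rewrite addnS; apply: vge_le (h _); lia.
have hc : forall N : int, exists n0, forall m n, (n0 <= m)%N -> (n0 <= n)%N ->
       val_ge v N (u m - u n).
  move=> N; exists `|N|%N => m n hm hn; change (vge V N (u m - u n)).
  apply: (@vge_le _ _ _ `|N|%N%:Z); first by lia.
  apply: (@vge_trans _ _ _ _ (u `|N|%N)).
    by have := hd `|N|%N (m - `|N|)%N; rewrite subnKC.
  by rewrite vge_sub_sym; have := hd `|N|%N (n - `|N|)%N; rewrite subnKC.
have [x hx] := lf_complete hF hc.
exists x => k; have [n0 hn] := hx k%:Z.
have := hn (k + n0)%N (leq_addl _ _) => h1.
apply: vge_trans (hd k n0); rewrite vge_sub_sym; exact: h1.
Qed.

Lemma local_reps : exists s : 'I_q -> F, [/\ forall i, vge V 0 (s i),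
  forall x, vge V 0 x -> exists i, vge V 1 (x - s i) &
  forall i k, vge V 1 (s i - s k) -> i = k].
Proof.
have [s hs] := lf_residue_card hF.
exists (fun i => vring_val (s i)); split.
- by move=> i; exact: (valP (s i)).
- move=> x hx; have [i [hi _]] := hs (VRing hx); by exists i.
- move=> i k hik; have [i' [_ hi']] := hs (s i).
  have <- : i' = i by apply: hi'; rewrite subrr; exact: (vge0 V 1).
  exact: hi'.
Qed.

End LocalFieldFacts.

Lemma iter_choice (T : Type) (G : nat -> T -> Prop) (R : nat -> T -> T -> Prop) x0 :
  G 0%N x0 -> (forall j x, G j x -> exists y, R j x y /\ G j.+1 y) ->
  exists u : nat -> T, forall j, G j (u j) /\ R j (u j) (u j.+1).
Proof.
move=> G0 hs.
have /choice[f hf] : forall z : nat * T, exists y, G z.1 z.2 ->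
    R z.1 z.2 y /\ G z.1.+1 y.
  move=> -[j x].
  have [/hs[y hy]|no] := pselect (G j x); first by exists y.
  by exists x => /no.
pose u := fix u n := if n is m.+1 then f (m, u m) else x0.
have hu n : G n (u n) by elim: n => //= n /(hf (_, _))[].
by exists u => j; split=> //; have [] := hf (j, u j) (hu j).
Qed.

(** * The norm of a division algebra compared with its coordinate lattices *)

Section DivisionAlgebra.
Variables (F : fieldType) (v : discrete_valuation F) (p q : nat).
Hypothesis hF : local_field v p q.
Variables (A : falgType F).
Hypothesis hA : GRing.field_axiom A.

Local Notation V := (field_dval v).
Local Notation n := (\dim {:A}).
Local Notation b := (vbasis {:A}).
Local Notation c := (coord b).

Definition rmul_mx (x : A) : 'M[F]_n := \matrix_(i, j) c j (b`_i * x).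
(** The lattices [pi^N] times the integral span of a fixed basis. They are not multiplicative and
    match the valuation only up to bounded shifts. *)
Definition Lam (N : int) (x : A) := forall i, vge V N (c i x).
Definition Nm (x : A) := \det (rmul_mx x).

Lemma coordE x : x = \sum_i c i x *: b`_i.
Proof. by apply: coord_vbasis; rewrite memvf. Qed.

Lemma coord_sum (f : 'I_n -> F) i : c i (\sum_k f k *: b`_k) = f i.
Proof.
exact: (coord_sum_free _ _ (basis_free (vbasisP _))).
Qed.

Lemma rmul_mxM x y : rmul_mx (x * y) = rmul_mx x *m rmul_mx y.
Proof.
apply/matrixP => i j; rewrite !mxE mulrA {1}[b`_i * x]coordE.
rewrite mulr_suml linear_sum; apply: eq_bigr => k _.
by rewrite -scalerAl linearZ !mxE.
Qed.

Lemma rmul_mx_linear : linear rmul_mx.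
Proof.
by move=> a x y; apply/matrixP => i j; rewrite !mxE mulrDr -scalerAr linearP.
Qed.
HB.instance Definition _ := GRing.isLinear.Build F A 'M[F]_n _ rmul_mx rmul_mx_linear.

Lemma rmul_mx1 : rmul_mx 1 = 1%:M.
Proof.
by apply/matrixP => i j; rewrite !mxE mulr1 coord_free ?(basis_free (vbasisP _))// eq_sym.
Qed.

Lemma NmM x y : Nm (x * y) = Nm x * Nm y.
Proof. by rewrite /Nm rmul_mxM det_mulmx. Qed.

Lemma Nm1 : Nm 1 = 1. Proof. by rewrite /Nm rmul_mx1 det1. Qed.

Lemma Nm_neq0 x : x != 0 -> Nm x != 0.
Proof.
move=> /hA /mulrV e; apply/eqP => N0.
by have := NmM x x^-1; rewrite e Nm1 N0 mul0r => /eqP; rewrite oner_eq0.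
Qed.

Lemma NmX x k : Nm (x ^+ k) = Nm x ^+ k.
Proof. by elim: k => [|k IH]; rewrite ?expr0 ?Nm1// !exprS NmM IH. Qed.

Lemma NmZ a x : Nm (a *: x) = a ^+ n * Nm x.
Proof. by rewrite /Nm linearZ detZ. Qed.

Lemma dim_gt0 : (0 < n)%N.
Proof.
rewrite lt0n dimv_eq0; apply/eqP => /vspaceP /(_ 1).
by rewrite memvf memv0 oner_eq0.
Qed.

Lemma LamD N x y : Lam N x -> Lam N y -> Lam N (x + y).
Proof. by move=> hx hy i; rewrite linearD; apply: vgeD; [exact: hx|exact: hy]. Qed.
Lemma LamN N x : Lam N x -> Lam N (- x).
Proof. by move=> hx i; rewrite linearN vgeN; exact: hx. Qed.
Lemma LamB N x y : Lam N x -> Lam N y -> Lam N (x - y).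
Proof. by move=> hx /LamN hy; apply: LamD. Qed.
Lemma Lam0 N : Lam N 0.
Proof. by move=> i; rewrite linear0 vge0. Qed.
Lemma LamZ M N a x : vge V M a -> Lam N x -> Lam (M + N) (a *: x).
Proof. by move=> ha hx i; rewrite linearZ; apply: vgeM => //; exact: hx. Qed.
Lemma Lam_le M N x : M <= N -> Lam N x -> Lam M x.
Proof. by move=> h hx i; apply: vge_le (hx i). Qed.
Lemma Lam_sum N (I : Type) (r : seq I) (f : I -> A) :
  (forall i, Lam N (f i)) -> Lam N (\sum_(i <- r) f i).
Proof. by move=> h; apply: (big_ind (Lam N)) => //; [exact: Lam0|exact: LamD]. Qed.
Lemma Lam_basis i : Lam 0 (b`_i : A).
Proof.
move=> k; have [ki|] := ltnP i n.
  rewrite -[i]/(val (Ordinal ki)) coord_free ?(basis_free (vbasisP _))//.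
  by case: eqP => _; [exact: vge1|exact: vge0].
by move=> h; rewrite nth_default ?size_tuple// linear0 vge0.
Qed.

Lemma rmul_bound : exists C : nat, forall N x, Lam N x ->
  forall i j, vge V (N - C%:Z) (rmul_mx x i j).
Proof.
have [C hC] := vge_finite V (fun t : 'I_n * 'I_n * 'I_n =>
  rmul_mx (b`_t.1.1) t.1.2 t.2).
exists C => N x hx i j.
rewrite [x]coordE linear_sum summxE; apply: vge_sum => k _.
by rewrite linearZ mxE; apply: vgeM => //; exact: (hC (k, i, j)).
Qed.

Variables (pi : F).
Hypotheses (pi0 : pi != 0) (vpi : v pi = 1).

Lemma vpiX k : V (pi ^+ k) = k%:Z.
Proof. by rewrite dvX// [V pi]vpi natz. Qed.

Lemma vge_piX k : vge V k%:Z (pi ^+ k).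
Proof. by rewrite vgeE ?expf_neq0// vpiX. Qed.

Lemma Lam_pi_div k x : Lam k%:Z x -> exists2 y, Lam 0 y & x = pi ^+ k *: y.
Proof.
move=> hx; exists (pi ^- k *: x); last first.
  by rewrite scalerA mulfV ?expf_neq0// scale1r.
rewrite -[0](addNr k%:Z); apply: LamZ => //.
by rewrite vgeE ?invr_neq0 ?expf_neq0// dvV ?expf_neq0// vpiX.
Qed.

Lemma Lam_scale (k : int) : exists2 a, a != 0 & V a = k.
Proof.
case: k => k; first by exists (pi ^+ k); rewrite ?expf_neq0// vpiX.
exists (pi ^- k.+1); rewrite ?invr_neq0 ?expf_neq0//.
by rewrite dvV ?expf_neq0// vpiX NegzE.
Qed.

Lemma Lam_all0 N x : (forall k : nat, Lam (N + k%:Z) x) -> x = 0.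
Proof.
move=> h; rewrite [x]coordE big1// => i _.
by rewrite (@vge_eq0 _ V N (c i x)) ?scale0r// => k; exact: h.
Qed.

Lemma Lam_limit (N : int) (u : nat -> A) :
  (forall k : nat, Lam (N + k%:Z) (u k.+1 - u k)) ->
  exists x, forall k : nat, Lam (N + k%:Z) (x - u k).
Proof.
move=> h; have [a a0 va] := Lam_scale N.
have ha : vge V (- N) a^-1 by rewrite vgeE ?invr_neq0// dvV// va.
have hl i : exists x, forall k : nat, vge V k%:Z (x - a^-1 * c i (u k)).
  apply: (local_limit hF (u := fun k => a^-1 * c i (u k))) => k.
  rewrite -mulrBr -linearB -[k%:Z](addKr N).
  by apply: vgeM => //; exact: h.
have [x hx] := choice hl.
exists (\sum_i (a * x i) *: b`_i) => k i; rewrite linearB /= (coord_sum (fun i => a * x i)).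
have -> : a * x i - c i (u k) = a * (x i - a^-1 * c i (u k)).
  by rewrite mulrBr mulrA mulfV// mul1r.
by apply: vgeM => //; rewrite vgeE// va.
Qed.

Lemma Lam_digit (s : 'I_q -> F) :
  (forall x, vge V 0 x -> exists i, vge V 1 (x - s i)) ->
  forall x, Lam 0 x -> exists t : {ffun 'I_n -> 'I_q},
    Lam 1 (x - \sum_i s (t i) *: b`_i).
Proof.
move=> hs x hx.
have [t ht] := choice (fun i => hs _ (hx i)).
exists [ffun i => t i] => i; rewrite linearB /= (coord_sum (fun i => s ([ffun i => t i] i))) ffunE; exact: ht.
Qed.

(* By compactness of the unit sphere, otherwise [Nm] would vanish on it. *)
Lemma Nm_sphere : exists C : nat, forall x, Lam 0 x -> ~ Lam 1 x -> v (Nm x) < C%:Z.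
Proof.
apply: contrapT => no.
pose B C x := [/\ Lam 0 x, ~ Lam 1 x & vge V C (Nm x)].
have exB (C : nat) : exists x, B C%:Z x.
  apply: contrapT => nx; apply: no; exists C => x x0 x1.
  rewrite ltNge; apply/negP => hC; apply: nx; exists x; split=> //.
  by apply/orP; right.
have [s [s0 s1 _]] := local_reps hF.
(* [G j y]: the class of [y] modulo [pi^j] contains points of the sphere where the norm is
   arbitrarily small. One more digit can always be added, because one of the finitely many digits
   works for all [C]. *)
pose G j y := forall C : nat, exists2 x, B C%:Z x & Lam j%:Z (x - y).
have G0 : G 0%N 0.
  by move=> C; have [x hx] := exB C; exists x; rewrite // subr0; case: hx.
have step j y : G j y -> exists y', Lam j%:Z (y' - y) /\ G j.+1 y'.
  move=> Gy; pose Y (t : {ffun 'I_n -> 'I_q}) := pi ^+ j *: \sum_i s (t i) *: b`_i.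
  have [||t ht] := @finite_pigeonhole _
      (fun C t => exists2 x, B C%:Z x & Lam j.+1%:Z (x - (y + Y t))).
  - move=> C D t CD [x [h0 h1 h2] hx]; exists x => //; split=> //.
    by apply: vge_le h2; lia.
  - move=> C; have [x hx hd] := Gy C; have [z z0 ez] := Lam_pi_div hd.
    have [t ht] := Lam_digit s1 z0; exists t, x => //.
    rewrite opprD addrA ez -scalerBr -addn1 PoszD.
    by apply: LamZ => //; exact: vge_piX.
  exists (y + Y t); split=> //; rewrite addrC addKr -[j%:Z]addr0.
  apply: LamZ; first exact: vge_piX.
  apply: Lam_sum => i; rewrite -[0]addr0; apply: LamZ => //; exact: Lam_basis.
have [u hu] := iter_choice G0 step.
have [|y hy] := @Lam_limit 0 u; first by move=> k; rewrite add0r; case: (hu k).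
have hy' (k : nat) : Lam k%:Z (y - u k) by have := hy k; rewrite add0r.
have near (k : nat) : exists2 x, B k%:Z x & Lam k%:Z (y - x).
  have [x hx hd] := (hu k).1 k; exists x => //.
  have -> : y - x = (y - u k) - (x - u k) by rewrite opprB addrA subrK.
  exact: LamB.
have y0 : Lam 0 y.
  by have [x [h _ _] hd] := near 0%N; rewrite -(subrK x y); exact: LamD.
have y1 : ~ Lam 1 y.
  have [x [_ h _] hd] := near 1%N => y1; apply: h.
  by rewrite -[x](subKr y); exact: LamB.
have yn0 : y != 0 by apply/eqP => e; apply: y1; rewrite e; exact: Lam0.
have [C hC] := rmul_bound.
(* By continuity of the determinant, [y] inherits arbitrarily small norms from nearby points of the
   sphere. *)
have : Nm y = 0.
  apply: (@vge_eq0 _ V ((- C%:Z) *+ n)) => k.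
  have [x [hx _ hNx] hd] := near k.
  rewrite -(subrK (Nm x) (Nm y)); apply: vgeD.
    apply: vge_detB => i j; first by rewrite -sub0r; exact: hC.
    have -> : rmul_mx y i j - rmul_mx x i j = rmul_mx (y - x) i j.
      by rewrite linearB !mxE.
    by rewrite addrC; exact: hC.
  apply: vge_le hNx; rewrite mulNrn; move: (_ *+ n) (mulrn_wge0 n (isT : 0 <= C%:Z)).
  by move=> ?; lia.
by apply/eqP; exact: Nm_neq0.
Qed.

Lemma Lam_some x : exists N, Lam N x.
Proof.
have [C hC] := vge_finite V (fun i => c i x).
by exists (- C%:Z).
Qed.

Lemma Lam_max x : x != 0 -> exists2 N, Lam N x & ~ Lam (N + 1) x.
Proof.
move=> x0; have [N hN] := Lam_some x.
apply: contrapT => no; move/eqP: x0; apply; apply: (@Lam_all0 N) => k.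
elim: k => [|k IH]; first by rewrite addr0.
apply: contrapT => h; apply: no; exists (N + k%:Z) => //.
by rewrite -addrA -PoszD addn1.
Qed.

Lemma Nm_lower : exists C : nat, forall N x, Lam N x ->
  vge V (N *+ n - C%:Z) (Nm x).
Proof.
have [C hC] := rmul_bound; exists (C * n)%N => N x hx.
have -> : N *+ n - (C * n)%N%:Z = (N - C%:Z) *+ n.
  by rewrite mulrnBl PoszM; congr (_ - _); rewrite -mulr_natr natz.
by apply: vge_det; exact: hC.
Qed.

(** Rescaling [x] to the unit sphere reduces to [Nm_sphere]. With [Nm_lower], the filtration by the
    norm and the lattices [Lam] agree up to bounded shifts. *)
Lemma Nm_upper : exists C : nat, forall N x,
  x != 0 -> N *+ n <= v (Nm x) -> Lam (N - C%:Z) x.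
Proof.
have [C hC] := Nm_sphere; exists C => N x x0 hN.
have [M hM hM1] := Lam_max x0.
have [a a0 va] := Lam_scale (- M).
have h0 : Lam 0 (a *: x) by rewrite -(addNr M); apply: LamZ => //; rewrite vgeE// va.
have h1 : ~ Lam 1 (a *: x).
  move=> h; apply: hM1; rewrite -[x](scalerK a0).
  by apply: LamZ => //; rewrite vgeE ?invr_neq0// dvV// va opprK.
have := hC _ h0 h1; rewrite NmZ.
have -> : v (a ^+ n * Nm x) = V (a ^+ n * Nm x) by [].
rewrite dvM ?expf_neq0 ?Nm_neq0// dvX// va [V (Nm x)]/= mulNrn => h.
apply: Lam_le hM; have n0 := dim_gt0.
rewrite lerBlDr; rewrite leNgt; apply/negP => MN.
have : (M + C%:Z) *+ n <= N *+ n by rewrite lerMn2r; apply/orP; right; lia.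
rewrite mulrnDl; have : C%:Z <= C%:Z *+ n.
  by rewrite -mulr_natr natz ler_peMr; lia.
move: (M *+ n) (C%:Z *+ n) (N *+ n) h hN; move: (v (Nm x)); lia.
Qed.

End DivisionAlgebra.

(** * The valuation of a division algebra over a local field *)

(* [e] is the ramification index; the finite system represents the classes
   modulo a uniformizer of [F]. *)
Record alg_val (F : fieldType) (v : discrete_valuation F) (A : falgType F)
    (V : divval A) (e : nat) : Prop := AlgVal {
  av_gt0 : (0 < e)%N;
  av_base : forall a : F, a != 0 -> V (a%:A) = v a *+ e;
  av_limit : forall u : nat -> A, (forall k : nat, vge V k%:Z (u k.+1 - u k)) ->
    exists x, forall k : nat, vge V k%:Z (x - u k);
  av_finite : exists s : seq A, forall x, vge V 0 x ->
    exists2 y, y \in s & vge V e%:Z (x - y) }.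

Section Construction.
Variables (F : fieldType) (v : discrete_valuation F) (p q : nat).
Hypothesis hF : local_field v p q.
Variables (A : falgType F).
Hypothesis hA : GRing.field_axiom A.
Variables (pi : F).
Hypotheses (pi0 : pi != 0) (vpi : v pi = 1).

Local Notation V := (field_dval v).
Local Notation n := (\dim {:A}).
Local Notation b := (vbasis {:A}).
Local Notation V0 x := (V (Nm (x : A))).

Lemma A_mulf_neq0 (x y : A) : x != 0 -> y != 0 -> x * y != 0.
Proof.
by move=> /hA ux /hA uy; apply/eqP => xy0; have := unitrMl x uy; rewrite xy0 ux unitr0.
Qed.

Lemma A_exp_neq0 (x : A) k : x != 0 -> x ^+ k != 0.
Proof.
by move=> x0; elim: k => [|k IH]; rewrite ?expr0 ?oner_neq0// exprS A_mulf_neq0.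
Qed.

Lemma A_inv_neq0 (x : A) : x != 0 -> x^-1 != 0.
Proof.
by move=> /hA ux; apply/eqP => e; have := unitrV x; rewrite e ux unitr0.
Qed.

Lemma V0M x y : x != 0 -> y != 0 -> V0 (x * y) = V0 x + V0 y.
Proof. by move=> x0 y0; rewrite NmM dvM// Nm_neq0. Qed.

Lemma V0V x : x != 0 -> V0 (x^-1) = - V0 x.
Proof.
move=> x0; have := V0M x0 (A_inv_neq0 x0); rewrite mulrV ?hA// Nm1 dv1.
by move: (V0 x) (V0 _); lia.
Qed.

Lemma V0X x k : x != 0 -> V0 (x ^+ k) = V0 x *+ k.
Proof. by move=> x0; rewrite NmX dvX// Nm_neq0. Qed.

Lemma V0_scalar a : a != 0 -> V0 (a%:A) = v a *+ n.
Proof. by move=> a0; rewrite NmZ Nm1 mulr1 dvX. Qed.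

(* The binomials are integral, so the powers of [1 + x] are as bounded as those
   of [x]. *)
Lemma V0_ultra1 x : x != 0 -> 1 + x != 0 -> 0 <= V0 x -> 0 <= V0 (1 + x).
Proof.
move=> x0 y0 hx.
have [C hC] := Nm_upper hF hA pi0 vpi.
have [C' hC'] := Nm_lower v A.
have hX k : Lam v (- C%:Z) (x ^+ k).
  rewrite -[- _]add0r; apply: hC; rewrite ?A_exp_neq0//.
  by rewrite mul0rn -[v _]/(V0 _) V0X// mulrn_wge0.
have hY k : Lam v (- C%:Z) ((1 + x) ^+ k).
  rewrite exprDn_comm; last exact: commr_sym (commr1 x).
  apply: Lam_sum => i; rewrite expr1n mul1r -scaler_nat -[- _]add0r.
  by apply: LamZ => //; exact: vge_nat.
have hV k : - (C%:Z *+ n) - C'%:Z <= V0 (1 + x) *+ k.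
  have := hC' _ _ (hY k); rewrite vgeE ?Nm_neq0 ?A_exp_neq0//.
  by rewrite -V0X// mulNrn.
rewrite leNgt; apply/negP => neg.
(* A negative valuation multiplied by this exponent would pass below the bound. *)
have := hV `|(C%:Z *+ n + C'%:Z + 1)%R|%N.
have : 0 <= C%:Z *+ n by rewrite mulrn_wge0.
rewrite -[_ *+ `|_|]mulr_natr natz; move: (C%:Z *+ n) (V0 _) neg => B X; nia.
Qed.

Lemma V0_ultra x y : x != 0 -> y != 0 -> x + y != 0 ->
  Num.min (V0 x) (V0 y) <= V0 (x + y).
Proof.
wlog le : x y / V0 x <= V0 y => [hw x0 y0 xy0|x0 y0 xy0].
  have [hxy|] := boolP (V0 x <= V0 y); first exact: hw.
  rewrite -ltNge => /ltW hxy; rewrite minC addrC.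
  by apply: hw => //; rewrite addrC.
have e : x + y = x * (1 + x^-1 * y) by rewrite mulrDr mulr1 mulrA mulrV ?hA// mul1r.
have z0 : x^-1 * y != 0 by rewrite A_mulf_neq0 ?A_inv_neq0.
have z1 : 1 + x^-1 * y != 0.
  by apply/eqP => h1; move/eqP: xy0; apply; rewrite e h1 mulr0.
have h : 0 <= V0 (x^-1 * y) by rewrite V0M ?A_inv_neq0// V0V// addrC subr_ge0.
have := V0_ultra1 z0 z1 h; rewrite e V0M//.
by move: le; move: (V0 (1 + _)) (V0 x) (V0 y) => a b c; lia.
Qed.

(** The value group contains [n], the value of [pi], so it has a least positive element, which
    generates it by division with remainder. *)
Lemma V0_generator : exists2 w : A, w != 0 & 0 < V0 w /\
  forall x, x != 0 -> exists k, V0 x = k * V0 w.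
Proof.
have [m [hm min]] : exists m : nat, (exists2 w : A, w != 0 & V0 w = m.+1%:Z) /\
    forall k : nat, (exists2 w : A, w != 0 & V0 w = k.+1%:Z) -> (m <= k)%N.
  have ex : exists m : nat, `[< exists2 w : A, w != 0 & V0 w = m.+1%:Z >].
    exists n.-1; apply/asboolP; exists (pi%:A).
      by rewrite scaler_eq0 negb_or pi0 oner_eq0.
    by rewrite V0_scalar// vpi prednK ?dim_gt0 ?natz.
  case: (ex_minnP ex) => m /asboolP hm min; exists m; split=> // k hk.
  by apply: min; apply/asboolP.
have [w w0 hw] := hm; exists w => //; split=> [|x x0]; first by rewrite hw.
suff e : (V0 x %% V0 w)%Z = 0.
  exists (V0 x %/ V0 w)%Z; have := divz_eq (V0 x) (V0 w).
  by rewrite e addr0.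
have := divz_eq (V0 x) (V0 w); rewrite {1}hw.
have : 0 <= (V0 x %% V0 w)%Z by rewrite modz_ge0// hw.
have : (V0 x %% V0 w)%Z < V0 w by rewrite ltz_pmod// hw.
move: (_ %% _)%Z (_ %/ _)%Z => r k r1 r0 e.
have [z0|rn] := eqVneq r 0; first by [].
have key (y : A) : y != 0 -> V0 y = r -> False.
  move=> y0 hy; have := min `|r|.-1; have -> : (`|r|.-1.+1 = `|r|)%N by lia.
  move=> /(_ _)/wrap[]; first by exists y; rewrite // hy gez0_abs.
  by move: r1; rewrite hw; lia.
have wX (j : nat) : V0 (w ^+ j) = V0 w * j%:Z by rewrite V0X// -mulr_natr natz.
case: k e => k e.
  have wk0 := A_exp_neq0 k w0; case: (key (x * (w ^+ k)^-1)).
    by rewrite A_mulf_neq0 ?A_inv_neq0.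
  by rewrite V0M ?A_inv_neq0// V0V// wX e hw; lia.
have wk0 := A_exp_neq0 k.+1 w0; case: (key (x * (w ^+ k.+1))).
  by rewrite A_mulf_neq0.
by rewrite V0M// wX e hw NegzE; lia.
Qed.

Lemma finite_lattice (M : nat) N : exists s : seq A, forall x, Lam v N x ->
  exists2 y, y \in s & Lam v (N + M%:Z) (x - y).
Proof.
have [s [s0 s1 _]] := local_reps hF.
elim: M => [|M [r hr]].
  by exists [:: 0] => x hx; exists 0; rewrite ?mem_head// addr0 subr0.
have [a a0 va] := Lam_scale pi0 vpi (N + M%:Z).
pose d (t : {ffun 'I_n -> 'I_q}) := a *: \sum_i s (t i) *: b`_i.
exists [seq y + d t | y <- r, t <- enum {ffun 'I_n -> 'I_q}] => x /hr[y yr hd].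
have h0 : Lam v 0 (a^-1 *: (x - y)).
  rewrite -(addNr (N + M%:Z)); apply: LamZ => //.
  by rewrite vgeE ?invr_neq0// dvV// va.
have [t ht] := Lam_digit s1 h0; exists (y + d t).
  by apply/allpairsP; exists (y, t); rewrite mem_enum.
have -> : x - (y + d t) = a *: (a^-1 *: (x - y) - \sum_i s (t i) *: b`_i).
  by rewrite scalerBr scalerA mulfV// scale1r opprD addrA.
rewrite -addn1 PoszD addrA; apply: LamZ => //.
by rewrite vgeE// va.
Qed.

(** The valuation of the norm is divided by the generator of its value group. Completeness and
    finiteness of residue classes are carried over from the coordinate lattices by the comparisons
    [T1] and [T2]. *)
Lemma alg_val_exists : exists (VA : divval A) (e : nat), alg_val v VA e.
Proof.
have [w w0 [hw gen]] := V0_generator.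
have [f fE] : exists f : A -> int, forall x, x != 0 -> V0 x = f x * V0 w.
  exists (fun x => (V0 x %/ V0 w)%Z) => x /gen[k e].
  by rewrite e mulzK// gt_eqF.
have w1 : f w = 1.
  by apply: (@mulIf _ (V0 w)); rewrite ?gt_eqF// mul1r -fE.
have fM x y : x != 0 -> y != 0 -> f (x * y) = f x + f y.
  move=> x0 y0; apply: (@mulIf _ (V0 w)); first by rewrite gt_eqF.
  by rewrite mulrDl -(fE x x0) -(fE y y0) -(fE (x * y)) ?A_mulf_neq0// V0M.
have fD x y : x != 0 -> y != 0 -> x + y != 0 ->
    Num.min (f x) (f y) <= f (x + y).
  move=> x0 y0 xy0; have := V0_ultra x0 y0 xy0.
  rewrite (fE x x0) (fE y y0) (fE _ xy0).
  rewrite !ge_min => /orP[] h; apply/orP; [left|right];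
    by rewrite -(ler_pM2r hw).
have ux (x : A) : x != 0 -> x \is a GRing.unit by exact: hA.
have onto : exists2 x : A, x != 0 & f x = 1 by exists w.
pose VA := DivVal ux fM fD onto.
have VAE x : VA x = f x by [].
have pA0 : pi%:A != 0 :> A by rewrite scaler_eq0 negb_or pi0 oner_eq0.
have hpi : f pi%:A * V0 w = n%:Z by rewrite -fE// V0_scalar// vpi natz.
have [e he] : exists e : nat, f pi%:A = e%:Z.
  by exists `|f pi%:A|%N; move: hpi; have := dim_gt0 A; move: (f _) (V0 w) hw; nia.
rewrite he in hpi.
have e0 : (0 < e)%N by have := dim_gt0 A; move: (V0 w) hw hpi; nia.
have [C hC] := Nm_upper hF hA pi0 vpi.
have [C' hC'] := Nm_lower v A.
have T2 N x : vge VA (N * e%:Z) x -> Lam v (N - C%:Z) x.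
  have [->|x0] := eqVneq x 0; first by move=> _; exact: Lam0.
  rewrite vgeE// => h; apply: hC => //; rewrite -[v _]/(V0 _) fE//.
  rewrite -mulr_natr natz -hpi mulrA ler_pM2r//.
have T1 N x : Lam v N x -> vge VA (N * e%:Z - C'%:Z) x.
  have [-> _|x0 /hC'] := eqVneq x 0; first exact: vge0.
  rewrite !vgeE ?Nm_neq0// VAE fE// -mulr_natr natz -hpi mulrA.
  by move: (N * e%:Z) (V0 w) hw (f x) => a c hc d; nia.
exists VA, e; split=> //.
- move=> a a0; apply: (@mulIf _ (V0 w)); first by rewrite gt_eqF.
  rewrite -fE ?V0_scalar//; last by rewrite scaler_eq0 negb_or a0 oner_eq0.
  by rewrite -[in RHS]mulr_natr natz -mulrA hpi -mulr_natr natz.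
- move=> u hu.
  have hd (k m : nat) : vge VA k%:Z (u (k + m)%N - u k).
    elim: m => [|m IH]; first by rewrite addn0 subrr vge0.
    apply: vge_trans IH; rewrite addnS; apply: vge_le (hu _); lia.
  have hd' (k m : nat) : (k <= m)%N -> vge VA k%:Z (u m - u k).
    by move=> km; have := hd k (m - k)%N; rewrite subnKC.
  have [|x hx] := @Lam_limit _ _ _ _ hF A _ pi0 vpi (- C%:Z) (fun k => u (k * e)%N).
    move=> k; rewrite addrC; apply: T2; rewrite -PoszM; apply: hd'.
    by rewrite leq_mul2r leqnSn orbT.
  (* The index leaves room for the losses [C] and [C'] of the two comparisons. *)
  exists x => j; pose k := (j + C + C')%N.
  apply: (@vge_trans _ _ _ _ (u (k * e)%N)).
    by apply: vge_le (T1 _ _ (hx k)); rewrite /k; nia.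
  by apply: hd'; rewrite /k; nia.
(* From level [- C], depth [C + C' + 1] ends at level [C' + 1], where the valuation is at least
   [(C' + 1) e - C' >= e]. *)
- have [s hs] := finite_lattice (C + C' + 1) (- C%:Z).
  exists s => x hx; have [|y ys hy] := hs x.
    by rewrite -[- _]add0r; apply: T2; rewrite mul0r.
  by exists y => //; apply: vge_le (T1 _ _ hy); nia.
Qed.

End Construction.

Lemma int_mul_ge (n : int) (m : nat) : 1 <= n * m%:Z -> m%:Z <= n * m%:Z.
Proof.
move=> h; have [n0|n1] := lerP n 0; last by nia.
have : n * m%:Z <= 0 by nia.
lia.
Qed.

Lemma intmulnE (c : int) (k : nat) : c *+ k = c * k%:Z.
Proof. by rewrite -mulr_natr natz. Qed.

Lemma mulz_lt_nat (c : int) (j k : nat) : c < 0 -> (j < k)%N ->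
  c * k%:Z + 1 <= c * j%:Z.
Proof.
move=> c0 jk; have [m ->] : exists m, k = (j + m.+1)%N by exists (k - j.+1)%N; lia.
nia.
Qed.

(** If [V x < 0], the leading term of a monic equation has strictly smaller valuation than all the
    others. *)
Lemma integral_vge (A : unitRingType) (V : divval A) (R : nzRingType)
    (f : {rmorphism R -> A}) (x : A) :
  (forall r, vge V 0 (f r)) -> integralOver f x -> vge V 0 x.
Proof.
move=> hf [P Pm /rootP]; have [->|x0] := eqVneq x 0; first by rewrite vge0.
rewrite horner_coef size_map_poly_id0; last first.
  by rewrite (monicP Pm) rmorph1 oner_neq0.
have P0 : size P != 0%N by rewrite size_poly_eq0 monic_neq0.
move: Pm; rewrite monicE lead_coefE; case: (size P) P0 => // k _ /= /eqP Pk.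
have fE i : (map_poly f P)`_i = f P`_i by rewrite coef_map.
have f1 : f 1 = 1 by exact: rmorph1.
rewrite big_ord_recr /= fE Pk f1 mul1r => e.
rewrite vgeE//; apply: contraT; rewrite -ltNge => neg.
have : vge V (V x *+ k + 1) (x ^+ k).
  rewrite -[x ^+ k](addKr (\sum_(i < k) (map_poly f P)`_i * x ^+ i)) e addr0 vgeN.
  apply: vge_sum => i _; rewrite fE; apply: vgeMl => //.
  rewrite vgeE ?(exp_neq0 V)// dvX//.
  rewrite !intmulnE; move: (V x) (nat_of_ord i) (ltn_ord i) neg => c j jk neg.
  exact: mulz_lt_nat.
by rewrite vgeE ?(exp_neq0 V)// dvX//; move: (V x *+ k); lia.
Qed.

(** * The valuation ring as the ring of integral elements *)

Section ValuedAlgebra.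
Variables (F : fieldType) (v : discrete_valuation F) (p q : nat).
Hypothesis hF : local_field v p q.
Variables (pi : F).
Hypotheses (pi0 : pi != 0) (vpi : v pi = 1).
Local Notation vF := (field_dval v).

Section One.
Variables (A : falgType F) (V : divval A) (e : nat).
Hypothesis av : alg_val v V e.

Lemma vgeZ M N a x : vge vF M a -> vge V N x -> vge V (M *+ e + N) (a *: x).
Proof.
have [-> _ _|a0 ha hx] := eqVneq a 0; first by rewrite scale0r vge0.
rewrite -mulr_algl; apply: vgeM => //.
rewrite vgeE ?scaler_eq0 ?negb_or ?a0 ?oner_neq0// (av_base av a0).
by rewrite lerMn2r -(vgeE vF _ a0) ha orbT.
Qed.

Lemma vge0Z a N x : vge vF 0 a -> vge V N x -> vge V N (a *: x).
Proof. by move=> ha hx; have := vgeZ ha hx; rewrite mul0rn add0r. Qed.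

Lemma vge_alg N a : vge V (N *+ e) (a%:A) = vge vF N a.
Proof.
have [->|a0] := eqVneq a 0; first by rewrite scale0r !vge0.
rewrite !vgeE// ?scaler_eq0 ?negb_or ?a0 ?oner_neq0// (av_base av a0).
rewrite lerMn2r; have -> : (e == 0)%N = false by case: (e) (av_gt0 av).
by [].
Qed.

Lemma vge0_alg a : vge V 0 (a%:A) = vge vF 0 a.
Proof. by rewrite -vge_alg mul0rn. Qed.

Lemma alg_neq0 a : a != 0 -> a%:A != 0 :> A.
Proof. by move=> a0; rewrite scaler_eq0 negb_or a0 oner_neq0. Qed.

Lemma V_pi : V (pi%:A) = e%:Z.
Proof. by rewrite (av_base av pi0) vpi natz. Qed.

Lemma vge_pi_quot (k : nat) x : vge V (k%:Z *+ e) x ->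
  exists2 y, vge V 0 y & x = pi ^+ k *: y.
Proof.
move=> hx; exists (pi ^- k *: x); last first.
  by rewrite scalerA mulfV ?expf_neq0// scale1r.
rewrite -[0](addNr (k%:Z *+ e)) -mulNrn; apply: vgeZ => //.
rewrite vgeE ?invr_neq0 ?expf_neq0// dvV ?expf_neq0// dvX//.
by rewrite [vF pi]vpi natz.
Qed.

Lemma vge_piXZ (k : nat) x : vge V 0 x -> vge V k%:Z (pi ^+ k *: x).
Proof.
move=> hx; have := @vgeZ k%:Z 0 (pi ^+ k) x; rewrite addr0 => h.
apply: vge_le (h _ hx); last by rewrite vgeE ?expf_neq0// dvX// [vF pi]vpi natz.
rewrite intmulnE; have := av_gt0 av; nia.
Qed.

(* Successive approximation modulo powers of [pi]. *)
Lemma series_span (I : finType) (b : I -> A) (B : A -> Prop) :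
  (forall i, vge V 0 (b i)) ->
  (forall x, B x -> vge V 0 x -> exists a : I -> F, (forall i, vge vF 0 (a i)) /\
     exists2 y, B y /\ vge V 0 y & x = \sum_i a i *: b i + pi *: y) ->
  forall x, B x -> vge V 0 x -> exists a : I -> F,
    (forall i, vge vF 0 (a i)) /\ x = \sum_i a i *: b i.
Proof.
move=> hb hB x Bx x0.
pose G (k : nat) (z : {ffun I -> F} * A) :=
  [/\ forall i, vge vF 0 (z.1 i), B z.2 /\ vge V 0 z.2 &
      x = \sum_i z.1 i *: b i + pi ^+ k *: z.2].
pose R (k : nat) (z w : {ffun I -> F} * A) := forall i, vge vF k%:Z (w.1 i - z.1 i).
have piX (k : nat) : vge vF k%:Z (pi ^+ k) by exact: vge_piX.
have [||u hu] := @iter_choice _ G R ([ffun => 0], x).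
- split=> //= [i|]; first by rewrite ffunE vge0.
  by rewrite scale1r big1 ?add0r// => i _; rewrite ffunE scale0r.
- move=> k [c y] [/= hc [By y0] ex].
  have [a [ha [z [Bz z0] ey]]] := hB y By y0.
  have ha' i : vge vF k%:Z (pi ^+ k * a i) by apply: vgeMr.
  exists ([ffun i => c i + pi ^+ k * a i], z); split=> /=.
    by move=> i; rewrite ffunE addrC addKr.
  split=> //= [i|]; first by rewrite ffunE; apply: vgeD => //; apply: vge_le (ha' i).
  rewrite ex ey scalerDr addrA scalerA -exprSr; congr (_ + _).
  rewrite scaler_sumr -big_split; apply: eq_bigr => i _.
  by rewrite ffunE scalerDl scalerA.
have hl i : exists l, forall k : nat, vge vF k%:Z (l - (u k).1 i).
  apply: (local_limit hF (u := fun k => (u k).1 i)) => k.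
  by have [_ h] := hu k; exact: h.
have [a ha] := choice hl.
exists a; split=> [i|].
  have := ha i 0%N => h; rewrite -(subrK ((u 0%N).1 i) (a i)); apply: vgeD => //.
  by have [[]] := hu 0%N.
apply/eqP; rewrite -subr_eq0; apply/eqP; apply: (@vge_all0 _ V) => k.
have [[h0 [_ y0] ex] _] := hu k; rewrite {1}ex addrAC -sumrB.
apply: vgeD; last exact: vge_piXZ.
apply: vge_sum => i _; rewrite -scalerBl -[k%:Z]addr0.
apply: (@vge_le _ _ _ (k%:Z *+ e + 0)).
  by rewrite intmulnE; have := av_gt0 av; nia.
by apply: vgeZ => //; rewrite vge_sub_sym.
Qed.

(** For the converse, finitely many residue representatives span the valuation ring over that of
    [F]; multiplication by [x] becomes a matrix and Cayley-Hamilton gives a monic equation. *)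
Lemma integers_vge x : integers (alg_map (vring_inc v) A) x <-> vge V 0 x.
Proof.
split=> [|x0].
  apply: integral_vge => a; rewrite -[alg_map _ _ a]/((vring_val a)%:A) vge0_alg.
  exact: (valP a).
have [s hs] := av_finite av.
pose r := size s.
pose b (i : 'I_r) := let y := s`_i in if vge V 0 y then y else 0.
have hb i : vge V 0 (b i) by rewrite /b; case: ifP => // _; exact: vge0.
have span y : vge V 0 y -> exists a : 'I_r -> F,
    (forall i, vge vF 0 (a i)) /\ y = \sum_i a i *: b i.
  move=> hy; apply: (@series_span _ b (fun=> True)) => // z _ hz.
  have [w ws hw] := hs z hz.
  have hi : (index w s < r)%N by rewrite index_mem.
  pose i0 := Ordinal hi.
  have w0 : vge V 0 w by rewrite -[w](subKr z); apply: vgeB => //; apply: vge_le hw.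
  have bi : b i0 = w by rewrite /b /= nth_index// w0.
  exists (fun i => (i == i0)%:R); split=> [i|]; first exact: vge_nat.
  have hw1 : vge V (1%:Z *+ e) (z - w) by rewrite natz.
  have [y' hy' ey] := vge_pi_quot hw1; exists y' => //.
  rewrite expr1 in ey; rewrite -ey (bigD1 i0)//= eqxx scale1r bi big1.
    by rewrite addr0 addrC subrK.
  by move=> i /negPf ->; rewrite scale0r.
have hM i : exists a : 'I_r -> F, (forall k, vge vF 0 (a k)) /\
    x * b i = \sum_k a k *: b k by apply: span; exact: vge0M.
have [M hM'] := choice hM.
pose N : 'M[vring v]_r := \matrix_(i, k) VRing ((hM' i).1 k).
have NE i : x * b i = \sum_k vring_val (N i k) *: b k.
  by rewrite (hM' i).2; apply: eq_bigr => k _; rewrite mxE.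
have [a1 [_ e1]] := span 1 (vge1 V).
(* Since 1 is a combination of the [b i], the size [r] is positive and the square matrices of size
   [r] form a nonzero ring. *)
have r0 : r = r.-1.+1.
  case: (r) a1 b e1 {hb span hM M hM' N NE} => // a1 b.
  by rewrite big_ord0 => /eqP; rewrite oner_eq0.
move: N NE a1 e1; rewrite r0 in b hb span hM M hM' * => N NE a1 e1.
exists (char_poly N); first exact: char_poly_monic.
apply/rootP; set f := alg_map _ _.
have fE a (z : A) : f a * z = vring_val a *: z by rewrite mulr_algl.
have key (P : {poly vring v}) i :
    (map_poly f P).[x] * b i = \sum_k vring_val (horner_mx N P i k) *: b k.
  elim/poly_ind: P i => [|P c IH] i.
    rewrite rmorph0 horner0 mul0r big1// => k _.
    by rewrite rmorph0 mxE scale0r.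
  have -> : map_poly f (P * 'X + c%:P) = map_poly f P * 'X + (f c)%:P.
    rewrite rmorphD rmorphM; congr (_ * _ + _); first exact: map_polyX.
    exact: map_polyC.
  have -> : horner_mx N (P * 'X + c%:P) = N * horner_mx N P + c%:M.
    by rewrite mulrC rmorphD rmorphM /= horner_mx_X horner_mx_C.
  rewrite hornerMXaddC mulrDl -mulrA NE mulr_sumr fE.
  have -> : vring_val c *: b i = \sum_k vring_val (c%:M i k) *: b k.
    rewrite (bigD1 i)//= big1 ?addr0; first by rewrite mxE eqxx mulr1n.
    by move=> k ki; rewrite mxE eq_sym (negPf ki) mulr0n scale0r.
  under [in LHS]eq_bigr => k _ do rewrite -scalerAr IH scaler_sumr.
  rewrite exchange_big -big_split; apply: eq_bigr => k _ /=.
  have -> : (N * horner_mx N P + c%:M) i k = (N * horner_mx N P) i k + c%:M i k.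
    by rewrite mxE.
  have valD (a a' : vring v) : vring_val (a + a') = vring_val a + vring_val a' :> F by [].
  have valM (a a' : vring v) : vring_val (a * a') = vring_val a * vring_val a' :> F by [].
  rewrite valD scalerDl; congr (_ + _).
  have -> : (N * horner_mx N P) i k = \sum_m N i m * horner_mx N P m k by rewrite mxE.
  rewrite (big_morph _ valD (erefl : vring_val (0 : vring v) = 0)) scaler_suml.
  by apply: eq_bigr => m _; rewrite valM scalerA.
rewrite -[LHS]mulr1 e1 mulr_sumr big1// => i _.
rewrite -scalerAr key Cayley_Hamilton big1 ?scaler0// => k _.
by rewrite mxE scale0r.
Qed.

Lemma max_ideal_vge x : max_ideal (alg_map (vring_inc v) A) x <-> vge V 1 x.
Proof.
split=> [[/integers_vge hx nu]|hx].
  have [/andP[x0 /eqP vx]|//] := vunit_cases hx; case: nu; split.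
    exact: dv_unit V _ x0.
  by apply/integers_vge; rewrite vgeE ?(inv_neq0 V)// dvV// vx.
split=> [|[ux]]; first by apply/integers_vge; apply: vge_le hx.
have x0 : x != 0 by rewrite -(unit_neq0 V).
move=> /integers_vge; rewrite vgeE ?(inv_neq0 V)// dvV//.
by move: hx; rewrite vgeE//; move: (V x); lia.
Qed.

Lemma U1_vge x : U1 (vring_inc v) x <-> vge V 1 (x - 1).
Proof. exact: max_ideal_vge. Qed.

(** The power [e] turns the valuation into a value of the base field, which a scalar cancels. *)
Lemma vunit_scaled x : x != 0 -> exists2 a : F, a != 0 & vunit V (a *: x ^+ e).
Proof.
move=> x0; have [a a0 va] := Lam_scale pi0 vpi (- V x).
exists a => //; have y0 : x ^+ e != 0 by rewrite (exp_neq0 V).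
rewrite /vunit scaler_eq0 negb_or a0 y0 /= -mulr_algl dvM ?alg_neq0//.
by rewrite (av_base av a0) [v a]va dvX// mulNrn addNr.
Qed.

Lemma residue_char l : prime l -> l != p -> vunit V l%:R.
Proof.
move=> lp lnp; have [//|hl] := vunit_cases (vge_nat V l).
have hp : vge V 1 p%:R.
  have -> : p%:R = (p%:R : F)%:A :> A by rewrite scaler_nat.
  apply: vge_le (_ : vge V (1%:Z *+ e) _).
    by rewrite natz; have := av_gt0 av; lia.
  rewrite vge_alg; exact: (lf_residue_char hF).
have co : coprime l p by rewrite prime_coprime// dvdn_prime2// (lf_prime hF).
case: (egcdnP p (prime_gt0 lp)) => kl kp e1 _.
have : vge V 1 (1 : A).
  have -> : (1 : A) = kl%:R * l%:R - kp%:R * p%:R.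
    by rewrite -!natrM e1 (eqP co) natrD addrC addKr.
  by apply: vgeB; apply: vgeMl => //; exact: vge_nat.
by rewrite vgeE ?oner_neq0// dv1.
Qed.

End One.

(** Integral elements go to integral elements, hence units to units, and [x^e] is a unit up to a
    scalar of [F]. *)
Lemma algval_morph (A A' : falgType F) (V : divval A) (V' : divval A') (e e' : nat)
    (h : {rmorphism A -> A'}) x :
  alg_val v V e -> alg_val v V' e' -> (forall a : F, h (a%:A) = a%:A) ->
  x != 0 -> V' (h x) *+ e = V x *+ e'.
Proof.
move=> av av' hh x0.
have hunit (y : A) : vunit V y -> vunit V' (h y).
  move=> uy; have y0 := vunit_neq0 uy.
  have hint (z : A) : vge V 0 z -> vge V' 0 (h z).
    move=> /(integers_vge av) hz; apply/(integers_vge av').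
    have := integral_rmorph h hz; congr integralOver; apply/funext => a /=.
    exact: hh.
  have hy : h y * h y^-1 = 1 by rewrite -rmorphM (dmulfV V)// rmorph1.
  have hy0 : h y != 0 by apply/eqP => e0; move/eqP: hy; rewrite e0 mul0r eq_sym oner_eq0.
  have hz0 : h y^-1 != 0 by apply/eqP => e0; move/eqP: hy; rewrite e0 mulr0 eq_sym oner_eq0.
  rewrite /vunit hy0 /=; have := dvM V' hy0 hz0; rewrite hy dv1.
  have := hint _ (vunit_vge (vunitV uy)); rewrite vgeE//.
  have := hint _ (vunit_vge uy); rewrite vgeE//.
  by move: (V' (h y)) (V' _) => c d; lia.
have h0 : h x != 0.
  apply/eqP => e0; have : h (x * x^-1) = 0 by rewrite rmorphM e0 mul0r.
  by rewrite (dmulfV V)// rmorph1 => /eqP; rewrite oner_eq0.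
have [a a0 hu] := vunit_scaled av x0.
have := hunit _ hu; rewrite -mulr_algl rmorphM rmorphXn /= hh mulr_algl.
move: hu; rewrite /vunit.
move=> /andP[_ /eqP]; rewrite -mulr_algl dvM ?alg_neq0 ?(exp_neq0 V)//.
rewrite (av_base av a0) dvX// => h1.
move=> /andP[_ /eqP]; rewrite -mulr_algl dvM ?alg_neq0 ?(exp_neq0 V')//.
rewrite (av_base av' a0) dvX// => h2.
have := av_gt0 av; move: h1 h2; rewrite !intmulnE.
move: (v a) (V x) (V' (h x)) => c d d'; nia.
Qed.

End ValuedAlgebra.

(** * Residue fields and roots of unity *)

Section ResidueField.
Variables (A : unitRingType) (V : divval A) (s : seq A).
Implicit Types x y : A.

Definition residue_system :=
  forall x, vge V 0 x -> exists2 y, y \in s & vge V 1 (x - y).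

Definition res_idx x := find (fun y => vge V 0 y && vge V 1 (x - y)) s.

Hypothesis hs : residue_system.

Lemma res_idx_has x : vge V 0 x -> (res_idx x < size s)%N.
Proof.
move=> hx; rewrite -has_find; apply/hasP; have [y ys hy] := hs hx.
exists y => //; rewrite hy andbT -[y](subKr x).
by apply: vgeB => //; apply: vge_le hy.
Qed.

Lemma res_idx_cong x y : vge V 1 (x - y) -> res_idx x = res_idx y.
Proof.
move=> h; apply: eq_find => z; congr (_ && _).
by apply/idP/idP; apply: vge_trans => //; rewrite vge_sub_sym.
Qed.

Lemma res_idxP x : vge V 0 x ->
  vge V 0 s`_(res_idx x) /\ vge V 1 (x - s`_(res_idx x)).
Proof.
move=> hx; have h : has (fun y => vge V 0 y && vge V 1 (x - y)) s.
  by rewrite has_find res_idx_has.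
by have /andP := nth_find 0 h.
Qed.

(** A class is encoded by the index that the search [res_idx] returns on it, so that the residue
    ring is a subtype of an ordinal and finite by construction. *)
Definition residue of residue_system : Type :=
  {i : 'I_(size s) | (res_idx s`_i == i) && vge V 0 s`_i}.
Local Notation kappa := (residue hs).
HB.instance Definition _ := Finite.on kappa.

Definition res_lift (t : kappa) : A := s`_(val (val t)).

Lemma res_lift_int t : vge V 0 (res_lift t).
Proof. by have /andP[] := valP t. Qed.

Lemma res_idx_lift t : res_idx (res_lift t) = val (val t).
Proof. by have /andP[/eqP] := valP t. Qed.

Lemma res_proof x (hx : vge V 0 x) : let i := Ordinal (res_idx_has hx) in
  (res_idx s`_i == i) && vge V 0 s`_i.
Proof.
have [h0 h1] := res_idxP hx; rewrite /= h0 andbT; apply/eqP.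
by rewrite -(res_idx_cong h1).
Qed.

Definition res_mk x (hx : vge V 0 x) : kappa :=
  exist (fun i : 'I_(size s) => (res_idx s`_i == i) && vge V 0 s`_i) _ (res_proof hx).

Definition res x : kappa :=
  match @idP (vge V 0 x) with
  | ReflectT hx => res_mk hx
  | ReflectF _ => res_mk (vge0 V 0)
  end.

Lemma res_eq x y : vge V 0 x -> vge V 0 y -> (res x = res y) <-> vge V 1 (x - y).
Proof.
move=> hx hy; have resE z : vge V 0 z -> val (val (res z)) = res_idx z.
  by rewrite /res; case: {-}_ / idP.
split=> [e|h]; last by do 2![apply: val_inj]; rewrite !resE//; exact: res_idx_cong.
have {}e : res_idx x = res_idx y by rewrite -!resE// e.
have [_ h1] := res_idxP hx; have [_ h2] := res_idxP hy.
by apply: vge_trans h1 _; rewrite e vge_sub_sym.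
Qed.

Lemma res_liftK : cancel res_lift res.
Proof.
move=> t; do 2![apply: val_inj].
by rewrite -[RHS]res_idx_lift /res; case: {-}_ / idP => // /(_ (res_lift_int t)).
Qed.

Lemma lift_res x : vge V 0 x -> vge V 1 (res_lift (res x) - x).
Proof.
by move=> hx; apply/res_eq; rewrite ?res_lift_int ?res_liftK.
Qed.

Definition res_add (t u : kappa) : kappa := res (res_lift t + res_lift u).
Definition res_opp (t : kappa) : kappa := res (- res_lift t).
Definition res_mul (t u : kappa) : kappa := res (res_lift t * res_lift u).

Let li := res_lift_int.

Lemma resD x y : vge V 0 x -> vge V 0 y -> res (x + y) = res_add (res x) (res y).
Proof.
move=> hx hy; apply/(res_eq (vgeD hx hy) (vgeD (li _) (li _))).
rewrite opprD addrACA; apply: vgeD; rewrite vge_sub_sym; exact: lift_res.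
Qed.

Lemma resN x : vge V 0 x -> res (- x) = res_opp (res x).
Proof.
move=> hx; apply/res_eq; rewrite ?vgeN ?li//.
by rewrite opprK addrC; exact: lift_res.
Qed.

Lemma resM x y : vge V 0 x -> vge V 0 y -> res (x * y) = res_mul (res x) (res y).
Proof.
move=> hx hy; apply/(res_eq (vge0M hx hy) (vge0M (li _) (li _))).
by apply: vge_congM; rewrite ?li// vge_sub_sym; exact: lift_res.
Qed.

Lemma res_ind (P : kappa -> Prop) : (forall x, vge V 0 x -> P (res x)) -> forall t, P t.
Proof. by move=> h t; rewrite -(res_liftK t); apply: h. Qed.

Lemma res_addA : associative res_add.
Proof.
elim/res_ind => x hx; elim/res_ind => y hy; elim/res_ind => z hz.
by rewrite -!resD ?vgeD// addrA.
Qed.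
Lemma res_addC : commutative res_add.
Proof. by elim/res_ind => x hx; elim/res_ind => y hy; rewrite -!resD// addrC. Qed.
Lemma res_add0 : left_id (res 0) res_add.
Proof. by elim/res_ind => x hx; rewrite -resD ?vge0// add0r. Qed.
Lemma res_addN : left_inverse (res 0) res_opp res_add.
Proof. by elim/res_ind => x hx; rewrite -resN// -resD ?vgeN// addNr. Qed.
HB.instance Definition _ := GRing.isZmodule.Build kappa
  res_addA res_addC res_add0 res_addN.

Lemma res_mulA : associative res_mul.
Proof.
elim/res_ind => x hx; elim/res_ind => y hy; elim/res_ind => z hz.
by rewrite -!resM ?vge0M// mulrA.
Qed.
Lemma res_mul1 : left_id (res 1) res_mul.
Proof. by elim/res_ind => x hx; rewrite -resM ?vge1// mul1r. Qed.
Lemma res_mulr1 : right_id (res 1) res_mul.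
Proof. by elim/res_ind => x hx; rewrite -resM ?vge1// mulr1. Qed.
Lemma res_mulDl : left_distributive res_mul res_add.
Proof.
elim/res_ind => x hx; elim/res_ind => y hy; elim/res_ind => z hz.
rewrite -(resD hx hy) -(resM (vgeD hx hy) hz) -(resM hx hz) -(resM hy hz).
by rewrite -resD ?vge0M// mulrDl.
Qed.
Lemma res_mulDr : right_distributive res_mul res_add.
Proof.
elim/res_ind => x hx; elim/res_ind => y hy; elim/res_ind => z hz.
rewrite -(resD hy hz) -(resM hx (vgeD hy hz)) -(resM hx hy) -(resM hx hz).
by rewrite -resD ?vge0M// mulrDr.
Qed.
Lemma res_one_neq0 : res 1 != res 0.
Proof.
apply/eqP => /res_eq; rewrite vge1 vge0 subr0 => /(_ isT isT).
by rewrite vgeE ?oner_neq0// dv1.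
Qed.
HB.instance Definition _ := GRing.Zmodule_isNzRing.Build kappa
  res_mulA res_mul1 res_mulr1 res_mulDl res_mulDr res_one_neq0.

Definition res_unit : pred kappa := fun t => t != 0.
Definition res_inv (t : kappa) : kappa :=
  if t == 0 then 0 else res (res_lift t)^-1.

Lemma res_eq0 x : vge V 0 x -> (res x = 0) <-> vge V 1 x.
Proof.
by move=> hx; rewrite -[x in vge V 1 x]subr0; apply: res_eq; rewrite ?vge0.
Qed.

Lemma res_lift_unit t : t != 0 -> vunit V (res_lift t).
Proof.
move=> t0; have [//|/res_eq0] := vunit_cases (li t).
by rewrite li res_liftK => /(_ isT) e; rewrite e eqxx in t0.
Qed.

Lemma res_mulV : {in res_unit, left_inverse 1 res_inv *%R}.
Proof.
move=> t t0; have u := res_lift_unit t0.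
transitivity (res ((res_lift t)^-1 * res_lift t)).
  by rewrite resM ?vunit_vge ?vunitV// res_liftK /res_inv (negPf t0).
by rewrite (dmulVf V)// (vunit_neq0 u).
Qed.
Lemma res_mulrV : {in res_unit, right_inverse 1 res_inv *%R}.
Proof.
move=> t t0; have u := res_lift_unit t0.
transitivity (res (res_lift t * (res_lift t)^-1)).
  by rewrite resM ?vunit_vge ?vunitV// res_liftK /res_inv (negPf t0).
by rewrite (dmulfV V)// (vunit_neq0 u).
Qed.
Lemma res_unitP (x y : kappa) : y * x = 1 /\ x * y = 1 -> res_unit x.
Proof.
by move=> [h _]; apply/eqP => x0; move/eqP: h; rewrite x0 mulr0 eq_sym oner_eq0.
Qed.
Lemma res_inv_out : {in [predC res_unit], res_inv =1 id}.
Proof. by move=> t; rewrite !inE negbK /res_inv => /[dup] /eqP -> ->. Qed.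
HB.instance Definition _ := GRing.NzRing_hasMulInverse.Build kappa
  res_mulV res_mulrV res_unitP res_inv_out.

Lemma residue_domain : GRing.integral_domain_axiom kappa.
Proof.
move=> t u tu; apply/norP => -[t0 u0].
have /(congr1 ( *%R t^-1)) := tu; rewrite mulrA mulVr ?mul1r ?mulr0//.
by move/eqP; rewrite (negPf u0).
Qed.

End ResidueField.

(* Commutativity is Wedderburn's theorem. *)
Lemma residue_field_exists (A : unitRingType) (V : divval A) (s : seq A) :
  residue_system V s -> exists (k : finFieldType) (red : A -> k),
  [/\ (forall x y, vge V 0 x -> vge V 0 y ->
         red (x + y) = red x + red y /\ red (x * y) = red x * red y),
      red 1 = 1,
      (forall x, vge V 0 x -> (red x = 0) <-> vge V 1 x) &
      forall c, exists2 x, vge V 0 x & red x = c].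
Proof.
move=> hs; exists (FinDomainFieldType (@residue_domain A V s hs)), (@res A V s hs).
split=> [x y hx hy||x hx|c].
- by split; [exact: (resD hs hx hy)|exact: (resM hs hx hy)].
- exact: erefl.
- exact: (res_eq0 hs hx).
- by exists (@res_lift A V s hs c); [exact: res_lift_int|exact: res_liftK].
Qed.

(** Values of [red] outside the valuation ring are arbitrary. *)
Record residue_map (A : unitRingType) (V : divval A) (k : finFieldType)
    (red : A -> k) : Prop := ResidueMap {
  redDM : forall x y, vge V 0 x -> vge V 0 y ->
    red (x + y) = red x + red y /\ red (x * y) = red x * red y;
  red1 : red 1 = 1;
  red_eq0 : forall x, vge V 0 x -> (red x = 0) <-> vge V 1 x;
  red_surj : forall c, exists2 x, vge V 0 x & red x = c }.

Lemma finField_generator (k : finFieldType) : exists g : k, g != 0 /\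
  (forall c, c != 0 -> exists i, c = g ^+ i) /\
  (forall i, (g ^+ i == 1) = (#|k|.-1 %| i)%N).
Proof.
have /cyclicP[g /= hg] := field_unit_group_cyclic [set: {unit k}]%G.
exists (val g); split; first by rewrite -unitfE; exact: (valP g).
split=> [c c0|i].
  have uc : c \is a GRing.unit by rewrite unitfE.
  have : FinRing.unit k uc \in <[g]>%g by rewrite -hg finset.in_setT.
  by case/cycleP => i /(congr1 val) /= ->; exists i; rewrite FinRing.val_unitX.
rewrite -FinRing.val_unitX -[1]/(val (1%g : {unit k})) (inj_eq val_inj) -order_dvdn.
by rewrite orderE -hg card_finField_unit.
Qed.

(** * Lifting roots of unity and averaging *)

Section Residue.
Variables (A : unitRingType) (V : divval A) (k : finFieldType) (red : A -> k).
Hypothesis hred : residue_map V red.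
Local Notation Q := #|k|.
Local Notation M := (#|k|.-1).

Lemma redD x y : vge V 0 x -> vge V 0 y -> red (x + y) = red x + red y.
Proof. by move=> hx hy; case: (redDM hred hx hy). Qed.
Lemma redM x y : vge V 0 x -> vge V 0 y -> red (x * y) = red x * red y.
Proof. by move=> hx hy; case: (redDM hred hx hy). Qed.
Lemma red0 : red 0 = 0.
Proof. by apply/(red_eq0 hred (vge0 V 0)); exact: vge0. Qed.
Lemma redN x : vge V 0 x -> red (- x) = - red x.
Proof.
move=> hx; apply/eqP; rewrite -subr_eq0 opprK -redD ?vgeN//.
by rewrite addNr red0.
Qed.
Lemma redB x y : vge V 0 x -> vge V 0 y -> red (x - y) = red x - red y.
Proof. by move=> hx hy; rewrite redD ?vgeN// redN. Qed.
Lemma red_eq x y : vge V 0 x -> vge V 0 y -> (red x = red y) <-> vge V 1 (x - y).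
Proof.
move=> hx hy; rewrite -(red_eq0 hred (vgeB hx hy)) redB//.
by split=> [->|/subr0_eq//]; rewrite subrr.
Qed.
Lemma redX x n : vge V 0 x -> red (x ^+ n) = red x ^+ n.
Proof.
by move=> hx; elim: n => [|n IH]; rewrite ?expr0 ?(red1 hred)// !exprS redM ?vgeX// IH.
Qed.
Lemma red_nat n : red n%:R = n%:R.
Proof.
by elim: n => [|n IH]; rewrite ?red0// -!natr1 redD ?vge_nat ?vge1// IH (red1 hred).
Qed.
Lemma red_sum (I : Type) (r : seq I) (P : pred I) (f : I -> A) :
  (forall i, vge V 0 (f i)) -> red (\sum_(i <- r | P i) f i) = \sum_(i <- r | P i) red (f i).
Proof.
move=> hf; elim: r => [|i r IH]; first by rewrite !big_nil red0.
by rewrite !big_cons; case: (P i); rewrite // redD ?IH//; apply: vge_sum.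
Qed.
Lemma red_neq0 x : vge V 0 x -> (red x != 0) = vunit V x.
Proof.
move=> hx; apply/idP/idP => [r0|ux].
  by have [//|/(red_eq0 hred hx) e] := vunit_cases hx; rewrite e eqxx in r0.
by apply/eqP => /(red_eq0 hred hx); apply/negP; exact: vunit_notP.
Qed.

Lemma Q_gt1 : (1 < Q)%N.
Proof. exact: finNzRing_gt1. Qed.

Lemma Q_prednK : M.+1 = Q.
Proof. by rewrite prednK// (ltn_trans _ Q_gt1). Qed.

(** Lagrange's theorem in the additive group of the residue field. *)
Lemma vge_Q : vge V 1 (Q%:R).
Proof.
apply/(red_eq0 hred (vge_nat _ _)); rewrite red_nat.
have := @order_dvdG _ [set: k]%G (1%R : k) (finset.in_setT _).
rewrite cardsT order_dvdn.
by rewrite FinRing.zmodXgE => /eqP.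
Qed.

Lemma vge_pred_Q : vge V 1 (1 + M%:R).
Proof. by rewrite nat1r Q_prednK vge_Q. Qed.

Lemma residue_generator : exists w, [/\ vunit V w,
  (forall x, vunit V x -> exists i, vge V 1 (x - w ^+ i)) &
  (forall i, vge V 1 (w ^+ i - 1) = (M %| i)%N)].
Proof.
have [g [g0 [gen ord]]] := finField_generator k.
have [w hw ew] := red_surj hred g.
have uw : vunit V w by rewrite -red_neq0// ew.
exists w; split=> // [x ux|i].
  have hx := vunit_vge ux; have [|i e] := gen (red x); first by rewrite red_neq0.
  by exists i; apply/red_eq; rewrite ?vgeX// redX// ew.
rewrite -ord -ew -redX// -(red1 hred).
by apply/idP/eqP => /red_eq; apply; rewrite ?vgeX ?vge1.
Qed.

Lemma vunit_pow x : vunit V x -> vge V 1 (x ^+ M - 1).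
Proof.
move=> ux; have [w [uw gen ord]] := residue_generator; have [i hi] := gen x ux.
apply: (@vge_trans _ _ _ _ ((w ^+ i) ^+ M)).
  by apply: vge_congX => //; exact: vunit_vge.
by rewrite -exprM ord dvdn_mull.
Qed.

Lemma vge_comm x y : vge V 0 x -> vge V 0 y -> vge V 1 (x * y - y * x).
Proof. by move=> hx hy; apply/red_eq; rewrite ?vge0M// !redM// mulrC. Qed.

(** The cofactor of [x - y] in [x^R - y^R] is congruent to [R y^(R-1)], which lies in the maximal
    ideal. *)
Lemma pow_contract R (n : nat) x y : vge V 1 R%:R -> x * y = y * x ->
  vge V 0 x -> vge V 0 y -> vge V n.+1%:Z (x - y) ->
  vge V n.+2%:Z (x ^+ R - y ^+ R).
Proof.
move=> hR cxy hx hy h; rewrite subrXX_comm//.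
rewrite -[n.+2]addn1 PoszD; apply: vgeM => //.
have h1 : vge V 1 (x - y) by apply: vge_le h; lia.
have -> : \sum_(i < R) x ^+ (R.-1 - i) * y ^+ i =
    \sum_(i < R) (x ^+ (R.-1 - i) - y ^+ (R.-1 - i)) * y ^+ i + R%:R * y ^+ R.-1.
  rewrite mulr_natl -[R in _ *+ R]card_ord -sumr_const -big_split /=.
  apply: eq_bigr => i _; rewrite mulrBl -exprD subnK ?subrK//.
  by rewrite -ltnS (leq_trans (ltn_ord i))// leqSpred.
apply: vgeD; last by apply: vgeMr => //; exact: vgeX.
by apply: vge_sum => i _; apply: vgeMr; [exact: vge_congX|exact: vgeX].
Qed.

Lemma pow_iter R x y : vge V 1 R%:R -> x * y = y * x ->
  vge V 0 x -> vge V 0 y -> vge V 1 (x - y) ->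
  forall n, vge V n.+1%:Z (x ^+ (R ^ n) - y ^+ (R ^ n)).
Proof.
move=> hR cxy hx hy h; elim=> [|n IH]; first by rewrite !expr1.
rewrite expnSr !exprM; apply: pow_contract; rewrite ?vgeX//.
by apply: commrX; apply/commr_sym/commrX.
Qed.

Hypothesis hlim : forall u : nat -> A, (forall n : nat, vge V n%:Z (u n.+1 - u n)) ->
  exists x, forall n : nat, vge V n%:Z (x - u n).

Lemma limit_comm (u : nat -> A) x y :
  (forall n : nat, vge V n%:Z (x - u n)) -> (forall n, y * u n = u n * y) ->
  y * x = x * y.
Proof.
move=> h hc; have [->|y0] := eqVneq y 0; first by rewrite mul0r mulr0.
apply/eqP; rewrite -subr_eq0; apply/eqP; apply: (@vge_eq0 _ V (V y)) => n.
have -> : y * x - x * y = y * (x - u n) - (x - u n) * y.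
  by rewrite mulrBr mulrBl hc opprB addrA subrK.
have hy : vge V (V y) y by rewrite vgeE.
by apply: vgeB; [|rewrite addrC]; apply: vgeM.
Qed.

(** [w] is the limit of [x^(Q^n)]. Limits keep commutation relations, which is how centralizers are
    respected later. *)
Lemma teichmuller x : vunit V x -> exists w, [/\ w ^+ M = 1, vge V 1 (w - x) &
  forall y, y * x = x * y -> y * w = w * y].
Proof.
move=> ux; have hx := vunit_vge ux.
have h1 : vge V 1 (x ^+ Q - x).
  have -> : x ^+ Q - x = (x ^+ M - 1) * x by rewrite mulrBl mul1r -exprSr Q_prednK.
  by apply: vgeMr => //; exact: vunit_pow.
have hQ n : vge V n.+1%:Z (x ^+ (Q ^ n.+1) - x ^+ (Q ^ n)).
  rewrite expnS exprM; apply: pow_iter; rewrite ?vge_Q ?vgeX//.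
  exact/commr_sym/commrX.
have [|w hw] := hlim (u := fun n => x ^+ (Q ^ n)).
  by move=> n; apply: vge_le (hQ n); lia.
have wx : vge V 1 (w - x).
  apply: (@vge_trans _ _ _ _ (x ^+ (Q ^ 1))); first exact: hw.
  by rewrite expn1.
have uw := vunit_near ux wx; have w0 := vunit_neq0 uw.
exists w; split=> // [|y yx]; last first.
  by apply: (limit_comm hw) => n; exact: commrX.
have e : w ^+ Q - w = 0.
  apply: (@vge_all0 _ V) => n; apply: (@vge_trans _ _ _ _ (x ^+ (Q ^ n.+1))).
    by rewrite expnSr exprM; apply: vge_congX => //; exact: vunit_vge.
  by rewrite vge_sub_sym; apply: vge_le (hw n.+1); lia.
apply: (dmulIf V w0); rewrite mul1r -exprSr Q_prednK.
exact: subr0_eq.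
Qed.

(* [c] is the limit of the powers of [b] with exponents [1 + R + ... + R^n]. *)
Lemma U1_root R b : (0 < R)%N -> vge V 1 R%:R -> vge V 1 (b - 1) ->
  exists c, [/\ c ^+ R.-1 * b = 1, vge V 1 (c - 1) &
    forall y, y * b = b * y -> y * c = c * y].
Proof.
move=> R0 hR hb; have ub := vunit_U1 hb; have b0 := vunit_vge ub.
have hRn n : vge V n.+1%:Z (b ^+ (R ^ n) - 1).
  rewrite -[X in _ - X](expr1n _ (R ^ n)); apply: pow_iter; rewrite ?vge1//.
  by rewrite mul1r mulr1.
pose E n := (\sum_(i < n) R ^ i)%N.
have ES n : E n.+1 = (E n + R ^ n)%N by rewrite /E big_ord_recr.
have [|c hc] := hlim (u := fun n => b ^+ E n).
  move=> n; rewrite ES exprD -{2}[b ^+ E n]mulr1 -mulrBr.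
  by apply: vgeMl; [exact: vgeX|apply: vge_le (hRn n); lia].
have c1 : vge V 1 (c - 1).
  by apply: vge_trans hb; have := hc 1%N; rewrite /E big_ord1.
exists c; split=> // [|y yb]; last by apply: (limit_comm hc) => n; exact: commrX.
apply/eqP; rewrite -subr_eq0; apply/eqP; apply: (@vge_all0 _ V) => n.
have key : b ^+ E n ^+ R.-1 * b = b ^+ (R ^ n).
  rewrite -exprM -exprSr; congr (_ ^+ _).
  have := predn_exp R n; rewrite -/(E n) mulnC => <-.
  by rewrite prednK// expn_gt0 R0.
apply: (@vge_trans _ _ _ _ (b ^+ (R ^ n))); last by apply: vge_le (hRn n); lia.
rewrite -key -mulrBl; apply: vgeMr => //; apply: vge_congX => //.
by apply: vunit_vge; exact: vunit_U1.
Qed.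

(* Averaging over the conjugates under the cyclic group generated by [w]. *)
Lemma averaging w u x : w ^+ M = 1 -> u ^+ M = 1 -> vunit V w -> vunit V u ->
  x != 0 -> vge V (V x + 1) (x * w - u * x) ->
  exists x', [/\ x' * w = u * x', vge V (V x + 1) (x' - x) &
    forall y, y * w = w * y -> y * u = u * y -> y * x = x * y -> y * x' = x' * y].
Proof.
move=> wM uM uw uu x0 hx; have hw := vunit_vge uw; have hu := vunit_vge uu.
pose S := \sum_(i < M) u ^+ i * x * w ^+ (M - i).
have M0 : (0 < M)%N by have := Q_gt1; lia.
have hi i : vge V (V x + 1) (u ^+ i * x - x * w ^+ i).
  elim: i => [|i IH]; first by rewrite !expr0 mul1r mulr1 subrr vge0.
  rewrite exprS exprSr -mulrA.
  apply: (@vge_trans _ _ _ _ (u * (x * w ^+ i))).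
    by rewrite -mulrBr; apply: vgeMl.
  rewrite mulrA [x * (_ * _)]mulrA -[x * _ * w]mulrA -exprSr exprS mulrA -mulrBl.
  by apply: vgeMr; [rewrite vge_sub_sym|exact: vgeX].
have hS : vge V (V x + 1) (S - M%:R * x).
  rewrite mulr_natl -[M in _ *+ M]card_ord -sumr_const -sumrB.
  apply: vge_sum => i _; have iM := ltnW (ltn_ord i).
  have -> : u ^+ i * x * w ^+ (M - i) - x = (u ^+ i * x - x * w ^+ i) * w ^+ (M - i).
    by rewrite mulrBl -[x * _ * _]mulrA -exprD subnKC// wM mulr1.
  by apply: vgeMr => //; exact: vgeX.
(* [S] approximates [M x], and [M] is congruent to -1, so a change of sign replaces the division by
   [M]. *)
exists (- S); split.
- rewrite mulNr mulrN; congr (- _); rewrite /S mulr_suml mulr_sumr.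
  rewrite -(prednK M0) big_ord_recl [RHS]big_ord_recr /= addrC; congr (_ + _).
    rewrite expr0 mul1r subn0 !mulrA -exprS (prednK M0) uM mul1r.
    rewrite -mulrA -exprSr exprS wM mulr1; congr (_ * _).
    have -> : (M - M.-1 = 1)%N by lia.
    by rewrite expr1.
  apply: eq_bigr => i _; rewrite /bump /= add1n.
  rewrite !mulrA -exprS -[LHS]mulrA -exprSr subSS; congr (_ * _ ^+ _).
  by have := ltn_ord i; lia.
- have -> : - S - x = - (S - M%:R * x) - (1 + M%:R) * x.
    by rewrite opprB mulrDl mul1r opprD [- x - _]addrC addrA; congr (_ - _); rewrite addrAC subrr add0r.
  apply: vgeB; first by rewrite vgeN.
  by rewrite addrC; apply: vgeM; [exact: vge_pred_Q|rewrite vgeE].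
- move=> y yw yu yx; rewrite mulrN mulNr; congr (- _).
  rewrite mulr_sumr mulr_suml; apply: eq_bigr => i _.
  by apply: commrM; [apply: commrM => //|]; apply: commrX.
Qed.

(** The cofactor of [r - 1] in [r^M - 1] is congruent to [M], hence to -1, and is a unit. *)
Lemma U1_torsion_free r : vge V 1 (r - 1) -> r ^+ M = 1 -> r = 1.
Proof.
move=> h rM; have ur := vunit_U1 h.
have := subrX1 r M; rewrite rM subrr => /esym e.
apply/eqP; rewrite -subr_eq0; apply/negPn/negP => r1.
have uS : vunit V (\sum_(i < M) r ^+ i).
  apply: (@vunit_near _ _ (- 1)); first by rewrite /vunit oppr_eq0 oner_neq0 dvN1 eqxx.
  have -> : \sum_(i < M) r ^+ i - -1 = (1 + M%:R) + (\sum_(i < M) r ^+ i - M%:R).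
    by rewrite opprK -addrA [M%:R + _]addrC subrK addrC.
  apply: vgeD; first exact: vge_pred_Q.
  rewrite -[M in _ - M%:R]card_ord -sumr_const -sumrB; apply: vge_sum => i _.
  by rewrite -[X in _ - X](expr1n _ i); apply: vge_congX => //; exact: vunit_vge.
by have := mulf_neq0 V r1 (vunit_neq0 uS); rewrite e eqxx.
Qed.

End Residue.

(** * The structure of a tame division algebra *)

(** A predicate rather than a subspace, so that the whole algebra and a centralizer given by
    commutation identities are both instances. *)
Record sub_division (F : fieldType) (A : falgType F) (B : A -> Prop) : Prop :=
  SubDivision {
  sdB : forall x y, B x -> B y -> B (x - y);
  sdM : forall x y, B x -> B y -> B (x * y);
  sdZ : forall a x, B x -> B (a *: x);
  sd1 : B 1;
  sdV : forall x, B x -> B x^-1 }.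

Section SubDivisionTheory.
Variables (F : fieldType) (A : falgType F) (B : A -> Prop).
Hypothesis hB : sub_division B.
Lemma sd0 : B 0.
Proof. by rewrite -(subrr 1); apply: (sdB hB); exact: (sd1 hB). Qed.
Lemma sdN x : B x -> B (- x).
Proof. by move=> hx; rewrite -sub0r; apply: (sdB hB) => //; exact: sd0. Qed.
Lemma sdD x y : B x -> B y -> B (x + y).
Proof. by move=> hx hy; rewrite -[y]opprK; apply: (sdB hB) => //; exact: sdN. Qed.
Lemma sd_sum (I : Type) (r : seq I) (P : pred I) (f : I -> A) :
  (forall i, B (f i)) -> B (\sum_(i <- r | P i) f i).
Proof. by move=> h; apply: big_ind => //; [exact: sd0|exact: sdD]. Qed.
Lemma sdX x n : B x -> B (x ^+ n).
Proof.
move=> hx; elim: n => [|n IH]; first exact: (sd1 hB).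
by rewrite exprS; apply: (sdM hB).
Qed.
End SubDivisionTheory.

Lemma dim_le_spanning (F : fieldType) (T : vectType F) (U : {vspace T}) (I : finType)
    (G : I -> T) :
  (forall x, x \in U -> exists a : I -> F, x = \sum_z a z *: G z) -> (\dim U <= #|I|)%N.
Proof.
move=> h; rewrite -(size_codom G); apply: leq_trans (dim_span _).
apply: dimvS; apply/subvP => x /h[a ->]; apply: memv_suml => z _.
by apply: memvZ; apply: memv_span; exact: codom_f.
Qed.

Lemma dim_ge_free (F : fieldType) (T : vectType F) (I : finType) (G : I -> T) :
  (forall a : I -> F, \sum_z a z *: G z = 0 -> forall z, a z = 0) ->
  (#|I| <= \dim {:T})%N.
Proof.
move=> h; pose X := [tuple G (enum_val i) | i < #|I|].
have fX : free X.
  apply/freeP => a ha i.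
  have := h (fun z => a (enum_rank z)) _ (enum_val i); rewrite enum_valK; apply.
  rewrite -[RHS]ha (reindex_onto (@enum_rank I) (@enum_val I I)) => [|j _].
    apply: eq_big => [j|j _]; first by rewrite enum_rankK eqxx.
    by rewrite -tnth_nth tnth_mktuple enum_rankK.
  by rewrite enum_valK.
have <- : \dim <<X>> = #|I| by move: fX; rewrite /free size_tuple => /eqP.
exact: dimvS (subvf _).
Qed.

Section RootOfUnity.
Variables (A : unitRingType) (V : divval A) (k : finFieldType) (red : A -> k).
Hypothesis hred : residue_map V red.
Local Notation M := (#|k|.-1).
Variables (w : A).
Hypothesis wM : w ^+ M = 1.
Lemma M_gt0 (kk : finFieldType) : (0 < #|kk|.-1)%N.
Proof. by have := @Q_gt1 kk; lia. Qed.

Lemma root_unit : vunit V w.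
Proof.
have [w0|w0] := eqVneq w 0; last first.
  rewrite /vunit w0; apply/eqP.
  have := dvX V M w0; rewrite wM dv1 intmulnE; have := M_gt0 k; nia.
have := wM; rewrite w0 expr0n; have := M_gt0 k; case: (M) => //= n _ /eqP.
by rewrite eq_sym oner_eq0.
Qed.

Lemma root_neq0 : w != 0. Proof. exact: vunit_neq0 root_unit. Qed.

Hypothesis w_ord : forall i, vge V 1 (w ^+ i - 1) = (M %| i)%N.

Lemma root_powers_eq i j : (w ^+ i == w ^+ j) = (i == j %[mod M]).
Proof.
wlog le : i j / (i <= j)%N => [hw|].
  by have [/hw//|/ltnW/hw h] := leqP i j; rewrite eq_sym h eq_sym.
have -> : (i == j %[mod M]) = (M %| j - i)%N by rewrite eq_sym eqn_mod_dvd.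
rewrite -w_ord -{1}(subnKC le) exprD -{1}[w ^+ i]mulr1.
have wi0 : w ^+ i != 0 by rewrite (exp_neq0 V) ?root_neq0.
apply/eqP/idP => [/(dmulfI V wi0) <-|h]; first by rewrite subrr vge0.
congr (_ * _); apply/esym; apply: (U1_torsion_free hred h).
by rewrite -exprM mulnC exprM wM expr1n.
Qed.

Lemma root_powers_cong i j : vge V 1 (w ^+ i - w ^+ j) -> w ^+ i = w ^+ j.
Proof.
wlog le : i j / (i <= j)%N => [hw|].
  have [/hw//|/ltnW/hw h] := leqP i j.
  by rewrite vge_sub_sym => /h.
have wi := vunitX i root_unit; rewrite vge_sub_sym -(subnKC le) exprD.
rewrite -{2}[w ^+ i]mulr1 -mulrBr => h; apply/eqP.
rewrite -(subnKC le) -exprD root_powers_eq -[X in X == _ %[mod _]]addn0 eqn_modDl eq_sym.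
rewrite eqn_mod_dvd// subn0 -w_ord ?addKn -[_ - _]mul1r -{1}(dmulVf V (vunit_neq0 wi)) -mulrA.
by apply: vgeMl => //; apply: vunit_vge; exact: vunitV.
Qed.

End RootOfUnity.

(** * Division algebras generated by a root of unity and a uniformizer *)

Section Skew.
Variables (F : fieldType) (v : discrete_valuation F) (p q : nat).
Hypothesis hF : local_field v p q.
Variables (pi : F).
Hypotheses (pi0 : pi != 0) (vpi : v pi = 1).
Variables (A : falgType F) (V : divval A) (e : nat).
Hypothesis av : alg_val v V e.
Variables (k : finFieldType) (red : A -> k).
Hypothesis hred : residue_map V red.
Local Notation vF := (field_dval v).
Local Notation Q := #|k|.
Local Notation M := (#|k|.-1).

(** Expanding [h] digits in powers of [c] leaves a multiple of [c^h], which has the valuation of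
    [pi]. Dividing by [pi] and iterating gives coefficients that converge in [F]. *)
Lemma span_sub (B : A -> Prop) (r : nat) (W : 'I_r -> A) (c : A) (m h : nat) :
  sub_division B -> B c -> c != 0 -> V c = m%:Z -> (m * h = e)%N -> (0 < m)%N ->
  (forall i, B (W i) /\ vge V 0 (W i)) ->
  (forall x, B x -> vge V 0 x -> exists a : 'I_r -> F,
     (forall i, vge vF 0 (a i)) /\ vge V 1 (x - \sum_i a i *: W i)) ->
  (forall x, B x -> x != 0 -> exists n : int, V x = n * m%:Z) ->
  forall x, B x -> exists a : 'I_r * 'I_h -> F,
    x = \sum_z a z *: (W z.1 * c ^+ z.2).
Proof.
move=> hB Bc c0 Vc mh m0 hW hW1 hV.
have hc : vge V 0 c by rewrite vgeE// Vc.
have step x : B x -> vge V 0 x -> forall j : nat,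
    exists a : nat -> 'I_r -> F, (forall j i, vge vF 0 (a j i)) /\
    exists2 y, B y /\ vge V 0 y &
      x = \sum_(j' < j) \sum_i a j' i *: (W i * c ^+ j') + y * c ^+ j.
  move=> Bx x0; elim=> [|j [a [ha [y [By y0] ex]]]].
    exists (fun _ _ => 0); split=> [j i|]; first exact: vge0.
    by exists x; rewrite // big_ord0 add0r mulr1.
  have [a1 [ha1 hd]] := hW1 y By y0; set d := y - _ in hd.
  have Bd : B d.
    apply: (sdB hB) => //; apply: sd_sum => // i; apply: (sdZ hB).
    by case: (hW i).
  pose a' j' i := if j' == j then a1 i else a j' i.
  exists a'; split=> [j' i|]; first by rewrite /a'; case: eqP.
  exists (d * c^-1).
    split; first by apply: (sdM hB) => //; apply: (sdV hB).
    have [->|d0] := eqVneq d 0; first by rewrite mul0r vge0.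
    rewrite vgeE ?(mulf_neq0 V) ?(inv_neq0 V)// dvM ?(inv_neq0 V)// dvV// Vc.
    have [n Vd] := hV d Bd d0; rewrite vgeE// in hd.
    by rewrite Vd in hd *; rewrite subr_ge0; exact: int_mul_ge.
  rewrite big_ord_recr /= exprS mulrA -[d * _ * c]mulrA (dmulVf V)// mulr1.
  rewrite {1}ex; have -> : y = d + \sum_i a1 i *: W i by rewrite subrK.
  rewrite mulrDl [d * _ + _]addrC addrA; congr (_ + _ + _).
    by apply: eq_bigr => j' _; rewrite /a' (ltn_eqF (ltn_ord j')).
  by rewrite mulr_suml; apply: eq_bigr => i _; rewrite /a' eqxx scalerAl.
pose G (z : 'I_r * 'I_h) := W z.1 * c ^+ z.2.
have int x : B x -> vge V 0 x -> exists a : 'I_r * 'I_h -> F, x = \sum_z a z *: G z.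
  move=> Bx x0; have [||a [_ ->]] := series_span hF pi0 vpi av (b := G) (B := B) _ _ Bx x0.
  - by move=> z; apply: vge0M; [case: (hW z.1)|exact: vgeX].
  - move=> y By y0; have [a [ha [z [Bz z0] ey]]] := step y By y0 h.
    exists (fun z : 'I_r * 'I_h => a z.2 z.1); split=> //.
    have ch0 : c ^+ h != 0 by rewrite (exp_neq0 V).
    exists (pi^-1 *: (z * c ^+ h)).
      split; first by apply: (sdZ hB); apply: (sdM hB) => //; exact: sdX.
      rewrite -[0](addNr e%:Z).
      have := @vgeZ _ _ _ _ _ av (-1) e%:Z pi^-1 (z * c ^+ h).
      rewrite mulNrn natz; apply; first by rewrite vgeE ?invr_neq0// dvV// [vF pi]vpi.
      rewrite -[e%:Z]add0r; apply: vgeM => //.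
      by rewrite vgeE// dvX// Vc intmulnE -PoszM mh.
    rewrite scalerA mulfV// scale1r {1}ey; congr (_ + _).
    by rewrite exchange_big pair_big.
  by exists a.
move=> x Bx; have [->|x0] := eqVneq x 0.
  by exists (fun=> 0); rewrite big1// => z _; rewrite scale0r.
have [a a0 va] := Lam_scale pi0 vpi `|V x|%N%:Z.
have [||b eb] := int (a *: x); first exact: (sdZ hB).
  rewrite -[0](subrr (V x)); apply: (@vge_le _ _ _ (`|V x|%N%:Z *+ e + V x)).
    have := av_gt0 av; rewrite intmulnE; move: (V x) => w; nia.
  by apply: (vgeZ av); rewrite vgeE// va.
exists (fun z => a^-1 * b z); rewrite -[x](scalerK a0) eb scaler_sumr.
by apply: eq_bigr => z _; rewrite scalerA.
Qed.

Variables (w : A).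
Hypotheses (wM : w ^+ M = 1) (w_gen : forall x, vunit V x -> exists i, vge V 1 (x - w ^+ i))
  (w_ord : forall i, vge V 1 (w ^+ i - 1) = (M %| i)%N).

Let w_unit : vunit V w := root_unit V wM.
Let wX_eq := root_powers_eq hred wM w_ord.
Let wX_cong := root_powers_cong hred wM w_ord.

Lemma residue_approx x : vge V 0 x -> exists a : 'I_M -> F,
  (forall i, vge vF 0 (a i)) /\ vge V 1 (x - \sum_i a i *: w ^+ i).
Proof.
move=> hx; have [ux|hx1] := vunit_cases hx; last first.
  exists (fun=> 0); split=> [i|]; first exact: vge0.
  by rewrite big1 ?subr0// => i _; rewrite scale0r.
have [i hi] := w_gen ux; have hm : (i %% M < M)%N by rewrite ltn_mod M_gt0.
exists (fun j => (j == Ordinal hm)%:R); split=> [j|]; first exact: vge_nat.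
rewrite (bigD1 (Ordinal hm))//= eqxx scale1r big1 => [|j /negPf ->]; last first.
  by rewrite scale0r.
rewrite addr0; have -> : w ^+ (i %% M) = w ^+ i; last by [].
by apply/eqP; rewrite wX_eq modn_mod.
Qed.

Variables (u : A) (N : nat).
Hypotheses (u0 : u != 0) (Vu : V u = 1) (uw : u * w = w ^+ N * u).

Lemma uX_w i j : u ^+ i * w ^+ j = w ^+ (N ^ i * j) * u ^+ i.
Proof.
have h1 j' : u * w ^+ j' = w ^+ (N * j') * u.
  elim: j' => [|j' IH]; first by rewrite muln0 mulr1 mul1r.
  by rewrite exprS mulrA uw -mulrA IH mulrA -exprD mulnS.
elim: i j => [|i IH] j; first by rewrite !mul1r expn0 mul1n mulr1.
by rewrite exprSr -mulrA h1 mulrA IH expnSr -!mulnA -mulrA -exprSr.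
Qed.

Lemma uX_neq0 i : u ^+ i != 0. Proof. by rewrite (exp_neq0 V). Qed.

Lemma wNX_inj i d : w ^+ (N ^ (i + d)) = w ^+ (N ^ i) -> w ^+ (N ^ d) = w.
Proof.
move=> h; apply: (dmulIf V (uX_neq0 d)); apply: (dmulfI V (uX_neq0 i)).
have := uX_w i 1; have := uX_w (i + d) 1; rewrite !muln1 !expr1 h exprD => e1 e2.
have := uX_w d 1; rewrite muln1 expr1 => <-.
by rewrite !mulrA e1 e2 mulrA.
Qed.

Lemma V_uX i : V (u ^+ i) = i%:Z.
Proof. by rewrite dvX// Vu natz. Qed.

Lemma u_int : vge V 0 u. Proof. by rewrite vgeE// Vu. Qed.

(* Conjugation by [u] is trivial on the residue field after [e] steps since a
   uniformizer of [F] is central. *)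
Lemma wNe : w ^+ (N ^ e) = w.
Proof.
have pA0 : pi%:A != 0 :> A by exact: alg_neq0.
have ue0 := uX_neq0 e.
pose y := pi%:A * (u ^+ e)^-1.
have y0 : y != 0 by rewrite (mulf_neq0 V) ?(inv_neq0 V).
have uy : vunit V y.
  rewrite /vunit y0 dvM ?(inv_neq0 V)// dvV// V_uX (V_pi pi0 vpi av).
  by rewrite subrr.
have ey : pi%:A = y * u ^+ e by rewrite /y -mulrA (dmulVf V)// mulr1.
have e1 : w * y = y * w ^+ (N ^ e).
  apply: (dmulIf V ue0); rewrite -mulrA -ey -mulrA.
  have := uX_w e 1; rewrite muln1 expr1 => <-.
  by rewrite mulrA -ey mulr_algl mulr_algr.
have hw := vunit_vge w_unit.
have hN : vge V 1 (w ^+ (N ^ e) - w ^+ 1).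
  rewrite expr1 -[_ - _]mul1r -(dmulVf V y0) -mulrA mulrBr.
  apply: vgeMl; first by apply: vunit_vge; exact: vunitV.
  by rewrite -e1; apply: (vge_comm hred) => //; exact: vunit_vge.
by rewrite (wX_cong hN).
Qed.

(** [t] is the order of conjugation by [u] on [w]. *)
Definition w_spec_order (t : nat) :=
  [/\ (0 < t)%N, w ^+ (N ^ t) = w & forall i, (0 < i)%N -> w ^+ (N ^ i) = w -> (t <= i)%N].

Lemma w_order_exists : exists t, w_spec_order t.
Proof.
have ex : exists t, (0 < t)%N && (w ^+ (N ^ t) == w).
  by exists e; rewrite (av_gt0 av) wNe eqxx.
case: (ex_minnP ex) => t /andP[t0 /eqP ht] min; exists t; split=> // i i0 hi.
by apply: min; rewrite i0 hi eqxx.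
Qed.

Lemma full_sub_division : sub_division (fun _ : A => True).
Proof. by []. Qed.

(** The products of a power of [w] and a power of [u] span [A] over [F]. *)
Lemma commutes_central x : x * w = w * x -> x * u = u * x -> forall y, x * y = y * x.
Proof.
move=> xw xu y.
have [||||a ->] := @span_sub (fun=> True) M (fun i => w ^+ i) u 1 e _ I u0 Vu (mul1n e) isT _ _ _ y I.
- exact: full_sub_division.
- by move=> i; split=> //; apply: vgeX; apply: vunit_vge; exact: w_unit.
- by move=> z _; exact: residue_approx.
- by move=> z _ z0; exists (V z); rewrite mulr1.
rewrite mulr_sumr mulr_suml; apply: eq_bigr => z _.
rewrite -scalerAr -scalerAl; congr (_ *: _).
by apply: commrM; apply: commrX.
Qed.

Hypothesis central : forall x : A, (forall y, x * y = y * x) -> exists a : F, x = a%:A.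

Section Order.
Variable (t : nat).
Hypothesis ht : w_spec_order t.

(** [u^t] commutes with [w] and [u], so it is a scalar and its valuation [t] is a positive multiple
    of [e]. The other inequality is [wNe]. *)
Lemma order_eq_e : t = e.
Proof.
have [t0 wt min] := ht; apply/eqP; rewrite eqn_leq min ?(av_gt0 av) ?wNe//=.
have [||a ea] := central (commutes_central (x := u ^+ t) _ _).
- by have := uX_w t 1; rewrite muln1 expr1 wt.
- by rewrite -exprSr exprS.
have a0 : a != 0.
  by apply/eqP => a0; have := uX_neq0 t; rewrite ea a0 scale0r eqxx.
have := V_uX t; rewrite ea (av_base av a0) intmulnE.
have e0 := av_gt0 av; move: (v a) => c h; have [c0|c0] := lerP c 0; last by nia.
have : c * e%:Z <= 0 by nia.
lia.
Qed.

Lemma wNX_neq i j : (i < j < t)%N -> w ^+ (N ^ i) != w ^+ (N ^ j).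
Proof.
move=> /andP[ij jt]; apply/eqP => h; have [_ _ min] := ht.
have := @wNX_inj i (j - i); rewrite subnKC 1?ltnW// => /(_ (esym h)) /min.
by rewrite subn_gt0 ij => /(_ isT); lia.
Qed.

Definition conj_u (x : A) := u * x * u^-1.
Lemma conj_u_zmod : zmod_morphism conj_u.
Proof. by move=> x y; rewrite /conj_u mulrBr mulrBl. Qed.
Lemma conj_u_monoid : monoid_morphism conj_u.
Proof.
split=> [|x y]; first by rewrite /conj_u mulr1 (dmulfV V).
by rewrite /conj_u !mulrA -[_ * u^-1 * u]mulrA (dmulVf V)// mulr1.
Qed.
HB.instance Definition _ := GRing.isZmodMorphism.Build A A conj_u conj_u_zmod.
HB.instance Definition _ := GRing.isMonoidMorphism.Build A A conj_u conj_u_monoid.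

Let R i : {poly A} := 'X - (w ^+ (N ^ i))%:P.

Lemma R_comm i j : GRing.comm (R i) (R j).
Proof.
apply: commrB; first exact: commr_polyX.
apply/commr_sym/commrB; first exact: commr_polyX.
by rewrite /GRing.comm -!polyCM -!exprD addnC.
Qed.

Lemma conj_R i : map_poly conj_u (R i) = R i.+1.
Proof.
rewrite /R rmorphB /= map_polyX map_polyC /=; congr (_ - _%:P).
rewrite /conj_u; have := uX_w 1 (N ^ i); rewrite !expr1 expn1 => ->.
by rewrite -mulrA (dmulfV V)// mulr1 expnS.
Qed.

(* The polynomial with roots the conjugates of [w] has central coefficients. *)
Lemma w_pow_rel : exists a : 'I_t -> F,
  (forall i, vge vF 0 (a i)) /\ w ^+ t = \sum_i a i *: w ^+ i.
Proof.
have [t0 wt _] := ht.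
pose P := \prod_(i < t) R i.
have size_P : size P = t.+1.
  by rewrite /P size_prod_XsubC /index_enum -enumT size_enum_ord.
have Pm : P \is monic by exact: monic_prod_XsubC.
have cP : map_poly conj_u P = P.
  rewrite /P rmorph_prod (eq_bigr (fun i : 'I_t => R i.+1)) => [|i _]; last exact: conj_R.
  case: (t) t0 wt => // t' _ wt; rewrite big_ord_recr big_ord_recl /=.
  have -> : R t'.+1 = R 0%N by rewrite /R wt expn0 expr1.
  by apply/commr_sym/commr_prod => i _; exact: R_comm.
have wP : GRing.comm P w%:P.
  apply/commr_sym/commr_prod => i _; apply: commrB; first exact: commr_polyX.
  by rewrite /GRing.comm -!polyCM -exprS -exprSr.
(* A coefficient commutes with [w] because all the roots are powers of [w], and with [u] because
   conjugation by [u] permutes the roots. *)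
have coefc i : exists a : F, P`_i = a%:A.
  apply: central; apply: commutes_central.
    by have /(congr1 (fun q : {poly A} => q`_i)) := wP; rewrite coefMC coefCM.
  have := congr1 (fun q : {poly A} => q`_i) cP; rewrite coef_map /= /conj_u => h.
  by rewrite -{1}h -mulrA (dmulVf V)// mulr1.
have coefi : forall i, vge V 0 P`_i.
  rewrite /P; apply: (big_ind (fun q : {poly A} => forall i, vge V 0 q`_i)).
  - by move=> i; rewrite coef1; exact: vge_nat.
  - move=> f g hf hg i; rewrite coefM; apply: vge_sum => j _; exact: vge0M.
  - move=> j _ i; rewrite coefB coefX coefC; apply: vgeB; first exact: vge_nat.
    by case: eqP => _; [apply: vgeX; apply: vunit_vge; exact: w_unit|exact: vge0].
have [a ha] := choice coefc.
exists (fun i => - a i); split=> [i|].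
  by rewrite vgeN -(vge0_alg av) -ha.
have rP : root P w.
  rewrite /P; case: (t) t0 => // t' _; rewrite big_ord_recl /=.
  (* Over a noncommutative ring a root corresponds to a linear factor on the right, so this factor
     is moved there. *)
  have -> : R 0%N * \prod_(i < t') R (lift ord0 i) = \prod_(i < t') R (lift ord0 i) * R 0%N.
    by apply: commr_prod => i _; exact: R_comm.
  by apply/factor_theorem; eexists; rewrite /R expn0 expr1.
move/rootP: rP; rewrite horner_coef size_P big_ord_recr /=.
have -> : P`_t = 1 by move/monicP: Pm; rewrite lead_coefE size_P.
rewrite mul1r addrC => /eqP; rewrite addr_eq0 => /eqP ->.
rewrite -sumrN; apply: eq_bigr => i _.
by rewrite ha scaleNr mulr_algl.
Qed.

Lemma w_pow_span s : exists a : 'I_t -> F,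
  (forall i, vge vF 0 (a i)) /\ w ^+ s = \sum_i a i *: w ^+ i.
Proof.
have [t0 _ _] := ht; have [b [hb eb]] := w_pow_rel.
elim: s => [|s [a [ha ea]]].
  exists (fun i => (i == Ordinal t0)%:R); split=> [i|]; first exact: vge_nat.
  rewrite (bigD1 (Ordinal t0))//= ?eqxx scale1r big1 ?addr0// => i /negPf ->.
  by rewrite scale0r.
rewrite exprS ea mulr_sumr.
have [t' et] : exists t', t = t'.+1 by exists t.-1; rewrite prednK.
pose a0 (i : nat) : F := if insub i is Some j then a j else 0.
have a0E (i : 'I_t) : a0 i = a i by rewrite /a0 valK.
exists (fun i : 'I_t => (if val i is j.+1 then a0 j else 0) + a0 t' * b i); split=> [i|].
  have ha0 j : vge vF 0 (a0 j) by rewrite /a0; case: insubP => *; [exact: ha|exact: vge0].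
  apply: vgeD; last exact: vge0M.
  by case: (val i) => [|j]; [exact: vge0|exact: ha0].
transitivity (\sum_(i < t) a0 i *: w ^+ i.+1).
  by apply: eq_bigr => i _; rewrite a0E -scalerAr exprS.
under [RHS]eq_bigr => i _ do rewrite scalerDl -scalerA.
rewrite big_split /= -scaler_sumr -eb.
rewrite et.
rewrite big_ord_recr /= big_ord_recl /= scale0r add0r; congr (_ + _).
Qed.

Lemma vge1_alg (a : F) : vge V 1 (a%:A) -> vge vF 1 a.
Proof.
have [->|a0] := eqVneq a 0; first by rewrite vge0.
rewrite !vgeE ?alg_neq0// (av_base av a0) intmulnE [vF a]/(v a) => h.
have [c0|//] := lerP (v a) 0; have : v a * e%:Z <= 0 by nia.
lia.
Qed.

Lemma red_w_neq i j : (i < j < t)%N -> red w ^+ (N ^ i) != red w ^+ (N ^ j).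
Proof.
move=> ij; have hw := vunit_vge w_unit; rewrite -!(redX hred)//; apply/eqP.
move/(red_eq hred); rewrite !vgeX// => /(_ isT isT) /wX_cong /eqP.
exact/negP/wNX_neq.
Qed.

(* A polynomial over the residue field of [F] killing the residue of [w] also
   kills its [t] conjugates. *)
Lemma res_indep (a : 'I_t -> F) : (forall i, vge vF 0 (a i)) ->
  vge V 1 (\sum_i a i *: w ^+ i) -> forall i, vge vF 1 (a i).
Proof.
move=> ha hs i0; have hw := vunit_vge w_unit.
have hA i : vge V 0 ((a i)%:A) by rewrite (vge0_alg av).
pose g (i : nat) := if insub i is Some j then red ((a j)%:A) else 0.
have gE (i : 'I_t) : g i = red ((a i)%:A) by rewrite /g valK.
pose P := \poly_(i < t) g i.
have P0 : P = 0.
  apply: contraTeq isT => P0; apply/negP => _.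
  have := @max_poly_roots _ P [seq red w ^+ (N ^ i) | i <- iota 0 t] P0.
  rewrite size_map size_iota => /(_ _ _)/wrap[].
  - apply/allP => c /mapP[j _ ->]; apply/rootP; rewrite horner_poly.
    have : vge V 1 (u ^+ j * (\sum_i a i *: w ^+ i) * (u ^+ j)^-1).
      by rewrite dv_unit_conj// uX_neq0.
    have -> : u ^+ j * (\sum_i a i *: w ^+ i) * (u ^+ j)^-1 =
        \sum_i (a i)%:A * w ^+ (N ^ j) ^+ i.
      rewrite mulr_sumr mulr_suml; apply: eq_bigr => i _.
      rewrite -scalerAr -scalerAl mulr_algl uX_w -mulrA (dmulfV V) ?uX_neq0// mulr1.
      by rewrite exprM.
    move=> h1; apply: (etrans (y := red (\sum_i (a i)%:A * w ^+ (N ^ j) ^+ i))).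
      rewrite (red_sum hred) => [|i]; last by apply: vge0M; rewrite ?vgeX.
      apply: eq_bigr => i _; rewrite gE (redM hred) ?vgeX// !(redX hred) ?vgeX//.
    apply/(red_eq0 hred) => //.
    by apply: vge_sum => i _; apply: vge0M; rewrite ?vgeX.
  - rewrite map_inj_in_uniq ?iota_uniq// => i j; rewrite !mem_iota !add0n /= => it jt.
    move=> /eqP e1; apply/eqP; apply: contraTT e1 => ij.
    have [lt|lt|/eqP] := ltngtP i j; last by rewrite (negPf ij).
      by apply: red_w_neq; rewrite lt.
    by rewrite eq_sym; apply: red_w_neq; rewrite lt.
  - by rewrite ltnNge size_poly.
have : P`_i0 = 0 by rewrite P0 coef0.
rewrite coef_poly ltn_ord gE => /(red_eq0 hred (hA i0)); exact: vge1_alg.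
Qed.

Lemma residue_basis x : vge V 0 x -> exists a : 'I_t -> F,
  (forall i, vge vF 0 (a i)) /\ vge V 1 (x - \sum_i a i *: w ^+ i).
Proof.
move=> hx; have [ux|hx1] := vunit_cases hx; last first.
  exists (fun=> 0); split=> [i|]; first exact: vge0.
  by rewrite big1 ?subr0// => i _; rewrite scale0r.
have [i hi] := w_gen ux; have [a [ha ea]] := w_pow_span i.
by exists a; rewrite -ea.
Qed.

(** The residues of [1, w, ..., w^(t-1)] form a basis of the residue field over that of [F]. *)
Lemma card_residue : Q = (q ^ t)%N.
Proof.
have [s [s0 s1 s2]] := local_reps hF.
pose f (c : {ffun 'I_t -> 'I_q}) := red (\sum_i s (c i) *: w ^+ i).
have hw := vunit_vge w_unit.
have hsum (a : 'I_t -> F) : (forall i, vge vF 0 (a i)) -> vge V 0 (\sum_i a i *: w ^+ i).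
  by move=> ha; apply: vge_sum => i _; apply: (vge0Z av) => //; exact: vgeX.
have f_inj : injective f.
  move=> c c' /(red_eq hred (hsum _ (fun=> s0 _)) (hsum _ (fun=> s0 _))).
  rewrite -sumrB => h; apply/ffunP => i; apply: s2.
  apply: (@res_indep (fun i => s (c i) - s (c' i))) => [j|]; first exact: vgeB.
  by move: h; congr (vge V 1 _); apply: eq_bigr => j _; rewrite scalerBl.
have f_surj y : y \in codom f.
  have [x hx <-] := red_surj hred y; have [a [ha hd]] := residue_basis hx.
  have [c hc] := choice (fun i => s1 _ (ha i)).
  apply/codomP; exists [ffun i => c i]; apply/(red_eq hred) => //; first exact: hsum.
  apply: vge_trans hd _; rewrite -sumrB; apply: vge_sum => i _.
  rewrite ffunE -scalerBl -mulr_algl; apply: vgeMr; last exact: vgeX.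
  apply: (@vge_le _ _ _ (1%:Z *+ e)); first by rewrite natz; have := av_gt0 av; lia.
  by rewrite (vge_alg av).
have <- : #|{ffun 'I_t -> 'I_q}| = (q ^ t)%N by rewrite card_ffun !card_ord.
have := card_codom f_inj; move=> <-; apply: eq_card => y.
by rewrite f_surj inE.
Qed.

(** Descent: once denominators are cleared, the coefficients of a relation are divisible by every
    power of [pi]. *)
Lemma free_of_mod (I : finType) (G : I -> A) :
  (forall a : I -> F, (forall z, vge vF 0 (a z)) -> vge V e%:Z (\sum_z a z *: G z) ->
     forall z, vge vF 1 (a z)) ->
  forall a : I -> F, \sum_z a z *: G z = 0 -> forall z, a z = 0.
Proof.
move=> hG a ha z0.
have [C hC] := vge_finite vF a.
have key (n : nat) : forall z, vge vF n%:Z (pi ^+ C * a z).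
  elim: n => [|n IH] z.
    by rewrite -[0%:Z](subrr C%:Z); apply: vgeM => //; exact: vge_piX.
  have hb z' : vge vF 0 (pi ^- n * (pi ^+ C * a z')).
    rewrite -[0](addNr n%:Z); apply: vgeM => //.
    by rewrite vgeE ?invr_neq0 ?expf_neq0// dvV ?expf_neq0// (vpiX pi0 vpi).
  have := hG _ hb _ z; rewrite (_ : \sum_z' _ = 0) ?vge0 => [/(_ isT) h1|].
    have -> : pi ^+ C * a z = pi ^+ n * (pi ^- n * (pi ^+ C * a z)).
      by rewrite mulrA mulfV ?expf_neq0// mul1r.
    by rewrite -addn1 PoszD; apply: vgeM => //; exact: vge_piX.
  transitivity ((pi ^- n * pi ^+ C) *: \sum_z' a z' *: G z'); last by rewrite ha scaler0.
  by rewrite scaler_sumr; apply: eq_bigr => z' _; rewrite scalerA mulrA.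
have /eqP := @vge_all0 _ vF _ (fun n => key n z0).
by rewrite mulf_eq0 expf_eq0 (negPf pi0) andbF /= => /eqP.
Qed.

(** The products [w^i u^j] with [i < t] and [j < e] form a basis, and [t = e]. Comparison with the
    dimension [d^2] later identifies [t] with [d]. *)
Lemma dim_square : \dim {:A} = (t * t)%N.
Proof.
have te := order_eq_e; have hw := vunit_vge w_unit.
apply/eqP; rewrite eqn_leq; apply/andP; split.
  have -> : (t * t)%N = #|{: 'I_t * 'I_e}| by rewrite card_prod !card_ord te.
  apply: (@dim_le_spanning _ _ _ _ (fun z : 'I_t * 'I_e => w ^+ z.1 * u ^+ z.2)) => x _.
  apply: (@span_sub (fun=> True) t (fun i => w ^+ i) u 1 e _ I u0 Vu (mul1n e) isT) => //.
  - by move=> i; split=> //; exact: vgeX.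
  - by move=> z _; exact: residue_basis.
  - by move=> z _ z0; exists (V z); rewrite mulr1.
have -> : (t * t)%N = #|{: 'I_t * 'I_e}| by rewrite card_prod !card_ord te.
apply: (@dim_ge_free _ _ _ (fun z : 'I_t * 'I_e => w ^+ z.1 * u ^+ z.2)).
apply: free_of_mod => a ha hs.
pose S (j : 'I_e) := \sum_i a (i, j) *: w ^+ i.
have hS j : vge V 0 (S j).
  by apply: vge_sum => i _; apply: (vge0Z av) => //; exact: vgeX.
have eS : \sum_z a z *: (w ^+ z.1 * u ^+ z.2) = \sum_j S j * u ^+ j.
  transitivity (\sum_(z : 'I_t * 'I_e) a (z.1, z.2) *: (w ^+ z.1 * u ^+ z.2)).
    by apply: eq_bigr => -[].
  rewrite -(pair_bigA _ (fun i j => a (i, j) *: (w ^+ i * u ^+ j))) exchange_big.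
  apply: eq_bigr => j _; rewrite mulr_suml.
  by apply: eq_bigr => i _; rewrite scalerAl.
(* Modulo valuation [j + 1] only the term at [j] is left: the earlier ones have coefficients
   divisible by [pi], of valuation [e > j], and the later ones contain a higher power of [u]. *)
have key (n : nat) : forall j : 'I_e, (j < n)%N -> forall i, vge vF 1 (a (i, j)).
  elim: n => // n IH j; rewrite ltnS leq_eqVlt => /orP[/eqP jn|]; last exact: IH.
  apply: res_indep => //; rewrite -/(S j).
  have [->|Sj0] := eqVneq (S j) 0; first exact: vge0.
  have : vge V (j%:Z + 1) (S j * u ^+ j).
    have -> : S j * u ^+ j = \sum_z a z *: (w ^+ z.1 * u ^+ z.2) -
        \sum_(j' | j' != j) S j' * u ^+ j'.
      by rewrite eS (bigD1 j)//= addrK.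
    apply: vgeB; first by apply: vge_le hs; have := ltn_ord j; lia.
    apply: vge_sum => j' jj'; have [lt|gt|/val_inj e1] := ltngtP j' j; last first.
    - by rewrite e1 eqxx in jj'.
    - apply: vgeMl => //; rewrite vgeE ?uX_neq0// V_uX; lia.
    - apply: (@vge_le _ _ _ e%:Z); first by have := ltn_ord j; lia.
      apply: vgeMr; last by apply: vgeX; exact: u_int.
      apply: vge_sum => i _; have := @vgeZ _ _ _ _ _ av 1 0 (a (i, j')) (w ^+ i).
      rewrite addr0 natz; apply; last exact: vgeX.
      by apply: IH; rewrite -jn.
  by rewrite !vgeE ?(mulf_neq0 V) ?uX_neq0// dvM ?uX_neq0// V_uX; move: (V (S j)); lia.
by move=> [i j]; apply: (key j.+1).
Qed.

End Order.
End Skew.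

Lemma valued_algebra_exists (F : fieldType) (v : discrete_valuation F) (p q : nat)
    (A : falgType F) : local_field v p q -> GRing.field_axiom A ->
  exists (V : divval A) (e : nat) (k : finFieldType) (red : A -> k),
    alg_val v V e /\ residue_map V red.
Proof.
move=> hF hA; have [pi pi0 vpi] := dval_onto v.
have [V [e av]] := alg_val_exists hF hA pi0 vpi.
have [s hs] := av_finite av.
have hs' : residue_system V s.
  move=> x /hs[y ys hy]; exists y => //; apply: vge_le hy.
  by have := av_gt0 av; lia.
have [k [red [h1 h2 h3 h4]]] := residue_field_exists hs'.
by exists V, e, k, red; split.
Qed.

Lemma teichmuller_generator (A : unitRingType) (V : divval A) (k : finFieldType)
    (red : A -> k) (w : A) : residue_map V red ->
  (forall u : nat -> A, (forall n : nat, vge V n%:Z (u n.+1 - u n)) ->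
    exists x, forall n : nat, vge V n%:Z (x - u n)) ->
  vunit V w -> (forall x, vunit V x -> exists i, vge V 1 (x - w ^+ i)) ->
  (forall i, vge V 1 (w ^+ i - 1) = (#|k|.-1 %| i)%N) ->
  exists z, [/\ z ^+ #|k|.-1 = 1,
    forall x, vunit V x -> exists i, vge V 1 (x - z ^+ i),
    forall i, vge V 1 (z ^+ i - 1) = (#|k|.-1 %| i)%N &
    forall y, y * w = w * y -> y * z = z * y].
Proof.
move=> hred hlim uw gen ord.
have [z [zM zw comm]] := teichmuller hred hlim uw.
have hz : vge V 0 z by apply: vge_of_cong zw; exact: vunit_vge.
have hX i : vge V 1 (z ^+ i - w ^+ i) by apply: vge_congX.
exists z; split=> // [x /gen[i hi]|i].
  by exists i; apply: vge_trans hi _; rewrite vge_sub_sym.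
rewrite -ord; apply/idP/idP; apply: vge_trans => //.
by rewrite vge_sub_sym.
Qed.

Lemma centralizerP (F : fieldType) (K : fieldExtType F) (A : falgType F)
    (j : {lrmorphism K -> A}) (x : A) :
  x \in centralizer j <-> forall y, x * j y = j y * x.
Proof.
split=> [/centvP h y|h].
  have := h (linfun j y) (memv_img _ (memvf y)); rewrite lfunE; exact.
by apply/centvP => y /memv_imgP[y' _ ->]; rewrite lfunE; exact: h.
Qed.

Lemma centralizer_sub_division (F : fieldType) (K : fieldExtType F) (A : falgType F)
    (V : divval A) (j : {lrmorphism K -> A}) :
  sub_division (fun x : A => forall y, x * j y = j y * x).
Proof.
split=> [x y hx hy z|x y hx hy z|a x hx z|z|x hx z].
- by rewrite mulrBl mulrBr hx hy.
- by rewrite -mulrA hy mulrA hx mulrA.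
- by rewrite -scalerAl hx scalerAr.
- by rewrite mul1r mulr1.
have [->|x0] := eqVneq x 0; first by rewrite invr0 mul0r mulr0.
apply: (dmulfI V x0); rewrite !mulrA hx (dmulfV V)// mul1r.
by rewrite -mulrA (dmulfV V)// mulr1.
Qed.

(** A uniformizer of [K] is a product [a y] with [a] in the maximal ideal of [F] and [y] integral,
    so its valuation 1 is at least [e]. *)
Lemma unramified_index (F : fieldType) (v : discrete_valuation F) (p q : nat)
    (K : fieldExtType F) (V : divval K) (e : nat) :
  local_field v p q -> alg_val v V e -> unramified (vring_inc v) K -> e = 1%N.
Proof.
move=> hF av unr; have [pi pi0 vpi] := dval_onto v.
have [x x0 Vx] := dv_onto V.
have [|a [y [ha hy ex]]] := unr x.
  by apply/(max_ideal_vge hF pi0 vpi av); rewrite vgeE// Vx.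
have a0 : a != 0 by apply: contraNneq x0 => a0; rewrite ex a0 scale0r.
have y0 : y != 0 by apply: contraNneq x0 => y0; rewrite ex y0 scaler0.
have va : 1 <= v a.
  have hint (z : F) : val_ge v 0 z -> integers (vring_inc v) z.
    move=> hz; rewrite -[z]/(vring_inc v (VRing hz)); exact: integral_id.
  have h0 : vge (field_dval v) 0 a.
    by apply: integral_vge ha.1 => r; exact: (valP r).
  rewrite vgeE// in h0; have {}h0 : 0 <= v a by exact: h0.
  apply: contrapT => n1; apply: ha.2; split; first by rewrite unitfE.
  apply: hint; change (vge (field_dval v) 0 a^-1); rewrite vgeE ?invr_neq0// dvV//.
  have e0 : v a = 0 by move/negP: n1; rewrite -ltNge; lia.
  by rewrite [field_dval v a]e0.
move/(integers_vge hF pi0 vpi av): hy; rewrite vgeE// => hy.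
move: Vx; rewrite ex -mulr_algl dvM ?alg_neq0// (av_base av a0) intmulnE.
by have := av_gt0 av; move: (v a) (V y) va hy; nia.
Qed.

Lemma uniq_roots_iota (A : unitRingType) (f : nat -> A) (s n : nat) :
  (forall i i', (s <= i < i')%N -> (i' < s + n)%N -> diff_roots (f i) (f i')) ->
  uniq_roots [seq f i | i <- iota s n].
Proof.
elim: n s => //= n IH s h; apply/andP; split.
  apply/allP => y /mapP[i]; rewrite mem_iota => /andP[si ism] ->.
  by apply: h; [rewrite leqnn|rewrite addnS -addSn].
apply: IH => i i' /andP[si ii'] lt.
by apply: h; [rewrite (ltnW si)|rewrite addnS -addSn].
Qed.

Lemma diff_roots_pow (A : unitRingType) (V : divval A) (w : A) (i j : nat) :
  w ^+ i != w ^+ j -> diff_roots (w ^+ i) (w ^+ j).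
Proof.
move=> h; rewrite /diff_roots -!exprD addnC eqxx /= (unit_neq0 V) subr_eq0 eq_sym.
exact: h.
Qed.

(* [w] is a root of unity generating the residue field and commuting with [K],
   [u] a uniformizer normalizing [w], [b] an element of the centralizer of [K]
   of minimal positive valuation [m], and [z] a root of unity generating [K]. *)
Record tame_structure (F : fieldType) (K : fieldExtType F) (D : falgType F)
    (V : divval D) (k : finFieldType) (j : {lrmorphism K -> D}) (q d : nat)
    (w u b z : D) (N m h : nat) : Prop := TameStructure {
  ts_wM : w ^+ #|k|.-1 = 1;
  ts_gen : forall x, vunit V x -> exists i, vge V 1 (x - w ^+ i);
  ts_ord : forall i, vge V 1 (w ^+ i - 1) = (#|k|.-1 %| i)%N;
  ts_u0 : u != 0;
  ts_Vu : V u = 1;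
  ts_uw : u * w = w ^+ N * u;
  ts_wB : forall y, w * j y = j y * w;
  ts_bB : forall y, b * j y = j y * b;
  ts_b0 : b != 0;
  ts_Vb : V b = m%:Z;
  ts_bw : b * w = w ^+ (N ^ m) * b;
  ts_m0 : (0 < m)%N;
  ts_mh : (m * h)%N = d;
  ts_div : forall x, x != 0 -> (forall y, x * j y = j y * x) ->
    exists n : int, V x = n * m%:Z;
  ts_order : w_spec_order w N d;
  ts_card : #|k| = (q ^ d)%N;
  ts_dim : (\dim (centralizer j) <= h * h * \dim {:K})%N;
  ts_zM : z ^+ #|k|.-1 = 1;
  ts_zK : exists y, z = j y;
  ts_zgen : forall (T : pzRingType) (f : {rmorphism D -> T}) (x : T),
    (forall a : F, x * f a%:A = f a%:A * x) -> x * f z = f z * x ->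
    forall y, x * f (j y) = f (j y) * x }.

(** * Generators of D adapted to the subfield K *)

Section Tame.
Variables (F : fieldType) (v : discrete_valuation F) (p q : nat).
Hypothesis hF : local_field v p q.
Variables (pi : F).
Hypotheses (pi0 : pi != 0) (vpi : v pi = 1).
Variables (D : falgType F) (V : divval D) (e : nat).
Hypothesis av : alg_val v V e.
Variables (k : finFieldType) (red : D -> k).
Hypothesis hred : residue_map V red.
Variables (d : nat) (hD : central_division D d).
Variables (K : fieldExtType F) (unrK : unramified (vring_inc v) K).
Variable j : {lrmorphism K -> D}.
Local Notation vF := (field_dval v).
Local Notation M := (#|k|.-1).

Lemma j_neq0 y : y != 0 -> j y != 0.
Proof. by rewrite fmorph_eq0. Qed.

Lemma center_scalar (x : D) : (forall y, x * y = y * x) -> exists a : F, x = a%:A.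
Proof.
move=> h; have [_ hZ _] := hD; apply/vlineP; rewrite -hZ.
by rewrite memv_cap memvf /=; apply/centvP => y _; rewrite h.
Qed.

(** As [K] is unramified, [pi] is a uniformizer of it and a lifted generator [z] of its residue
    field generates it over [F]. The last clause is stated along a ring morphism [f] so that it also
    serves for centralizers in [DE]. *)
Lemma K_root_of_unity : exists z : K, [/\ z != 0, j z ^+ M = 1 &
  forall (T : pzRingType) (f : {rmorphism D -> T}) (x : T),
    (forall a : F, x * f a%:A = f a%:A * x) -> x * f (j z) = f (j z) * x ->
    forall y, x * f (j y) = f (j y) * x].
Proof.
have hK : GRing.field_axiom K by move=> x x0; rewrite unitfE.
have [VK [eK [kK [redK [avK hredK]]]]] := valued_algebra_exists hF hK.
have eK1 := unramified_index hF avK unrK.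
have [w0 [uw0 gen0 ord0]] := residue_generator hredK.
have [z [zM zgen zord _]] := teichmuller_generator hredK (av_limit avK) uw0 gen0 ord0.
have MK0 : (0 < #|kK|.-1)%N by have := Q_gt1 kK; lia.
have z0 : z != 0.
  by apply/eqP => z0; have := zM; rewrite z0 expr0n gtn_eqF// => /eqP; rewrite eq_sym oner_eq0.
have Vj (y : K) : y != 0 -> V (j y) = VK y *+ e.
  move=> y0; have := algval_morph hF pi0 vpi avK av (h := j) _ y0.
  rewrite eK1 mulr1n; apply => a.
  exact: (rmorph_alg j).
have Vz : VK z = 0.
  have := dvX VK #|kK|.-1 z0; rewrite zM dv1 intmulnE; move: (VK z) => c; nia.
exists z; split=> //.
  have uj : vunit V (j z) by rewrite /vunit j_neq0// Vj// Vz mul0rn.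
  have h1 : vge V 1 (j (z ^+ M - 1)).
    by rewrite rmorphB rmorphXn rmorph1; exact: vunit_pow hred _ uj.
  have h2 : vge VK 1 (z ^+ M - 1).
    have [->|y0] := eqVneq (z ^+ M - 1) 0; first exact: vge0.
    move: h1; rewrite !vgeE ?j_neq0// Vj// intmulnE.
    by have := av_gt0 av; move: (VK _) => c; nia.
  move: h2; rewrite zord => /dvdnP[i ei].
  by rewrite -rmorphXn ei mulnC exprM zM expr1n rmorph1.
move=> T f x xF xz y.
have piK0 : pi%:A != 0 :> K by exact: alg_neq0.
have VpiK : VK pi%:A = 1 by rewrite (V_pi pi0 vpi avK) eK1.
have [||||a ->] := @span_sub _ _ _ _ hF _ pi0 vpi K VK eK avK (fun=> True)
    #|kK|.-1 (fun i => z ^+ i) pi%:A 1 eK _ I piK0 VpiK (mul1n _) isT _ _ _ y I.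
- exact: full_sub_division.
- move=> i; split=> //; apply: vgeX; by rewrite vgeE// Vz.
- by move=> y' _ hy'; exact: (residue_approx v hredK zM zgen zord).
- by move=> y' _ y0; exists (VK y'); rewrite mulr1.
rewrite !rmorph_sum mulr_sumr mulr_suml; apply: eq_bigr => i _ /=.
have xz' n : x * f (j z) ^+ n = f (j z) ^+ n * x by apply: commrX.
have jA (c : F) : j c%:A = c%:A by exact: rmorph_alg.
have -> : j (a i *: (z ^+ i.1 * pi%:A ^+ i.2)) =
    (a i)%:A * (j z ^+ i.1 * pi%:A ^+ i.2).
  by rewrite linearZ rmorphM !rmorphXn /= jA mulr_algl.
rewrite (rmorphM f) (rmorphM f (_ ^+ _)) !(rmorphXn f).
by apply: commrM => //; apply: commrM => //; exact: commrX.
Qed.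

(** Each generator is found up to higher valuation and then corrected by [averaging]: [w] so as to
    commute with [z], then [u] and [b] so as to normalize [w] exactly. *)
Lemma tame_structure_exists :
  exists (w u b z : D) (N m h : nat), tame_structure V k j q d w u b z N m h /\ e = d.
Proof.
have [z [z0 zM zgen]] := K_root_of_unity.
have hlim := av_limit av.
pose B (x : D) := forall y, x * j y = j y * x.
have hB : sub_division B := centralizer_sub_division V j.
have uz : vunit V (j z).
  rewrite /vunit j_neq0//; apply/eqP; have := dvX V M (j_neq0 z0).
  rewrite zM dv1 intmulnE; have := Q_gt1 k; move: (V (j z)) => c; nia.
have zB x : x * j z = j z * x -> B x.
  move=> xz; apply: (zgen D idfun) => // a.
  by rewrite /= mulr_algl mulr_algr.
have [w0 [uw0 gen0 ord0]] := residue_generator hred.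
have [w1 [w1z w1w0 _]] : exists w1, [/\ w1 * j z = j z * w1, vge V 1 (w1 - w0) & True].
  have V0 : V w0 = 0 by case/andP: uw0 => _ /eqP.
  have [|x' [h1 h2 _]] := averaging hred zM zM uz uz (vunit_neq0 uw0).
    rewrite V0; exact: (vge_comm hred (vunit_vge uw0) (vunit_vge uz)).
  by exists x'; split=> //; rewrite V0 in h2.
have uw1 := vunit_near uw0 w1w0.
have hX i : vge V 1 (w1 ^+ i - w0 ^+ i) by apply: vge_congX => //; exact: vunit_vge.
have gen1 x : vunit V x -> exists i, vge V 1 (x - w1 ^+ i).
  by move=> /gen0[i hi]; exists i; apply: vge_trans hi _; rewrite vge_sub_sym.
have ord1 i : vge V 1 (w1 ^+ i - 1) = (M %| i)%N.
  by rewrite -ord0; apply/idP/idP; apply: vge_trans => //; rewrite vge_sub_sym.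
have [w [wM gen ord wcomm]] := teichmuller_generator hred hlim uw1 gen1 ord1.
have uw : vunit V w by exact: root_unit wM.
have hw := vunit_vge uw; have w_0 := vunit_neq0 uw.
have wz : w * j z = j z * w by rewrite wcomm.
have wB : B w by exact: zB.
(* [j z] agrees with some [w^r] modulo the maximal ideal; the quotient is a 1-unit killed by [M],
   hence 1. Conjugates of [z] by powers of [u] thus become powers of [w]. *)
have [r er] : exists r, j z = w ^+ r.
  have [r hr] := gen _ uz; exists r.
  have wr0 : w ^+ r != 0 by rewrite (exp_neq0 V).
  have uwr := vunitX r uw.
  have wrz : j z * w ^+ r = w ^+ r * j z by apply/commr_sym/commr_sym/commrX/commr_sym.
  have e1 : (j z * (w ^+ r)^-1) ^+ M = 1.
    rewrite exprMn_comm; last exact: commrV.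
    by rewrite zM mul1r exprVn -exprM mulnC exprM wM expr1n invr1.
  have := U1_torsion_free hred _ e1; rewrite -(dmulfV V wr0) -mulrBl => /(_ _)/wrap[].
    by apply: vgeMr => //; apply: vunit_vge; exact: vunitV.
  by move=> /(dmulIf V (inv_neq0 V wr0)).
have [u0 u00 Vu0] := dv_onto V.
have [N hN] : exists N, vge V 1 (u0 * w * u0^-1 - w ^+ N).
  apply: gen; rewrite /vunit !(mulf_neq0 V) ?(inv_neq0 V)//= !dvM ?(mulf_neq0 V) ?(inv_neq0 V)// dvV//.
  by case/andP: uw => _ /eqP ->; rewrite addr0 subrr.
have wNM : (w ^+ N) ^+ M = 1 by rewrite -exprM mulnC exprM wM expr1n.
have [|u [uw' uu0 _]] := averaging hred wM wNM uw (vunitX N uw) u00.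
  have -> : u0 * w - w ^+ N * u0 = (u0 * w * u0^-1 - w ^+ N) * u0.
    by rewrite mulrBl -[u0 * w * _ * _]mulrA (dmulVf V)// mulr1.
  by rewrite addrC; apply: vgeM => //; rewrite vgeE.
have [u_0 Vu] := dv_near u00 uu0; rewrite Vu0 in Vu.
have central := center_scalar.
have [t ht] := w_order_exists pi0 vpi av hred wM ord u_0 Vu uw'.
have te := order_eq_e hF pi0 vpi av hred wM gen ord u_0 Vu uw' central ht.
have card_k := card_residue hF pi0 vpi av hred wM gen ord u_0 Vu uw' central ht.
have dimD := dim_square hF pi0 vpi av hred wM gen ord u_0 Vu uw' central ht.
have td : t = d.
  have [_ _ hdim] := hD; rewrite dimD in hdim.
  by apply/eqP; rewrite -eqn_sqr -hdim -mulnn.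
rewrite td in ht te card_k dimD; clear t td.
have ed : e = d by rewrite -te.
have exm : exists m, (0 < m)%N && `[< exists2 b, B b /\ b != 0 & V b = m%:Z >].
  exists e; rewrite (av_gt0 av); apply/asboolP; exists pi%:A.
    split; last exact: alg_neq0.
    by move=> y; rewrite mulr_algl mulr_algr.
  exact: (V_pi pi0 vpi av).
case: (ex_minnP exm) => m /andP[m0 /asboolP[b0 [b0B b00] Vb0]] mmin.
have div x : x != 0 -> B x -> exists n : int, V x = n * m%:Z.
  move=> x0 Bx; exists (V x %/ m%:Z)%Z; have := divz_eq (V x) m%:Z.
  suff -> : (V x %% m%:Z)%Z = 0 by rewrite addr0.
  have mz : m%:Z != 0 by rewrite eqz_nat -lt0n.
  have r0 := modz_ge0 (V x) mz.
  have r1 : (V x %% m%:Z)%Z < m%:Z by apply: ltz_pmod.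
  apply/eqP; apply: contraT => rn.
  have := mmin `|(V x %% m%:Z)%Z|%N => /(_ _)/wrap[].
    2: by move: r1; rewrite -{1}(gez0_abs r0) ltz_nat ltnNge => /negP h1 /h1.
  rewrite absz_gt0 rn /=.
  apply/asboolP; rewrite gez0_abs//.
  have eV : (V x %% m%:Z)%Z = V x - (V x %/ m%:Z)%Z * m%:Z.
    by rewrite {2}(divz_eq (V x) m%:Z) addrC addKr.
  rewrite eV; case: (V x %/ m%:Z)%Z => n.
    exists (x * (b0 ^+ n)^-1); last first.
      by rewrite dvM ?(inv_neq0 V) ?(exp_neq0 V)// dvV ?(exp_neq0 V)// dvX// Vb0 intmulnE mulrC.
    split; last by rewrite (mulf_neq0 V) ?(inv_neq0 V) ?(exp_neq0 V).
    exact: (sdM hB Bx (sdV hB (sdX hB n b0B))).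
  exists (x * b0 ^+ n.+1); last first.
    by rewrite dvM ?(exp_neq0 V)// dvX// Vb0 intmulnE NegzE mulNr opprK mulrC.
  split; last by rewrite (mulf_neq0 V) ?(exp_neq0 V).
  exact: (sdM hB Bx (sdX hB n.+1 b0B)).
have [h mh] : exists h, (m * h)%N = d.
  have [|n en] := div (pi%:A) (alg_neq0 D pi0).
    by move=> y; rewrite mulr_algl mulr_algr.
  exists `|n|%N; have := V_pi pi0 vpi av; rewrite en ed => /(congr1 absz).
  by rewrite abszM !absz_nat mulnC.
have uX i : u ^+ i != 0 by rewrite (exp_neq0 V).
have VuX i : V (u ^+ i) = i%:Z by rewrite dvX// Vu natz.
have uXw := uX_w uw'.
have wNm : (w ^+ (N ^ m)) ^+ M = 1 by rewrite -exprM mulnC exprM wM expr1n.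
(* [b0] is [y u^m] with [y] integral, and [y] commutes with [w] modulo the maximal ideal, so [b0]
   conjugates [w] to [w^(N^m)] up to higher valuation. *)
have [|b [bw bb0 bcomm]] := averaging hred wM wNm uw (vunitX _ uw) b00.
  pose y := b0 * (u ^+ m)^-1.
  have eb : b0 = y * u ^+ m by rewrite /y -mulrA (dmulVf V)// mulr1.
  have hy : vge V 0 y.
    by rewrite vgeE ?(mulf_neq0 V) ?(inv_neq0 V)// dvM ?(inv_neq0 V)// dvV// VuX Vb0 subrr.
  clearbody y.
  have -> : b0 * w - w ^+ (N ^ m) * b0 = (y * w ^+ (N ^ m) - w ^+ (N ^ m) * y) * u ^+ m.
    rewrite mulrBl {1 2}eb -!mulrA; congr (_ - _); congr (_ * _).
    by have := uXw m 1%N; rewrite muln1 expr1.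
  rewrite addrC; apply: vgeM; first by apply: (vge_comm hred) => //; exact: vgeX.
  by rewrite vgeE// VuX Vb0.
have [b_0 Vb] := dv_near b00 bb0; rewrite Vb0 in Vb.
have bB : B b.
  move=> y; apply/esym/bcomm; rewrite -?wB -?b0B//.
  by apply/esym; exact: (sdX hB _ wB).
exists w, u, b, (j z), N, m, h; split=> //; split=> //.
- have span := @span_sub _ _ _ _ hF _ pi0 vpi D V e av B d (fun i => w ^+ i) b m h hB bB b_0 Vb.
  have dimB : (\dim (centralizer j) <= d * h)%N.
    have -> : (d * h)%N = #|{: 'I_d * 'I_h}| by rewrite card_prod !card_ord.
    apply: (@dim_le_spanning _ _ _ _ (fun z : 'I_d * 'I_h => w ^+ z.1 * b ^+ z.2)) => x.
    move=> /centralizerP xB; apply: span => //.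
    + by rewrite mh.
    + by move=> i; split; [exact: (sdX hB _ wB)|exact: vgeX].
    + move=> y _; exact: (residue_basis hF pi0 vpi av hred wM gen ord u_0 Vu uw' central ht).
    + by move=> y By y0; exact: div.
  (* What is left is that [m] is at most the degree of [K]: a relation of that degree killing [z]
     also kills its [m] conjugates by the [u^i], which are distinct because no [u^i] with
     [0 < i < m] centralizes [K]. *)
  apply: leq_trans dimB _; rewrite -mh mulnAC leq_mul2r mulnC leq_mul2l; apply/orP; right; apply/orP; right.
  have [_ _ min] := ht.
  pose nK := \dim {:K}.
  have [a [i0 ai0] ha] : exists2 a : 'I_nK.+1 -> F, exists i, a i != 0 &
      \sum_i a i *: z ^+ i = 0.
    apply: contrapT => no.
    have := @dim_ge_free _ K 'I_nK.+1 (fun i => z ^+ i).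
    rewrite card_ord ltnn => /(_ _)/wrap[]// a ha i.
    by apply: contrapT => /eqP ai; apply: no; exists a => //; exists i.
  pose a' (i : nat) : D := if insub i is Some i' then (a i')%:A else 0.
  have aE (i : 'I_nK.+1) : a' i = (a i)%:A by rewrite /a' valK.
  pose P := \poly_(i < nK.+1) a' i.
  have P0 : P != 0.
    apply/eqP => P0; have : P`_i0 = 0 by rewrite P0 coef0.
    by rewrite coef_poly ltn_ord aE => /eqP; apply/negP; exact: alg_neq0.
  have := @max_ring_poly_roots _ P [seq w ^+ (N ^ i * r) | i <- iota 0 m] P0.
  rewrite size_map size_iota => /(_ _ _)/wrap[].
  + apply/allP => c /mapP[i _ ->]; apply/rootP; rewrite horner_poly.
    have -> : w ^+ (N ^ i * r) = u ^+ i * j z * (u ^+ i)^-1.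
      by rewrite er uXw -mulrA (dmulfV V)// mulr1.
    have : u ^+ i * j (\sum_i a i *: z ^+ i) * (u ^+ i)^-1 = 0.
      by rewrite ha rmorph0 mulr0 mul0r.
    rewrite rmorph_sum mulr_sumr mulr_suml; apply: etrans; apply: eq_bigr => i' _ /=.
    have conjX n : (u ^+ i * j z * (u ^+ i)^-1) ^+ n = u ^+ i * j z ^+ n * (u ^+ i)^-1.
      elim: n => [|n IH]; first by rewrite !expr0 mulr1 (dmulfV V).
      by rewrite !exprSr IH !mulrA -[_ * (u ^+ i)^-1 * u ^+ i]mulrA (dmulVf V)// mulr1.
    by rewrite conjX aE mulr_algl linearZ rmorphXn /= -scalerAr -scalerAl.
  + apply: uniq_roots_iota => i i' /andP[_ ii'] i'm; apply: (diff_roots_pow V).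
    apply/eqP => e1; have : (u ^+ (i' - i)) * j z = j z * u ^+ (i' - i).
      apply: (dmulfI V (uX i)); rewrite !mulrA -exprD subnKC 1?ltnW// er !uXw -e1.
      by rewrite -mulrA -exprD subnKC 1?ltnW.
    move/zB => /(div _ (uX _))[n]; rewrite VuX => e2.
    have := @int_mul_ge n m; rewrite -e2 !lez_nat subn_gt0 ii' => /(_ isT).
    by rewrite leqNgt (leq_ltn_trans (leq_subr _ _) i'm).
  + by move=> h1; have := leq_trans h1 (size_poly _ _); rewrite ltnS.
- by exists z.
Qed.

End Tame.

(** * Reduced norms *)

Lemma interpolation (K C : fieldType) (c : {rmorphism K -> C}) (x : nat -> K)
    (P : {poly C}) (s : nat) : injective x -> (size P <= s)%N ->
  (forall i, exists y, P.[c (x i)] = c y) -> exists R : {poly K}, P = map_poly c R.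
Proof.
move=> xinj sP hP; have [y hy] := choice hP.
have [R [sR hR]] : exists R : {poly K}, (size R <= s)%N /\
    forall i, (i < s)%N -> R.[x i] = y i.
  elim: (s) => [|n [R [sR hR]]]; first by exists 0; rewrite size_poly0.
  pose T := \prod_(i < n) ('X - (x i)%:P).
  have Tn : T.[x n] != 0.
    rewrite horner_prod; apply/prodf_neq0 => i _; rewrite hornerXsubC subr_eq0.
    by apply/eqP => /xinj e; have := ltn_ord i; rewrite -e ltnn.
  have sT : size T = n.+1.
    by rewrite /T size_prod_XsubC /index_enum -enumT size_enum_ord.
  exists (R + ((y n - R.[x n]) / T.[x n]) *: T); split.
    rewrite (leq_trans (size_polyD _ _))// geq_max (leq_trans sR)//=.
    by rewrite (leq_trans (size_scale_leq _ _))// sT.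
  move=> i; rewrite ltnS leq_eqVlt hornerD hornerZ => /orP[/eqP ->|lt].
    by rewrite divfK// addrC subrK.
  have -> : T.[x i] = 0; last by rewrite mulr0 addr0 hR.
  rewrite /T horner_prod (bigD1 (Ordinal lt))//= hornerXsubC subrr mul0r.
  by [].
exists R; apply/eqP; rewrite -subr_eq0; apply/negPn/negP => n0.
have := @max_poly_roots _ _ [seq c (x i) | i <- iota 0 s] n0.
rewrite size_map size_iota => /(_ _ _)/wrap[].
- apply/allP => z /mapP[i]; rewrite mem_iota add0n => /andP[_ lt] ->.
  by rewrite /root hornerD hornerN horner_map hR// hy subrr.
- by rewrite map_inj_uniq ?iota_uniq// => i i' /fmorph_inj /xinj.
- apply/negP; rewrite -leqNgt (leq_trans (size_polyD _ _))// size_polyN geq_max sP.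
  by rewrite size_map_poly sR.
Qed.

Lemma horner_char_poly (C : comNzRingType) n (A : 'M[C]_n) (a : C) :
  (char_poly A).[a] = \det (a%:M - A).
Proof.
rewrite /char_poly -horner_evalE -det_map_mx; congr (\det _).
by apply/matrixP => i j; rewrite !mxE /= /horner_eval hornerD hornerN hornerMn hornerX hornerC.
Qed.

Section ReducedNorm.
Variables (F : fieldType) (K : fieldExtType F) (A : falgType F) (V : divval A).
Variables (j : {lrmorphism K -> A}) (nrd : A -> K).
Hypothesis hnrd : reduced_norm j nrd.
Local Notation B := (fun x : A => forall y, x * j y = j y * x).

Lemma nrd_mul x y : B x -> B y -> nrd (x * y) = nrd x * nrd y.
Proof.
move=> /centralizerP hx /centralizerP hy.
have [n [C [c [phi [_ hphi _ hdet]]]]] := hnrd.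
have hxy : x * y \in centralizer j.
  apply/centralizerP/(sdM (centralizer_sub_division V j)); exact/centralizerP.
apply: (fmorph_inj c); rewrite rmorphM !hdet//.
by have [_ ->] := hphi _ _ hx hy; rewrite det_mulmx.
Qed.

Lemma nrd_1 : nrd 1 = 1.
Proof.
have [n [C [c [phi [_ _ hK hdet]]]]] := hnrd.
apply: (fmorph_inj c); rewrite rmorph1 hdet; last first.
  by apply/centralizerP => y; rewrite mul1r mulr1.
by rewrite -(rmorph1 j) hK rmorph1 det1.
Qed.

Lemma nrd_neq0 x : B x -> x != 0 -> nrd x != 0.
Proof.
move=> hx x0; apply/eqP => n0.
have hV := sdV (centralizer_sub_division V j) hx.
have := nrd_mul hx hV; rewrite (dmulfV V)// nrd_1 n0 mul0r => /eqP.
by rewrite oner_eq0.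
Qed.

(* The characteristic polynomial of the image of [w] has coefficients in [K] and
   degree at most [h], and the [h] conjugates of [w] are roots of it. *)
Lemma nrd_root_of_unity (inf : nat -> K) (w b : A) (N h : nat) :
  injective inf -> B w -> B b -> b != 0 -> b * w = w ^+ N * b ->
  (forall i i', (i < i' < h)%N -> w ^+ (N ^ i) != w ^+ (N ^ i')) ->
  (\dim (centralizer j) <= h * h * \dim {:K})%N ->
  j (nrd w) = \prod_(i < h) w ^+ (N ^ i).
Proof.
move=> infI Bw Bb b0 bw wN dimC.
have [n [C [c [phi [hn hphi hK hdet]]]]] := hnrd.
have hB := centralizer_sub_division V j.
have mB x : B x -> x \in centralizer j by move=> hx; apply/centralizerP.
have B1 : B 1 by exact: (sd1 hB).
have dK : (0 < \dim {:K})%N by exact: dim_gt0.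
have nh : (n <= h)%N.
  move: dimC; rewrite -hn leq_pmul2r// mulnn.
  by rewrite leq_sqr.
have n0 : (0 < n)%N.
  rewrite lt0n; apply/eqP => n0; move: hn; rewrite n0 mul0n => /esym/eqP.
  rewrite dimv_eq0 => /eqP e0; have := mB _ B1.
  by rewrite e0 memv0 oner_eq0.
case: n n0 phi hn hphi hK hdet nh => // n _ phi hn hphi hK hdet nh.
have phiD x y : B x -> B y -> phi (x + y) = phi x + phi y.
  by move=> hx hy; have [] := hphi _ _ (mB _ hx) (mB _ hy).
have phiM x y : B x -> B y -> phi (x * y) = phi x * phi y.
  by move=> hx hy; have [] := hphi _ _ (mB _ hx) (mB _ hy).
have phi0 : phi 0 = 0 by rewrite -(rmorph0 j) hK rmorph0 raddf0.
have phi1 : phi 1 = 1 by rewrite -(rmorph1 j) hK rmorph1.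
have phiN x : B x -> phi (- x) = - phi x.
  move=> hx; apply/eqP; rewrite -subr_eq0 opprK -phiD//; last exact: (sdN hB hx).
  by rewrite addNr phi0.
have BK y : B (j y) by move=> y'; rewrite -!rmorphM mulrC.
have phi_inj x : B x -> phi x = 0 -> x = 0.
  move=> hx px; apply/eqP; apply: contraT => x0.
  have := phiM _ _ hx (sdV hB hx); rewrite (dmulfV V)// px mul0r phi1 => /eqP.
  by rewrite oner_eq0.
have phiX i : phi (w ^+ i) = phi w ^+ i.
  elim: i => [|i IH]; first by rewrite !expr0.
  by rewrite !exprS phiM// ?IH//; exact: (sdX hB i Bw).
(* At a point [x] of [K] the characteristic polynomial takes the value [det (phi (j x - w))], the
   image of a reduced norm, hence of an element of [K]. *)
have [|i|R eR] := @interpolation _ _ c inf (char_poly (phi w)) n.+2 infI.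
- by rewrite size_char_poly.
- exists (nrd (j (inf i) - w)); rewrite horner_char_poly hdet; last first.
    by apply: mB; apply: (sdB hB).
  by rewrite phiD// ?phiN ?hK//; exact: (sdN hB Bw).
have sR : size R = n.+2 by rewrite -(size_map_poly c) -eR size_char_poly.
have mR : R \is monic by rewrite -(map_monic c) -eR char_poly_monic.
pose Rj := map_poly j R.
have sRj : size Rj = n.+2 by rewrite size_map_poly.
have mRj : Rj \is monic by rewrite map_monic.
have Rw : \sum_(i < n.+2) j R`_i * w ^+ i = 0.
  have Bt i : B (j R`_i * w ^+ i) by apply: (sdM hB) => //; exact: (sdX hB i Bw).
  apply: phi_inj; first by apply: (sd_sum hB) => i; exact: Bt.
  transitivity (horner_mx (phi w) (char_poly (phi w))); last exact: Cayley_Hamilton.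
  have phi_sum (f : 'I_n.+2 -> A) : (forall i, B (f i)) ->
      phi (\sum_i f i) = \sum_i phi (f i).
    move=> hf; have : B (\sum_i f i) /\ phi (\sum_i f i) = \sum_i phi (f i).
      elim/big_rec2: _ => [|i y1 y2 _ [h1 h2]]; first by split=> //; exact: (sd0 hB).
      by split; [exact: (sdD hB)|rewrite phiD// h2].
    by case.
  rewrite phi_sum// eR /horner_mx /horner_morph (@horner_coef_wide _ n.+2); last first.
    by rewrite (leq_trans (size_poly _ _))// size_map_poly sR.
  apply: eq_bigr => i _; rewrite phiM//; last exact: (sdX hB i Bw).
  by rewrite hK phiX !coef_map.
have bX i : b ^+ i * w = w ^+ (N ^ i) * b ^+ i.
  by have := uX_w bw i 1; rewrite muln1.
have bn0 i : b ^+ i != 0 by rewrite (exp_neq0 V).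
have root_w i : root Rj (w ^+ (N ^ i)).
  apply/rootP; rewrite horner_coef sRj.
  have conjX k : (b ^+ i * w * (b ^+ i)^-1) ^+ k = b ^+ i * w ^+ k * (b ^+ i)^-1.
    elim: k => [|k IH]; first by rewrite !expr0 mulr1 (dmulfV V).
    by rewrite !exprSr IH !mulrA -[_ * (b ^+ i)^-1 * b ^+ i]mulrA (dmulVf V)// mulr1.
  have -> : w ^+ (N ^ i) = b ^+ i * w * (b ^+ i)^-1.
    by rewrite bX -mulrA (dmulfV V)// mulr1.
  have : b ^+ i * (\sum_(i < n.+2) j R`_i * w ^+ i) * (b ^+ i)^-1 = 0.
    by rewrite Rw mulr0 mul0r.
  rewrite mulr_sumr mulr_suml; apply: etrans; apply: eq_bigr => k _.
  rewrite coef_map /= conjX !mulrA; congr (_ * _ * _).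
  by apply/esym; exact: (sdX hB i Bb).
pose rs := [seq w ^+ (N ^ i) | i <- iota 0 h].
have ars : all (root Rj) rs by apply/allP => y /mapP[i _ ->].
have urs : uniq_roots rs.
  apply: uniq_roots_iota => i i' /andP[_ ii'] i'h; apply: (diff_roots_pow V).
  by apply: wN; rewrite ii'.
(* A polynomial of degree [n + 1 <= h] has [h] roots. Commuting roots with invertible differences
   take the place of a commutative coefficient ring. *)
have hn1 : h = n.+1.
  apply/eqP; rewrite eqn_leq nh andbT.
  have := max_ring_poly_roots (monic_neq0 mRj) ars urs.
  by rewrite size_map size_iota sRj ltnS.
have [T eT] := uniq_roots_prod_XsubC ars urs.
pose P := \prod_(z <- rs) ('X - z%:P).
have mP : P \is monic by exact: monic_prod_XsubC.
have sP : size P = n.+2 by rewrite size_prod_XsubC size_map size_iota hn1.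
have T0 : T != 0.
  by apply: contraTneq mRj => T0; rewrite eT T0 mul0r monicE lead_coef0 eq_sym oner_eq0.
have sT : size T = 1%N.
  by have := size_Mmonic T0 mP; rewrite -eT sRj sP addnS /=; lia.
have T1 : T = 1.
  have := lead_coef_Mmonic T mP; rewrite -eT (monicP mRj) => e1.
  have /size_poly1P[a _ ea] : size T == 1%N by rewrite sT.
  by rewrite ea lead_coefC in e1 *; rewrite -e1.
have R0 : R`_0 = (-1) ^+ n.+1 * nrd w.
  apply: (fmorph_inj c); rewrite -coef_map -eR char_poly_det rmorphM rmorphXn rmorphN1.
  by rewrite hdet//; exact: mB.
have : Rj`_0 = (-1) ^+ n.+1 * \prod_(i < h) w ^+ (N ^ i).
  have eI : iota 0 h = index_iota 0 h by rewrite /index_iota subn0.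
  rewrite eT T1 mul1r /rs big_map eI big_mkord.
  have -> : n.+1 = #|'I_h| by rewrite card_ord hn1.
  rewrite -prodrN; elim/big_rec2: _ => [|i y1 y2 _ IH]; first by rewrite coef1.
  by rewrite coef0M IH coefB coefX coefC /= sub0r.
rewrite coef_map /= R0 rmorphM rmorphXn rmorphN1.
by move/(congr1 ( *%R ((-1) ^+ n.+1))); rewrite !signrMK.
Qed.

End ReducedNorm.

(** * Base change of the division algebra *)

Section RestrictBase.
Variables (F : fieldType) (E : fieldExtType F) (A : falgType E).

(** [A] as an algebra over [F]: the valuation theory then applies to [DE] without a discrete
    valuation on [E]. *)
Definition over_base : Type := A.
HB.instance Definition _ := GRing.UnitRing.on over_base.

Definition over_base_scale (a : F) (x : over_base) : over_base := a%:A *: (x : A).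
Lemma over_base_scaleA a b x :
  over_base_scale a (over_base_scale b x) = over_base_scale (a * b) x.
Proof. by rewrite /over_base_scale scalerA -[_ * _]/(in_alg E a * in_alg E b) -rmorphM. Qed.
Lemma over_base_scale1 : left_id 1 over_base_scale.
Proof. by move=> x; rewrite /over_base_scale scale1r scale1r. Qed.
Lemma over_base_scaleDr : right_distributive over_base_scale +%R.
Proof. by move=> a x y; exact: scalerDr. Qed.
Lemma over_base_scaleDl x : {morph over_base_scale^~ x : a b / a + b}.
Proof. by move=> a b; rewrite /over_base_scale scalerDl scalerDl. Qed.
HB.instance Definition _ := GRing.Zmodule_isLmodule.Build F over_base
  over_base_scaleA over_base_scale1 over_base_scaleDr over_base_scaleDl.
Lemma over_base_scaleAl (a : F) (x y : over_base) : a *: (x * y) = (a *: x) * y.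
Proof. exact: (scalerAl (a%:A : E) (x : A) (y : A)). Qed.
HB.instance Definition _ := GRing.Lmodule_isLalgebra.Build F over_base over_base_scaleAl.
Lemma over_base_scaleAr (a : F) (x y : over_base) : a *: (x * y) = x * (a *: y).
Proof. exact: (scalerAr (a%:A : E) (x : A) (y : A)). Qed.
HB.instance Definition _ := GRing.Lalgebra_isAlgebra.Build F over_base over_base_scaleAr.

Definition over_base_coord (x : over_base) : 'rV[F]_(\dim {:A} * \dim {:E}) :=
  mxvec (\matrix_(i, k) coord (vbasis {:E}) k (coord (vbasis {:A}) i (x : A))).

Lemma over_base_coord_linear : linear over_base_coord.
Proof.
move=> a x y; rewrite -linearP; congr mxvec; apply/matrixP => i k.
rewrite !mxE [coord _ i _](linearP (coord (vbasis {:A}) i) (a%:A)) linearD /=.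
by rewrite mulr_algl linearZ.
Qed.

Lemma over_base_coord_bij : bijective over_base_coord.
Proof.
pose g (r : 'rV[F]_(\dim {:A} * \dim {:E})) : over_base :=
  \sum_i (\sum_k vec_mx r i k *: (vbasis {:E})`_k) *: (vbasis {:A})`_i.
exists g => [x|r].
  rewrite /g mxvecK; apply: etrans (esym (coordE (x : A))).
  apply: eq_bigr => i _; congr (_ *: _); apply: etrans (esym (coordE _)).
  by apply: eq_bigr => k _; rewrite mxE.
apply: (can_inj vec_mxK); rewrite /over_base_coord mxvecK.
apply/matrixP => i k; rewrite mxE.
by rewrite (coord_sum (A := A)) (coord_sum (A := E)).
Qed.

HB.instance Definition _ := Lmodule_hasFinDim.Build F over_base
  (exist2 _ _ over_base_coord over_base_coord_linear over_base_coord_bij).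
End RestrictBase.

(** * Coordinates for an extension of scalars *)

Section BaseChange.
Variables (F : fieldType) (E : fieldExtType F) (V : vectType F).
Local Notation n := (\dim {:V}).
Local Notation b := (vbasis {:V}).
Local Notation l := (\dim {:E}).
Local Notation eps := (vbasis {:E}).

Lemma vcoordE (x : V) : x = \sum_k coord b k x *: b`_k.
Proof. by apply: coord_vbasis; rewrite memvf. Qed.

(** Coordinates come from the existence half of the universal property. Spanning comes from its
    uniqueness half, applied to the identity and to the reconstruction from coordinates. *)
Lemma base_change_coord (W : lmodType E) (i : V -> W) : base_change (in_alg E) i ->
  exists co : {linear W -> 'rV[E]_n},
    (forall y, y = \sum_k co y 0 k *: i b`_k) /\
    (forall r : 'I_n -> E, forall k, co (\sum_k r k *: i b`_k) 0 k = r k).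
Proof.
move=> [hi univ].
have [|co hco _] := univ _ (fun x => \row_k (coord b k x)%:A : 'rV[E]_n).
  move=> a x y; apply/rowP => k; rewrite !mxE linearP scalerDl.
  by rewrite mulr_algl scalerA.
have hb (m : 'I_n) k : co (i b`_m) 0 k = (m == k)%:R.
  rewrite hco mxE coord_free ?(basis_free (vbasisP _))//.
  by rewrite -val_eqE /=; case: eqP => _; rewrite ?scale1r ?scale0r.
have hi_sum (c : 'I_n -> F) : i (\sum_k c k *: b`_k) = \sum_k (c k)%:A *: i b`_k.
  have i0 : i 0 = 0.
    have := hi 1 0 0; rewrite scaler0 addr0 rmorph1 scale1r.
    by move/eqP; rewrite -subr_eq0 opprD addNKr oppr_eq0 => /eqP.
  by elim/big_rec2: _ => // m y1 y2 _ <-; rewrite hi.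
have hr (r : 'I_n -> E) k : co (\sum_k r k *: i b`_k) 0 k = r k.
  rewrite linear_sum summxE (bigD1 k)//= big1 ?addr0 => [|m mk].
    by rewrite linearZ mxE hb eqxx mulr1.
  by rewrite linearZ mxE hb (negPf mk) mulr0.
exists co; split=> // y.
pose g (r : 'rV[E]_n) : W := \sum_k r 0 k *: i b`_k.
have g_lin : linear g.
  move=> a r r'; rewrite /g scaler_sumr -big_split; apply: eq_bigr => k _.
  by rewrite !mxE scalerDl scalerA.
pose gL := HB.pack_for {linear 'rV[E]_n -> W} g (GRing.isLinear.Build _ _ _ _ g g_lin).
have [k0 _ uniq] := univ W i hi.
have e1 := uniq (gL \o co) _ y.
have e2 := uniq idfun (fun=> erefl) y.
have -> : \sum_k co y 0 k *: i b`_k = (gL \o co) y by [].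
rewrite e1 -?e2// => x; rewrite /= hco /g [in RHS](vcoordE x) hi_sum.
by apply: eq_bigr => k _; rewrite mxE.
Qed.

Lemma base_change_dim (W : vectType E) (i : V -> W) : base_change (in_alg E) i ->
  \dim {:W} = n.
Proof.
move=> /base_change_coord[co [hco hr]]; apply/eqP; rewrite eqn_leq; apply/andP; split.
  rewrite -[n in (_ <= n)%N]card_ord; apply: (@dim_le_spanning _ _ _ _ (fun k : 'I_n => i b`_k)).
  by move=> x _; exists (co x 0); exact: hco.
rewrite -[n in (n <= _)%N]card_ord; apply: (@dim_ge_free _ _ _ (fun k : 'I_n => i b`_k)).
by move=> a ha k; rewrite -(hr a k) ha linear0 mxE.
Qed.

(** Decomposition along a basis of [E] instead of [V], which reduces identities in the extension to
    identities in [V]. *)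
Lemma base_change_decomp (W : lmodType E) (i : V -> W) : base_change (in_alg E) i ->
  (forall y, exists x : 'I_l -> V, y = \sum_(m < l) eps`_m *: i (x m)) /\
  (forall x : 'I_l -> V, \sum_(m < l) eps`_m *: i (x m) = 0 -> forall m, x m = 0).
Proof.
move=> hi; have [co [hco hr]] := base_change_coord hi; case: hi => hi _.
have i0 : i 0 = 0.
  have := hi 1 0 0; rewrite scaler0 addr0 rmorph1 scale1r.
  by move/eqP; rewrite -subr_eq0 opprD addNKr oppr_eq0 => /eqP.
have hi_sum (c : 'I_n -> F) : i (\sum_k c k *: b`_k) = \sum_k (c k)%:A *: i b`_k.
  by elim/big_rec2: _ => // m y1 y2 _ <-; rewrite hi.
have exch (c : 'I_l -> 'I_n -> F) : \sum_(m < l) eps`_m *: i (\sum_k c m k *: b`_k) =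
    \sum_k (\sum_(m < l) c m k *: eps`_m) *: i b`_k.
  under eq_bigr => m _ do rewrite hi_sum scaler_sumr.
  rewrite exchange_big; apply: eq_bigr => k _; rewrite scaler_suml.
  by apply: eq_bigr => m _; rewrite scalerA mulr_algr.
split=> [y|x hx m].
  exists (fun m => \sum_k coord eps m (co y 0 k) *: b`_k); rewrite exch [LHS]hco.
  by apply: eq_bigr => k _; rewrite -(coordE (A := E) (co y 0 k)).
have hx' : \sum_k (\sum_m coord b k (x m) *: eps`_m) *: i b`_k = 0.
  rewrite -exch -[RHS]hx; apply: eq_bigr => m' _.
  by rewrite -vcoordE.
rewrite [x m]vcoordE big1// => k _.
have := hr (fun k => \sum_m coord b k (x m) *: eps`_m) k; rewrite hx' linear0 mxE => e0.
have := coord_sum (A := E) (fun m => coord b k (x m)) m; rewrite -e0 linear0 => <-.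
by rewrite scale0r.
Qed.
End BaseChange.

(* A module over a division algebra is free. *)
Lemma dim_module_dvd (F : fieldType) (R T : falgType F) (f : {lrmorphism R -> T})
    (M : {vspace T}) : GRing.field_axiom R ->
  (forall a y, y \in M -> f a * y \in M) -> (\dim {:R} %| \dim M)%N.
Proof.
move=> hR hM.
suff key n (N : {vspace T}) : (\dim M - \dim N <= n)%N -> (N <= M)%VS ->
    (forall a y, y \in N -> f a * y \in N) -> (\dim {:R} %| \dim N)%N ->
    (\dim {:R} %| \dim M)%N.
  apply: (key (\dim M) 0%VS); rewrite ?leq_subr ?sub0v ?dimv0 ?dvdn0//.
  by move=> a y; rewrite !memv0 => /eqP ->; rewrite mulr0.
elim: n N => [|n IH] N hn NM hN hd.
  have /eqP <- : (N == M)%VS; last by [].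
  by rewrite eqEdim NM -subn_eq0 -leqn0.
have [/subvP MN|/subvPn[y yM yN]] := boolP (M <= N)%VS.
  have /eqP <- : (N == M)%VS; last by [].
  by rewrite eqEsubv NM; apply/subvP.
pose g := (amulr y \o linfun f)%VF.
have gE a : g a = f a * y by rewrite comp_lfunE lfunE /= lfunE.
have yN' a : a != 0 -> f a * y \notin N.
  move=> /hR ua; apply: contra yN => h; have := hN a^-1 _ h.
  by rewrite mulrA -rmorphM mulVr// rmorph1 mul1r.
have cap0 : (N :&: limg g = 0)%VS.
  apply/eqP; rewrite -subv0; apply/subvP => z; rewrite memv_cap => /andP[zN].
  move=> /memv_imgP[a _ ez]; rewrite ez gE in zN *.
  by have [->|/yN'/negP//] := eqVneq a 0; rewrite rmorph0 mul0r mem0v.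
have dg : \dim (limg g) = \dim {:R}.
  rewrite limg_dim_eq// capfv; apply/eqP; rewrite -subv0; apply/subvP => a.
  rewrite memv_ker gE memv0; apply: contraTT => a0.
  by apply: contra (yN' a a0) => /eqP ->; exact: mem0v.
have dN' : \dim (N + limg g) = (\dim N + \dim {:R})%N.
  by rewrite dimv_disjoint_sum// dg.
have sN' : (N + limg g <= M)%VS.
  rewrite subv_add NM; apply/subvP => z /memv_imgP[a _ ->]; rewrite gE; exact: hM.
apply: (IH (N + limg g)%VS) => //.
- by rewrite dN'; have := dim_gt0 R; lia.
- move=> a z /memv_addP[z1 z1N [z2 /memv_imgP[c _ ->] ->]]; rewrite mulrDr.
  apply: memv_add; first exact: hN.
  by rewrite gE mulrA -rmorphM -gE memv_img// memvf.
- by rewrite dN' dvdn_addr.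
Qed.

Lemma over_base_dim (F : fieldType) (E : fieldExtType F) (A : falgType E) :
  \dim {:over_base A} = (\dim {:A} * \dim {:E})%N.
Proof. by rewrite dimvf. Qed.

Section BaseChangeAlgebra.
Variables (F : fieldType) (E : fieldExtType F) (D : falgType F) (DE : falgType E).
Variable iD : {rmorphism D -> DE}.
Hypothesis hDE : base_change (in_alg E) iD.

Definition base_incl : D -> over_base DE := iD.
HB.instance Definition _ := GRing.RMorphism.copy base_incl iD.
Lemma base_incl_scalable : scalable base_incl.
Proof.
move=> a x; have := hDE.1 a x 0; rewrite rmorph0 !addr0; exact.
Qed.
HB.instance Definition _ :=
  GRing.isScalable.Build F D (over_base DE) _ base_incl base_incl_scalable.

Definition scalar_incl : E -> over_base DE := in_alg DE.
HB.instance Definition _ := GRing.RMorphism.copy scalar_incl (in_alg DE).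
Lemma scalar_incl_scalable : scalable scalar_incl.
Proof.
move=> a x; change ((a *: x) *: (1 : DE) = a%:A *: (x *: (1 : DE))).
by rewrite scalerA mulr_algl.
Qed.
HB.instance Definition _ :=
  GRing.isScalable.Build F E (over_base DE) _ scalar_incl scalar_incl_scalable.

(* Left ideals are modules over both [D] and [E], whose dimensions are coprime. *)
Lemma base_change_division (d : nat) : GRing.field_axiom D -> \dim {:D} = (d ^ 2)%N ->
  coprime (\dim {:E}) d -> GRing.field_axiom DE.
Proof.
move=> hD dimD co.
suff linv (x : DE) : x != 0 -> exists y, y * x = 1.
  move=> x x0; have [y yx] := linv x x0.
  have y0 : y != 0.
    by apply/eqP => y0; move/eqP: yx; rewrite y0 mul0r eq_sym oner_eq0.
  have [z zy] := linv y y0; apply/unitrP; exists y; split=> //.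
  have <- : z = x by rewrite -[LHS]mulr1 -yx mulrA zy mul1r.
  exact: zy.
move=> x0; pose I := limg (amulr (x : over_base DE)).
have stable (c z : over_base DE) : z \in I -> c * z \in I.
  move=> /memv_imgP[y _ ->]; rewrite lfunE /= mulrA.
  have -> : c * y * (x : over_base DE) = amulr (x : over_base DE) (c * y) by rewrite lfunE.
  by rewrite memv_img ?memvf.
have xI : (x : over_base DE) \in I.
  have -> : (x : over_base DE) = amulr (x : over_base DE) 1 by rewrite lfunE /= mul1r.
  by rewrite memv_img ?memvf.
have h1 : (\dim {:D} %| \dim I)%N.
  by apply: (@dim_module_dvd F D (over_base DE) base_incl) => // a y; exact: stable.
have hE : GRing.field_axiom E by move=> y y0; rewrite unitfE.
have h2 : (\dim {:E} %| \dim I)%N.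
  by apply: (@dim_module_dvd F E (over_base DE) scalar_incl) => // a y; exact: stable.
have dimT : \dim {:over_base DE} = (\dim {:D} * \dim {:E})%N.
  by rewrite over_base_dim (base_change_dim hDE).
have I0 : (0 < \dim I)%N.
  by rewrite lt0n dimv_eq0; apply: contraNneq x0 => e; move: xI; rewrite e memv0.
have h3 : (\dim {:over_base DE} %| \dim I)%N.
  rewrite dimT Gauss_dvd ?h1 ?h2// dimD coprime_sym coprimeXr//.
have IT : I = fullv.
  by apply/eqP; rewrite eqEdim subvf dvdn_leq.
have : (1 : over_base DE) \in I by rewrite IT memvf.
by move=> /memv_imgP[y _]; rewrite lfunE /= => ->; exists y.
Qed.

End BaseChangeAlgebra.

Lemma expr_coprime_eq1 (R : pzRingType) (x : R) (a b : nat) :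
  (0 < a)%N -> coprime a b -> x ^+ a = 1 -> x ^+ b = 1 -> x = 1.
Proof.
move=> a0 co xa xb; case: (egcdnP b a0) => u v e _; rewrite (eqP co) in e.
have : x ^+ (u * a) = x by rewrite e exprD mulnC exprM xb expr1n mul1r expr1.
by rewrite mulnC exprM xa expr1n.
Qed.

Lemma mod_pow_coprime (M N a b : nat) : (0 < a)%N -> coprime a b ->
  N ^ a = 1 %[mod M] -> N ^ b = 1 %[mod M] -> N = 1 %[mod M].
Proof.
move=> a0 co xa xb; case: (egcdnP b a0) => u v e _; rewrite (eqP co) in e.
have hp c n : N ^ c = 1 %[mod M] -> N ^ (n * c) = 1 %[mod M].
  by move=> h; rewrite mulnC expnM -modnXm h modnXm exp1n.
have e2 : N ^ (u * a) = N %[mod M].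
  by rewrite e expnD expn1 -modnMml (hp _ _ xb) modnMml mul1n.
by rewrite -e2 (hp _ _ xa).
Qed.

(* A Hilbert 90 argument: unless [s] is trivial on the residue field, some trace
   of a multiple of a uniformizer has valuation 1. *)
Section FixedUniformizer.
Variables (A : unitRingType) (V : divval A) (k : finFieldType) (red : A -> k).
Hypothesis hred : residue_map V red.
Variables (s : {rmorphism A -> A}) (l m0 : nat).
Hypotheses (l_prime : prime l) (sl : forall x, iter l s x = x)
  (Vs : forall x, x != 0 -> V (s x) = V x) (ul : vunit V l%:R)
  (co : coprime l m0)
  (hfix : forall a, s a = a -> vunit V a -> vge V 1 (a ^+ m0 - 1)).
Local Notation M := (#|k|.-1).

Let l0 : (0 < l)%N := prime_gt0 l_prime.

Lemma s_neq0 x : x != 0 -> s x != 0.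
Proof.
move=> x0; apply/eqP => sx0; have : s (x * x^-1) = 0 by rewrite rmorphM sx0 mul0r.
by rewrite (dmulfV V)// rmorph1 => /eqP; rewrite oner_eq0.
Qed.

Lemma vge_s n x : vge V n (s x) = vge V n x.
Proof.
have [->|x0] := eqVneq x 0; first by rewrite rmorph0.
by rewrite !vgeE ?s_neq0// Vs.
Qed.

Lemma vge_iter_s i n x : vge V n (iter i s x) = vge V n x.
Proof. by elim: i => //= i IH; rewrite vge_s. Qed.

Lemma iter_sM i x y : iter i s (x * y) = iter i s x * iter i s y.
Proof. by elim: i => //= i ->; rewrite rmorphM. Qed.

Lemma iter_sX i x n : iter i s (x ^+ n) = iter i s x ^+ n.
Proof. by elim: i => //= i ->; rewrite rmorphXn. Qed.

Lemma iter_s1 i : iter i s 1 = 1.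
Proof. by elim: i => //= i ->; rewrite rmorph1. Qed.

Definition strace x := \sum_(i < l) iter i s x.

Lemma strace_fixed x : s (strace x) = strace x.
Proof.
rewrite /strace rmorph_sum; case: (l) l0 sl => // n _ hn.
rewrite big_ord_recr [RHS]big_ord_recl /= -[s (iter n s x)]/(iter n.+1 s x) hn.
by rewrite addrC; congr (_ + _); apply: eq_bigr.
Qed.

Lemma fixed_uniformizer : exists y, [/\ s y = y, y != 0 & V y = 1].
Proof.
have [P P0 VP] := dv_onto V.
pose C i := iter i s P * P^-1.
have iP0 i : iter i s P != 0 by elim: i => //= i; exact: s_neq0.
have ViP i : V (iter i s P) = 1 by elim: i => //= i; rewrite Vs.
have uC i : vunit V (C i).
  by rewrite /vunit (mulf_neq0 V) ?(inv_neq0 V)// dvM ?(inv_neq0 V)// dvV// ViP VP subrr.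
have hC i := vunit_vge (uC i).
pose S a := \sum_(i < l) iter i s a * C i.
have tS a : strace (a * P) = S a * P.
  rewrite /strace /S mulr_suml; apply: eq_bigr => i _.
  by rewrite iter_sM -mulrA /C -[iter i s P * _ * _]mulrA (dmulVf V)// mulr1.
(* If some [S a] is a unit, the trace of [a P] is a fixed uniformizer. Otherwise [S a] lies in the
   maximal ideal for every integral [a]. *)
have [[a uS]|no] := pselect (exists a, vunit V (S a)).
  exists (strace (a * P)); split; first exact: strace_fixed.
    by rewrite tS (mulf_neq0 V)// (vunit_neq0 uS).
  rewrite tS dvM ?(vunit_neq0 uS)// VP.
  by case/andP: uS => _ /eqP ->; rewrite add0r.
exfalso.
have S1 a : vge V 0 a -> vge V 1 (S a).
  move=> ha; have [us|//] : vunit V (S a) \/ vge V 1 (S a).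
    apply: vunit_cases; apply: vge_sum => i _; apply: vge0M => //.
    by rewrite vge_iter_s.
  by case: no; exists a.
have [w [uw gen ord]] := residue_generator hred.
have hw := vunit_vge uw.
have [N hN] : exists N, vge V 1 (s w - w ^+ N).
  by apply: gen; rewrite /vunit s_neq0 ?Vs ?(vunit_neq0 uw)//; case/andP: uw.
have iw i : vge V 1 (iter i s w - w ^+ (N ^ i)).
  elim: i => [|i IH]; first by rewrite expn0 expr1 subrr vge0.
  rewrite iterS; apply: (@vge_trans _ _ _ _ (s w ^+ (N ^ i))).
    by rewrite -rmorphXn -rmorphB vge_s.
  by rewrite expnS exprM; apply: vge_congX; rewrite ?vge_s.
pose g := red w.
have gpow a b : (g ^+ a == g ^+ b) = (a == b %[mod M]).
  wlog le : a b / (a <= b)%N => [hwl|].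
    by have [/hwl//|/ltnW/hwl h] := leqP a b; rewrite eq_sym h eq_sym.
  have g0 : g != 0 by rewrite /g (red_neq0 hred).
  rewrite [RHS]eq_sym eqn_mod_dvd// -ord -{1}(subnKC le) exprD -{1}[g ^+ a]mulr1.
  rewrite (inj_eq (mulfI (expf_neq0 _ g0))) eq_sym -(red1 hred) /g -(redX hred)//.
  by apply/eqP/idP => /(red_eq hred); apply; rewrite ?vgeX ?vge1.
have redC i n : red (iter i s (w ^+ n) * C i) = red (C i) * g ^+ (N ^ i * n).
  have hi : vge V 0 (iter i s w) by rewrite vge_iter_s.
  rewrite (redM hred) ?vge_iter_s ?vgeX// mulrC iter_sX (redX hred)//.
  have -> : g ^+ (N ^ i * n) = red (w ^+ (N ^ i)) ^+ n by rewrite exprM (redX hred).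
  congr (_ * _ ^+ _).
  by apply/(red_eq hred) => //; exact: vgeX.
have Nl : N ^ l = 1 %[mod M].
  apply/eqP; rewrite -gpow /g -!(redX hred)// expr1; apply/eqP/(red_eq hred) => //.
    exact: vgeX.
  by rewrite vge_sub_sym -{1}(sl w).
have M0 := M_gt0 k.
(* Were the [N^i] distinct modulo [M], the reduction of [S] would be a nonzero polynomial of degree
   less than [M] vanishing at all [M] powers of [g]. *)
have [i [j [ij jl Nij]]] : exists i j, [/\ (i < j)%N, (j < l)%N & N ^ i = N ^ j %[mod M]].
  apply: contrapT => nd.
  pose ex (i : nat) := (N ^ i %% M)%N.
  have exM i : (ex i < M)%N by rewrite ltn_mod.
  have exinj (i j : 'I_l) : ex i = ex j -> i = j.
    move=> e; apply: val_inj => /=; have [lt|lt|//] := ltngtP i j; case: nd.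
      by exists i, j; split=> //; exact: ltn_ord.
    by exists j, i; split.
  pose Q : {poly k} := \sum_(i < l) red (C i) *: 'X^(ex i).
  have Qc (i : 'I_l) : Q`_(ex i) = red (C i).
    rewrite /Q coef_sum (bigD1 i)//= coefZ coefXn eqxx mulr1 big1 ?addr0// => j ji.
    rewrite coefZ coefXn; case: eqP => [/exinj e|_]; last by rewrite mulr0.
    by rewrite e eqxx in ji.
  have Q0 : Q != 0.
    apply/eqP => Q0; have := Qc (Ordinal l0); rewrite Q0 coef0 => /esym/eqP.
    by apply/negP; rewrite (red_neq0 hred).
  have sQ : (size Q <= M)%N.
    apply: (leq_trans (size_sum _ _ _)); apply/bigmax_leqP => i _.
    by rewrite (leq_trans (size_scale_leq _ _))// size_polyXn.
  have := @max_poly_roots _ _ [seq g ^+ n | n <- iota 0 M] Q0.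
  rewrite size_map size_iota => /(_ _ _)/wrap[].
  - apply/allP => c /mapP[n _ ->]; apply/rootP.
    rewrite /Q horner_sum; apply: (etrans (y := red (S (w ^+ n)))).
      rewrite (red_sum hred) => [|i]; last by apply: vge0M; rewrite ?vge_iter_s ?vgeX.
      apply: eq_bigr => i _; rewrite redC hornerZ hornerXn -exprM; congr (_ * _).
      by apply/eqP; rewrite gpow /ex mulnC modnMml mulnC.
    apply/(red_eq0 hred); last by apply: S1; exact: vgeX.
    by apply: vge_sum => i _; apply: vge0M; rewrite ?vge_iter_s ?vgeX.
  - rewrite map_inj_in_uniq ?iota_uniq// => a b; rewrite !mem_iota !add0n /= => aM bM.
    by move=> /eqP; rewrite gpow !modn_small// => /eqP.
  - by apply/negP; rewrite -leqNgt.
have Nd : N ^ (j - i) = 1 %[mod M].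
  have e1 : (N ^ l * N ^ (j - i) = N ^ l %[mod M])%N.
    rewrite -(subnKC (ltnW (ltn_trans ij jl))) expnD mulnAC -expnD subnKC; last exact: ltnW.
    by rewrite -modnMml -Nij modnMml.
  move: e1; rewrite -modnMml Nl modnMml mul1n; exact.
have N1 : N = 1 %[mod M].
  apply: (mod_pow_coprime l0 _ Nl Nd); rewrite prime_coprime//.
  apply/negP => /dvdn_leq; rewrite subn_gt0 => /(_ ij).
  by rewrite leqNgt (leq_ltn_trans (leq_subr _ _) jl).
clear i j ij jl Nij Nd.
have s_triv a : vge V 0 a -> vge V 1 (s a - a).
  move=> ha; have [ua|ha1] := vunit_cases ha; last by apply: vgeB; rewrite ?vge_s.
  have [n hn] := gen a ua.
  apply: (@vge_trans _ _ _ _ (s (w ^+ n))); first by rewrite -rmorphB vge_s.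
  apply: (@vge_trans _ _ _ _ (w ^+ n)); last by rewrite vge_sub_sym.
  rewrite rmorphXn; apply: vge_congX; rewrite ?vge_s//.
  apply: vge_trans hN _; rewrite -[X in _ - X]expr1; apply/(red_eq hred); rewrite ?vgeX//.
  by rewrite !(redX hred)//; apply/eqP; rewrite gpow N1.
have red_s a : vge V 0 a -> red (s a) = red a.
  by move=> ha; apply/(red_eq hred); rewrite ?vge_s//; exact: s_triv.
have red_is i a : vge V 0 a -> red (iter i s a) = red a.
  by move=> ha; elim: i => //= i IH; rewrite red_s// vge_iter_s.
have C0 : C 0%N = 1 by rewrite /C /= (dmulfV V).
have redCi i : red (C i) = red (C 1%N) ^+ i.
  elim: i => [|i IH]; first by rewrite C0 (red1 hred).
  have -> : C i.+1 = s (C i) * C 1%N.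
    rewrite /C /= rmorphM -!mulrA; congr (_ * _).
    by rewrite mulrA -rmorphM (dmulVf V)// rmorph1 mul1r.
  by rewrite (redM hred) ?vge_s// red_s// IH exprSr.
(* This residue has order dividing [l]. It is also the residue of a fixed unit, the average of the
   conjugates of [C 1], so its order divides [m0], which is prime to [l]. *)
have c1 : red (C 1%N) = 1.
  apply: (expr_coprime_eq1 l0 co).
    by rewrite -redCi /C sl (dmulfV V)// (red1 hred).
  pose t := strace (C 1%N) * l%:R^-1.
  have ul' := vunitV ul.
  have et : red t = red (C 1%N).
    rewrite /t (redM hred) ?(vunit_vge ul')//; last first.
      by apply: vge_sum => i _; rewrite vge_iter_s.
    rewrite /strace (red_sum hred) => [|i]; last by rewrite vge_iter_s.
    rewrite (eq_bigr (fun=> red (C 1%N))) => [|i _]; last exact: red_is.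
    rewrite sumr_const card_ord -[red _ *+ l]mulr_natr -mulrA -(red_nat hred) -(redM hred).
    - by rewrite (dmulfV V) ?(vunit_neq0 ul)// (red1 hred) mulr1.
    - exact: vge_nat.
    - exact: vunit_vge.
  have ht : vge V 0 t.
    apply: vge0M; last exact: vunit_vge.
    by apply: vge_sum => i _; rewrite vge_iter_s.
  have sfix : s t = t.
    rewrite /t rmorphM strace_fixed; congr (_ * _).
    apply: (dmulfI V (vunit_neq0 ul)); rewrite (dmulfV V) ?(vunit_neq0 ul)//.
    by rewrite -{1}(rmorph_nat s) -rmorphM (dmulfV V) ?(vunit_neq0 ul)// rmorph1.
  have ut : vunit V t by rewrite -(red_neq0 hred)// et (red_neq0 hred).
  have /(red_eq hred) := hfix sfix ut; rewrite vgeX// vge1 => /(_ isT isT).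
  by rewrite (redX hred)// et (red1 hred).
(* With all residues of the [C i] equal to 1, [S 1] reduces to [l], which is a unit. *)
have := S1 1 (vge1 V) => /(red_eq0 hred) /wrap[].
  by apply: vge_sum => i _; apply: vge0M; rewrite ?vge_iter_s ?vge1.
rewrite /S (red_sum hred) => [|i]; last by apply: vge0M; rewrite ?vge_iter_s ?vge1.
rewrite (eq_bigr (fun=> 1)) => [|i _]; last by rewrite iter_s1 mul1r redCi c1 expr1n.
rewrite sumr_const card_ord -(red_nat hred) => /eqP.
by apply/negP; rewrite (red_neq0 hred) ?vge_nat.
Qed.

End FixedUniformizer.

(** * Induced representations *)

Lemma max_ideal_of_integers (o : nzRingType) (A : unitRingType) (V : divval A)
    (f : o -> A) : (forall x, integers f x <-> vge V 0 x) ->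
  forall x, max_ideal f x <-> vge V 1 x.
Proof.
move=> hf x; split=> [[/hf hx nu]|hx].
  have [/andP[x0 /eqP vx]|//] := vunit_cases hx; case: nu; split.
    exact: dv_unit V _ x0.
  by apply/hf; rewrite vgeE ?(inv_neq0 V)// dvV// vx.
split=> [|[ux]]; first by apply/hf; apply: vge_le hx.
have x0 : x != 0 by rewrite -(unit_neq0 V).
move=> /hf; rewrite vgeE ?(inv_neq0 V)// dvV//.
by move: hx; rewrite vgeE//; move: (V x); lia.
Qed.

Section IntegersOverE.
Variables (F : fieldType) (v : discrete_valuation F) (p q : nat).
Hypothesis hF : local_field v p q.
Variables (pi : F).
Hypotheses (pi0 : pi != 0) (vpi : v pi = 1).
Variables (E : fieldExtType F) (A : falgType E) (V : divval (over_base A)) (e : nat).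
Hypothesis av : alg_val v V e.
Local Notation fE := (alg_map (vring_inc v) E).
Local Notation oE := (intring fE).

Definition vring_to_intring (a : vring v) : oE :=
  IntRing (asboolT (integral_id fE a)).
Lemma vring_to_intring_zmod : zmod_morphism vring_to_intring.
Proof. by move=> a b; apply: val_inj; exact: (rmorphB fE). Qed.
Lemma vring_to_intring_monoid : monoid_morphism vring_to_intring.
Proof.
by split=> [|a b]; apply: val_inj; [exact: (rmorph1 fE)|exact: (rmorphM fE)].
Qed.
HB.instance Definition _ := GRing.isZmodMorphism.Build (vring v) oE
  vring_to_intring vring_to_intring_zmod.
HB.instance Definition _ := GRing.isMonoidMorphism.Build (vring v) oE
  vring_to_intring vring_to_intring_monoid.

(** Integers of [E] are integral over those of [F], so their valuation is nonnegative. Conversely,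
    an equation over the integers of [F] is one over those of [E]. *)
Lemma integers_over_ext (x : over_base A) :
  integers (alg_map (intring_inc fE) A) x <-> vge V 0 x.
Proof.
split.
  apply: (@integral_vge (over_base A) V oE (alg_map (intring_inc fE) A)) => r.
  apply/(integers_vge hF pi0 vpi av).
  have hr : integralOver fE (intring_val r) by exact/asboolP/(valP r).
  have := integral_rmorph (scalar_incl A : {rmorphism E -> over_base A}) hr.
  by [].
move/(integers_vge hF pi0 vpi av) => [P Pm rP].
exists (map_poly vring_to_intring P); first exact: monic_map.
rewrite -map_poly_comp.
move: rP; congr (root _ _).
Qed.

End IntegersOverE.

Lemma uvalX (R : unitRingType) (x : units R) n : uval (x ^+ n)%g = uval x ^+ n.
Proof. by elim: n => // n IH; rewrite expgS /= IH exprS. Qed.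

Section Induced.
Variables (o : comNzRingType) (F : fieldType) (io : {rmorphism o -> F}).
Variables (K : fieldExtType F) (A : falgType F) (j : {lrmorphism K -> A}) (nrd : A -> K).
Hypothesis hnrd : reduced_norm j nrd.
Variables (C : fieldType) (chi : K -> C).
Hypothesis hchi : mult_character chi.
Variable V : divval A.
Hypothesis hint : forall x, integers (alg_map io A) x <-> vge V 0 x.
Variable a0 : F.
Hypotheses (a0_neq0 : a0 != 0) (Va0 : vge V 1 (a0%:A)).
Local Notation B := (fun x : A => forall y, x * j y = j y * x).
Local Notation ind := (ind_space io j nrd chi).
Implicit Types (x y g u b : units A) (f : units A -> C^o).

Let hB := centralizer_sub_division V j.

Lemma unitsP x : uval x != 0.
Proof. by rewrite -(unit_neq0 V); exact: uvalP. Qed.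

Lemma U1_vgeP (x : A) : U1 io x <-> vge V 1 (x - 1).
Proof. exact: (max_ideal_of_integers hint). Qed.

Lemma vge_U1M (x y : A) : vge V 1 (x - 1) -> vge V 1 (y - 1) -> vge V 1 (x * y - 1).
Proof.
move=> hx hy; have hx0 := vunit_vge (vunit_U1 hx); have hy0 := vunit_vge (vunit_U1 hy).
by rewrite -[X in _ - X]mulr1; apply: vge_congM; rewrite ?vge1.
Qed.

Lemma vge_U1V (x : A) : vge V 1 (x - 1) -> vge V 1 (x^-1 - 1).
Proof.
move=> hx; have ux := vunit_U1 hx; have x0 := vunit_neq0 ux.
have -> : x^-1 - 1 = - (x^-1 * (x - 1)) by rewrite mulrBr (dmulVf V)// mulr1 opprB.
by rewrite vgeN; apply: vgeMl => //; apply: vunit_vge; exact: vunitV.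
Qed.

Lemma vge_U1J (x y : A) : y != 0 -> vge V 1 (x - 1) -> vge V 1 (y * x * y^-1 - 1).
Proof.
move=> y0 hx; have -> : y * x * y^-1 - 1 = y * (x - 1) * y^-1.
  by rewrite mulrBr mulr1 mulrBl (dmulfV V).
by rewrite dv_unit_conj.
Qed.

Lemma ind_mul f b u g : ind f -> B (uval b) -> vge V 1 (uval u - 1) ->
  f (b * u * g)%g = chi (nrd (uval b)) * f g.
Proof.
by move=> [h _ _] hb hu; apply: h; [apply/centralizerP|apply/U1_vgeP].
Qed.

Lemma chi_neq0 z : z != 0 -> chi z != 0.
Proof.
move=> z0; have [c1 cM] := hchi; apply/eqP => e.
have := cM z z^-1 z0; rewrite invr_eq0 => /(_ z0); rewrite mulfV// c1 e mul0r => /eqP.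
by rewrite oner_eq0.
Qed.

Lemma ind_left f b g : ind f -> B (uval b) -> f (b * g)%g = chi (nrd (uval b)) * f g.
Proof.
move=> hf hb; have := @ind_mul f b 1%g g hf hb; rewrite mulg1; apply.
by rewrite subrr vge0.
Qed.

Lemma ind_leftU f u g : ind f -> vge V 1 (uval u - 1) -> f (u * g)%g = f g.
Proof.
move=> hf hu; have := @ind_mul f 1%g u g hf _ hu; rewrite mul1g (nrd_1 hnrd) hchi.1 mul1r.
by apply; exact: (sd1 hB).
Qed.

Definition chiB (b : A) := chi (nrd b).

Lemma chiBM (x y : A) : B x -> B y -> x != 0 -> y != 0 -> chiB (x * y) = chiB x * chiB y.
Proof.
move=> hx hy x0 y0; rewrite /chiB (nrd_mul V hnrd hx hy).
by apply: hchi.2; exact: (nrd_neq0 V hnrd).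
Qed.

Lemma chiBX (x : A) n : B x -> x != 0 -> chiB (x ^+ n) = chiB x ^+ n.
Proof.
move=> hx x0; elim: n => [|n IH]; first by rewrite !expr0 /chiB (nrd_1 hnrd) hchi.1.
rewrite !exprS chiBM ?IH ?(exp_neq0 V)//; exact: (sdX hB n hx).
Qed.

Lemma chiB_neq0 (x : A) : B x -> x != 0 -> chiB x != 0.
Proof. by move=> hx x0; apply: chi_neq0; exact: (nrd_neq0 V hnrd). Qed.

Lemma compact_units1 : compact_units io [set 1%g : units A].
Proof.
move=> I Y hY cov; have [i hi] := cov _ (erefl : [set 1%g : units A] 1%g).
by exists [:: i] => x ->; exists i; rewrite ?mem_head.
Qed.

(** The congruence subgroup of [a0] consists of 1-units, because [a0] lies in the maximal ideal. *)
Lemma smooth_left_cosets (f : units A -> C) :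
  (forall g u, vge V 1 (uval u - 1) -> f (g * u)%g = f g) -> smooth_fun io f.
Proof.
move=> hf; exists a0 => // g u [y /hint hy eu]; apply: hf.
by rewrite eu addrAC subrr add0r -mulr_algl; apply: vgeMr.
Qed.

(* The function supported on J extending the inflated character. *)
Lemma ind_fun_exists : (forall b : A, B b -> vge V 1 (b - 1) -> chiB b = 1) ->
  exists2 f, ind f & f 1%g = 1 /\
    forall x, f x != 0 -> exists b u, [/\ B (uval b), vge V 1 (uval u - 1) & x = (b * u)%g].
Proof.
move=> triv.
pose J x b := B (uval b) /\ vge V 1 (uval (b^-1 * x)%g - 1).
(* The value is [chiB b] for a chosen [b] with [x] in the coset of [b] modulo 1-units; [triv] makes
   it independent of the choice. *)
pose f x : C^o := if pselect (exists b, J x b) is left h then chiB (uval (projT1 (cid h))) else 0.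
have JB x b b' : J x b -> J x b' -> chiB (uval b) = chiB (uval b').
  move=> [hb hx] [hb' hx'].
  have b0 := unitsP b; have b'0 := unitsP b'.
  have hbb : B (uval (b'^-1 * b)%g) by apply: (sdM hB) => //; apply: (sdV hB).
  have e : uval b = uval b' * uval (b'^-1 * b)%g by rewrite /= mulrA (dmulfV V)// mul1r.
  rewrite e chiBM ?unitsP// [X in _ * X](triv _ hbb) ?mulr1//.
  have -> : (b'^-1 * b = (b'^-1 * x) * (b^-1 * x)^-1)%g.
    by rewrite invgM invgK mulgA mulgK.
  exact: (vge_U1M hx' (vge_U1V hx)).
have fJ x b : J x b -> f x = chiB (uval b).
  move=> h; rewrite /f; case: pselect => [h'|[]]; last by exists b.
  by apply: (JB x) => //; exact: (projT2 (cid h')).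
have fJ0 x : f x != 0 -> exists b, J x b.
  by rewrite /f; case: pselect => // _; rewrite eqxx.
have Jmul b u x b' : B (uval b) -> vge V 1 (uval u - 1) -> J x b' -> J (b * u * x)%g (b * b')%g.
  move=> hb hu [hb' hx]; split; first exact: (sdM hB).
  have -> : ((b * b')^-1 * (b * u * x) = (b'^-1 * u * b') * (b'^-1 * x))%g.
    by rewrite invgM !mulgA !mulgVK mulgK.
  apply: (vge_U1M _ hx); rewrite /= -{2}[uval b']invrK.
  by apply: vge_U1J => //; rewrite (inv_neq0 V)// unitsP.
exists f.
  split.
  - move=> b u g /centralizerP hb /U1_vgeP hu.
    have [[b' hb']|no] := pselect (exists b', J g b').
      rewrite (fJ _ _ (Jmul _ _ _ _ hb hu hb')) (fJ _ _ hb') /= chiBM ?unitsP//.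
      by case: hb'.
    have g0 : f g = 0 by apply/eqP/negPn/negP => /fJ0.
    rewrite g0 mulr0; apply/eqP/negPn/negP => /fJ0[b' hb']; apply: no.
    exists (b^-1 * b')%g; have hVb : B (uval b^-1%g) by exact: (sdV hB).
    have := Jmul b^-1%g (b * u^-1 * b^-1)%g _ _ hVb _ hb'.
    have -> : (b^-1 * (b * u^-1 * b^-1) * (b * u * g) = g)%g.
      by rewrite !mulgA mulVg mul1g mulgVK mulVg mul1g.
    by apply; apply: vge_U1J; [exact: unitsP|exact: vge_U1V].
  - apply: smooth_left_cosets => g u hu.
    have Ju x b u' : vge V 1 (uval u' - 1) -> J x b -> J (x * u')%g b.
      by move=> hu' [hb hx]; split=> //; rewrite mulgA; exact: (vge_U1M hx hu').
    have [[b hb]|no] := pselect (exists b, J g b).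
      by rewrite (fJ _ _ (Ju _ _ _ hu hb)) (fJ _ _ hb).
    have g0 : f g = 0 by apply/eqP/negPn/negP => /fJ0.
    rewrite g0; apply/eqP/negPn/negP => /fJ0[b hb]; apply: no.
    by exists b; rewrite -(mulgK u g); apply: Ju => //; exact: vge_U1V.
  - exists [set 1%g]; first exact: compact_units1.
    move=> g /fJ0[b [hb hg]]; exists g, 1%g; split=> //; last by rewrite mulg1.
    exists b, (b^-1 * g)%g; split; [exact/centralizerP|exact/U1_vgeP|].
    by rewrite mulgA mulgV mul1g.
split.
  rewrite (fJ _ 1%g) /chiB ?(nrd_1 hnrd) ?hchi.1//.
  by split; [exact: (sd1 hB)|rewrite mulg1 invg1 /= subrr vge0].
move=> x /fJ0[b [hb hx]]; exists b, (b^-1 * x)%g; split=> //.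
by rewrite mulgA mulgV mul1g.
Qed.

(** Dividing by a power of [c] reduces to units, where [happ] applies. Membership in the inducing
    subgroup is thus read off the valuation. *)
Lemma J_decomp (c : units A) (m : nat) :
  (forall x : A, vunit V x -> exists2 b, B b & vge V 1 (x - b)) ->
  B (uval c) -> V (uval c) = m%:Z ->
  forall x n, V (uval x) = n * m%:Z ->
  exists b u, [/\ B (uval b), vge V 1 (uval u - 1) & x = (b * u)%g].
Proof.
move=> happ hc Vc.
have unitcase x : vunit V (uval x) ->
    exists b u, [/\ B (uval b), vge V 1 (uval u - 1) & x = (b * u)%g].
  move=> ux; have [b hb hx] := happ _ ux.
  have ub : vunit V b by apply: (vunit_near ux); rewrite vge_sub_sym.
  have b0 := vunit_neq0 ub.
  pose b' := Units (dv_unit V b0).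
  exists b', (b'^-1 * x)%g; split=> //; last by rewrite mulgA mulgV mul1g.
  rewrite /= -[X in _ - X](dmulVf V b0) -mulrBr.
  by apply: vgeMl => //; apply: vunit_vge; exact: vunitV.
have hcX n : B (uval (c ^+ n)%g) by rewrite uvalX; exact: (sdX hB n hc).
have step x y : B (uval y) -> vunit V (uval (x * y^-1)%g) ->
    exists b u, [/\ B (uval b), vge V 1 (uval u - 1) & x = (b * u)%g].
  move=> hy /unitcase[b [u [hb hu e]]].
  exists (b * y)%g, (y^-1 * u * y)%g; split; first exact: (sdM hB).
    by rewrite /= -{2}[uval y]invrK; apply: vge_U1J; rewrite ?(inv_neq0 V) ?unitsP.
  by rewrite !mulgA mulgK -e mulgVK.
move=> x; case=> n hx.
  apply: (step x (c ^+ n)%g) => //; rewrite /vunit unitsP /=.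
  by rewrite dvM ?(inv_neq0 V) ?unitsP// dvV ?unitsP// uvalX dvX ?unitsP// Vc hx
    intmulnE mulrC subrr.
apply: (step x (c ^+ n.+1)^-1%g); first exact: (sdV hB).
rewrite /vunit unitsP /= invrK dvM ?unitsP// uvalX dvX ?unitsP// Vc hx.
by rewrite intmulnE NegzE mulrC mulrN addNr.
Qed.

End Induced.

(** * The Galois action and the norm to K *)

Section GaloisDescent.
Variables (F : fieldType) (E : splittingFieldType F).
Variables (D : falgType F) (DE : falgType E) (iD : {rmorphism D -> DE}).
Hypothesis hDE : base_change (in_alg E) iD.
Variable gD : gal_of {:E} -> {rmorphism DE -> DE}.
Hypothesis hgD : galois_action iD gD.
Implicit Types (g : gal_of {:E}) (x y : DE).

Lemma gD_scale g (c : E) x : gD g (c *: x) = g c *: gD g x.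
Proof.
have h : gD g (c *: 1) = g c *: 1 by rewrite -(rmorph1 iD) hgD rmorph1.
by rewrite -[x in LHS]mul1r scalerAl rmorphM h -scalerAl mul1r.
Qed.

Lemma gD_base g (x : D) : gD g (iD x) = iD x.
Proof. by have := hgD g 1 x; rewrite rmorph1 !scale1r. Qed.

(** [galois_action] prescribes values only on the [e *: iD x]. These generate [DE] additively, which
    forces the composition law. *)
Lemma gD_mul g g' x : gD g' (gD g x) = gD (g * g')%g x.
Proof.
have [dec _] := base_change_decomp hDE; have [c ->] := dec x.
rewrite !rmorph_sum; apply: eq_bigr => i _.
by rewrite !gD_scale !gD_base galM ?memvf.
Qed.

Lemma gD_1 x : gD 1%g x = x.
Proof.
have [dec _] := base_change_decomp hDE; have [c ->] := dec x.
by rewrite rmorph_sum; apply: eq_bigr => i _; rewrite gD_scale gD_base gal_id.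
Qed.

Lemma gD_iter g n x : iter n (gD g) x = gD (g ^+ n)%g x.
Proof. by elim: n => [|n IH]; rewrite ?gD_1//= IH gD_mul expgSr. Qed.

(** [gD sigma] acts on the coordinates with respect to a basis of [D], so those of a fixed point are
    fixed by the Galois group and lie in [F]. *)
Lemma gD_fixed sigma x : galois 1%VS {:E} -> generator 'Gal({:E} / 1) sigma ->
  gD sigma x = x -> exists y : D, x = iD y.
Proof.
move=> hE hs hx.
have [co [co1 co2]] := base_change_coord hDE.
have fixc k : sigma (co x 0 k) = co x 0 k.
  rewrite -[LHS](co2 (fun k => sigma (co x 0 k))) -{2}hx {2}[x]co1 rmorph_sum.
  by congr (co _ 0 k); apply: eq_bigr => i _; rewrite gD_scale gD_base.
have inF k : exists a : F, co x 0 k = a%:A.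
  have : co x 0 k \in fixedField 'Gal({:E} / 1)%g.
    apply/fixedFieldP; first exact: memvf.
    move=> g; have /eqP -> := hs => /cycleP[n ->].
    elim: n => [|n IH]; first by rewrite expg0 gal_id.
    by rewrite expgSr galM ?memvf// IH fixc.
  by move: hE => /galois_fixedField ->; move/vlineP.
have [a ha] := choice inF.
exists (\sum_k a k *: (vbasis {:D})`_k); rewrite {1}[x]co1 rmorph_sum.
apply: eq_bigr => k _; rewrite ha.
by have := hDE.1 (a k) (vbasis {:D})`_k 0; rewrite rmorph0 !addr0 => ->.
Qed.

Lemma gal_order_dim sigma l : galois 1%VS {:E} -> \dim {:E} = l ->
  generator 'Gal({:E} / 1) sigma -> (sigma ^+ l = 1)%g.
Proof.
move=> hE hl hs; rewrite -hl; have := galois_dim hE; rewrite dimv1 divn1 => ->.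
apply: expg_cardG; have /eqP e := hs.
have : sigma \in <[sigma]>%g by exact: cycle_id.
by rewrite -e.
Qed.

End GaloisDescent.

Lemma intmulnI (b c : int) (n : nat) : (0 < n)%N -> b *+ n = c *+ n -> b = c.
Proof. by move=> n0; rewrite !intmulnE; apply: mulIf; rewrite eqz_nat -lt0n. Qed.

Lemma intmuln_dvd_eq (b c : int) (n n' : nat) : (0 < n)%N -> (0 < n')%N ->
  n%:Z = b * n'%:Z -> n'%:Z = c * n%:Z -> n' = n.
Proof.
move=> n0 n'0 h h'; apply/eqP; rewrite eqn_dvd; apply/andP; split.
  by have := dvdz_mull b (dvdzz n'%:Z); rewrite -h dvdzE.
by have := dvdz_mull c (dvdzz n%:Z); rewrite -h' dvdzE.
Qed.

(** * The valuation of the extended division algebra *)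

Section BaseChangeValuation.
Variables (F : fieldType) (v : discrete_valuation F) (p q : nat).
Hypothesis hF : local_field v p q.
Variables (pi : F).
Hypotheses (pi0 : pi != 0) (vpi : v pi = 1).
Variables (D : falgType F) (d : nat) (hD : central_division D d).
Variables (V : divval D) (e : nat).
Hypothesis av : alg_val v V e.
Variables (k : finFieldType) (red : D -> k).
Hypothesis hred : residue_map V red.
Variables (l : nat) (l_prime : prime l) (l_neq_p : l != p) (l_ndvd_d : ~~ (l %| d)%N).
Hypothesis co : coprime l #|k|.-1.
Variables (E : splittingFieldType F) (hE : galois 1%VS {:E}) (hEl : \dim {:E} = l).
Variables (DE : falgType E) (iD : {rmorphism D -> DE}).
Hypothesis hDE : base_change (in_alg E) iD.
Variable gD : gal_of {:E} -> {rmorphism DE -> DE}.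
Hypothesis hgD : galois_action iD gD.
Variables (sigma : gal_of {:E}) (hsigma : generator 'Gal({:E} / 1) sigma).

(** The point is equality of the ramification indices: a fixed uniformizer of [DE] comes from [D],
    so each index divides the other. *)
Lemma base_change_valuation : exists (V' : divval (over_base DE)) (k' : finFieldType)
    (red' : over_base DE -> k'),
  [/\ alg_val v V' e, residue_map V' red',
    forall x : D, x != 0 -> V' (iD x) = V x &
    forall g (x : DE), x != 0 -> V' (gD g x) = V' x].
Proof.
have [hA _ hd] := hD.
have hT : GRing.field_axiom (over_base DE).
  by apply: (base_change_division hDE hA hd); rewrite hEl prime_coprime.
have iDa (a : F) : iD a%:A = (a%:A : over_base DE).
  by have := hDE.1 a 1 0; rewrite rmorph0 rmorph1 !addr0.
have [V' [e' [k' [red' [av' hred']]]]] := valued_algebra_exists hF hT.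
have ViD (x : D) : x != 0 -> V' (iD x) *+ e = V x *+ e'.
  move=> x0; apply: (algval_morph hF pi0 vpi av av' (h := base_incl iD)) => // a.
have VgD g (x : DE) : x != 0 -> V' (gD g x) = V' x.
  move=> x0.
  have /(_ _)/wrap[] := algval_morph hF pi0 vpi av' av' (h := gD g : {rmorphism over_base DE -> over_base DE}) _ x0.
    by move=> a; rewrite -iDa (gD_base hgD).
  exact: intmulnI (av_gt0 av').
have iD0 (x : D) : x != 0 -> iD x != 0.
  move=> x0; rewrite -(unit_neq0 V'); apply: (rmorph_unit iD); exact: (dv_unit V x0).
have e0 := av_gt0 av; have e'0 := av_gt0 av'.
have vge_iD (x : D) : vge V 1 x -> vge V' 1 (iD x).
  have [->|x0] := eqVneq x 0; first by move=> _; rewrite rmorph0; exact: (vge0 V').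
  rewrite !vgeE ?iD0//; have := ViD x x0; rewrite !intmulnE.
  move: (V' _) (V x) e0 e'0 => b c; clear; nia.
have [|||y [fy y0 Vy]] := fixed_uniformizer hred' l_prime _ (VgD sigma) _ co.
- by move=> x; rewrite (gD_iter hDE hgD) (gal_order_dim hE hEl hsigma) (gD_1 hDE hgD).
- exact: (residue_char hF pi0 vpi av' l_prime l_neq_p).
- move=> a /(gD_fixed hDE hgD hE hsigma)[x ->] ux.
  have x0 : x != 0 by apply: contraTneq ux => ->; rewrite rmorph0 /vunit eqxx.
  have Vx : vunit V x.
    rewrite /vunit x0 /=; apply/eqP; apply: (intmulnI e'0); rewrite -ViD//.
    by move: ux; rewrite /vunit => /andP[_ /eqP ->]; rewrite !mul0rn.
  have := vge_iD _ (vunit_pow hred Vx).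
  by rewrite rmorphB rmorphXn rmorph1.
have [x ex] := gD_fixed hDE hgD hE hsigma fy.
have x0 : x != 0 by apply: contraNneq y0 => x0; rewrite ex x0 rmorph0.
have ee : e' = e.
  have := ViD x x0; rewrite -ex Vy; have [u u0 Vu] := dv_onto V.
  have := ViD u u0; rewrite Vu !intmulnE !mul1r => h h'.
  by apply: (intmuln_dvd_eq e0 e'0 h' (esym h)).
exists V', k', red'; split=> //; first by rewrite -ee.
move=> z z0; have := ViD z z0; rewrite ee; exact: intmulnI.
Qed.

End BaseChangeValuation.

(** * Norms of field extensions *)

Section FieldNorm.
Variables (K L : fieldType) (i : {rmorphism K -> L}) (N : L -> K).

Lemma mul_matrix_ext n (b : 'I_n -> L) (M M' : 'M[K]_n) :
  (forall y, exists! c : 'rV[K]_n, y = \sum_k i (c 0 k) * b k) ->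
  (forall k, \sum_m i (M k m) * b m = \sum_m i (M' k m) * b m) -> M = M'.
Proof.
move=> ub h; apply/row_matrixP => k.
have [c [hc uc]] := ub (\sum_m i (M k m) * b m).
have rowE (X : 'M[K]_n) : \sum_m i (X k m) * b m = \sum_m i (row k X 0 m) * b m.
  by apply: eq_bigr => m _; congr (i _ * _); rewrite mxE.
by transitivity c; [apply/esym; apply: uc; rewrite rowE|apply: uc; rewrite h rowE].
Qed.

Hypothesis hN : field_norm i N.

Lemma field_norm_1 : N 1 = 1.
Proof.
have [n [b [ub hM]]] := hN; have [M e ->] := hM 1.
suff -> : M = 1%:M by rewrite det1.
apply: (mul_matrix_ext ub) => k; rewrite -e mul1r (bigD1 k)//= big1 ?addr0.
  rewrite mxE eqxx mulr1n. by rewrite rmorph1 mul1r.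
by move=> m mk; rewrite mxE eq_sym (negbTE mk) mulr0n rmorph0 mul0r.
Qed.

Lemma field_norm_mul x y : N (x * y) = N x * N y.
Proof.
have [n [b [ub hM]]] := hN.
have [M e ->] := hM (x * y); have [X ex ->] := hM x; have [Y ey ->] := hM y.
suff -> : M = Y *m X by rewrite det_mulmx mulrC.
apply: (mul_matrix_ext ub) => k; rewrite -e -mulrA ey mulr_sumr.
under eq_bigr => m _ do rewrite mulrCA ex mulr_sumr.
rewrite exchange_big; apply: eq_bigr => r _ /=.
rewrite mxE rmorph_sum mulr_suml; apply: eq_bigr => m _.
by rewrite rmorphM mulrA.
Qed.

Lemma field_norm_neq0 x : x != 0 -> N x != 0.
Proof.
move=> x0; have := field_norm_mul x x^-1; rewrite divff// field_norm_1 => h.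
by apply/eqP => e; move/eqP: h; rewrite e mul0r oner_eq0.
Qed.

(** [i y] acts by a scalar matrix, and the size of the basis hidden in [hN] is [l] because mutually
    inverse rectangular matrices are square. *)
Lemma field_norm_base l (eps : 'I_l -> L) :
  (forall y, exists x : 'I_l -> K, y = \sum_m i (x m) * eps m) ->
  (forall x : 'I_l -> K, \sum_m i (x m) * eps m = 0 -> forall m, x m = 0) ->
  forall y, N (i y) = y ^+ l.
Proof.
move=> span free y; have [n [b [ub hM]]] := hN; have [M e ->] := hM (i y).
have -> : M = y%:M.
  apply: (mul_matrix_ext ub) => k; rewrite -e (bigD1 k)//= big1 ?addr0.
    by rewrite mxE eqxx mulr1n.
  by move=> m mk; rewrite mxE eq_sym (negbTE mk) mulr0n rmorph0 mul0r.
rewrite det_scalar; suff -> : n = l by [].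
have /choice[P hP] : forall k : 'I_n, exists x : 'I_l -> K, b k = \sum_m i (x m) * eps m.
  by move=> k; exact: span.
have /choice[R hR] : forall m : 'I_l, exists c : 'rV[K]_n, eps m = \sum_k i (c 0 k) * b k.
  by move=> m; have [c [hc _]] := ub (eps m); exists c.
pose MP : 'M[K]_(n, l) := \matrix_(k, m) P k m.
pose MR : 'M[K]_(l, n) := \matrix_(m, k) R m 0 k.
have e1 : MP *m MR = 1%:M.
  apply: (mul_matrix_ext ub) => k; rewrite [in RHS](bigD1 k)//= [in RHS]big1 ?addr0; last first.
    by move=> m mk; rewrite mxE eq_sym (negbTE mk) mulr0n rmorph0 mul0r.
  rewrite mxE eqxx mulr1n rmorph1 mul1r [in RHS]hP.
  under [in RHS]eq_bigr => m _ do rewrite hR mulr_sumr.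
  rewrite exchange_big; apply: eq_bigr => r _ /=.
  rewrite mxE rmorph_sum mulr_suml; apply: eq_bigr => m _.
  by rewrite !mxE rmorphM mulrA.
have e2 : MR *m MP = 1%:M.
  apply/matrixP => m m'; apply/eqP; rewrite -subr_eq0; apply/eqP.
  apply: (free (fun m' => (MR *m MP) m m' - (1%:M : 'M_l) m m')).
  under eq_bigr => r _ do rewrite rmorphB mulrBl.
  rewrite sumrB [X in _ - X](bigD1 m)//= [X in _ - (_ + X)]big1 ?addr0; last first.
    by move=> r rm; rewrite mxE eq_sym (negbTE rm) mulr0n rmorph0 mul0r.
  rewrite mxE eqxx mulr1n rmorph1 mul1r [eps m]hR.
  under [X in _ - X]eq_bigr => k _ do rewrite hP mulr_sumr.
  rewrite [X in _ - X]exchange_big /= -sumrB big1// => r _.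
  rewrite mxE rmorph_sum mulr_suml -sumrB big1// => k _.
  by rewrite !mxE rmorphM mulrA subrr.
by apply/eqP; rewrite eqn_leq (mulmx1_min e1) (mulmx1_min e2).
Qed.

End FieldNorm.

Lemma mult_character_norm (K L : fieldType) (i : {rmorphism K -> L}) (N : L -> K)
    (C : fieldType) (theta : K -> C) : field_norm i N -> mult_character theta ->
  mult_character (theta \o N).
Proof.
move=> hN [t1 tM]; split=> [|x y x0 y0] /=; first by rewrite (field_norm_1 hN).
by rewrite (field_norm_mul hN) tM ?(field_norm_neq0 hN).
Qed.

Lemma vge_congV (A : unitRingType) (V : divval A) (x y : A) : vunit V x -> vunit V y ->
  vge V 1 (x - y) -> vge V 1 (x^-1 - y^-1).
Proof.
move=> ux uy hxy; have x0 := vunit_neq0 ux; have y0 := vunit_neq0 uy.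
have -> : x^-1 - y^-1 = - (x^-1 * (x - y) * y^-1).
  by rewrite mulrBr mulrBl (dmulVf V x0) mul1r -mulrA (dmulfV V y0) mulr1 opprB.
by rewrite vgeN; apply: vgeMr; [apply: vgeMl|]; rewrite ?vunit_vge ?vunitV.
Qed.

(** * The inducing character over E and the triviality of the Galois action *)

Section TameBaseChange.
Variables (F : fieldType) (v : discrete_valuation F) (p q : nat).
Hypothesis hF : local_field v p q.
Variables (pi : F).
Hypotheses (pi0 : pi != 0) (vpi : v pi = 1).
Variables (D : falgType F) (d : nat) (V : divval D) (e : nat).
Hypothesis av : alg_val v V e.
Variables (k : finFieldType) (red : D -> k).
Hypothesis hred : residue_map V red.
Variables (K : fieldExtType F) (C : fieldType) (theta : K -> C).
Hypothesis htame : tame_pair (vring_inc v) theta.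
Variables (j : {lrmorphism K -> D}) (nrd : D -> K).
Hypothesis hnrd : reduced_norm j nrd.
Variables (w u b z : D) (N m h : nat).
Hypothesis ts : tame_structure V k j q d w u b z N m h.
Variables (E : splittingFieldType F) (DE : falgType E) (iD : {rmorphism D -> DE}).
Hypothesis hDE : base_change (in_alg E) iD.
Variable gD : gal_of {:E} -> {rmorphism DE -> DE}.
Hypothesis hgD : galois_action iD gD.
Variables (V' : divval (over_base DE)) (k' : finFieldType) (red' : over_base DE -> k').
Hypotheses (av' : alg_val v V' e) (hred' : residue_map V' red').
Hypothesis ViD : forall x : D, x != 0 -> V' (iD x) = V x.
Hypothesis VgD : forall g (x : DE), x != 0 -> V' (gD g x) = V' x.
Variables (EK : fieldExtType E) (iEK : {rmorphism K -> EK}).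
Hypothesis hEK : base_change (in_alg E) iEK.
Variables (jE : {lrmorphism EK -> DE}) (nrdE : DE -> EK).
Hypothesis hjE : forall x, jE (iEK x) = iD (j x).
Hypothesis hnrdE : reduced_norm jE nrdE.
Variables (Nr : EK -> K).
Hypothesis hNr : field_norm iEK Nr.
Local Notation M := (#|k|.-1).
Local Notation M' := (#|k'|.-1).
Local Notation BE := (fun x : DE => forall y, x * jE y = jE y * x).
Local Notation VE := (V' : divval DE).
Local Notation chiE := (chiB nrdE (theta \o Nr)).
Local Notation fE := (alg_map (vring_inc v) E).

Let hB := centralizer_sub_division VE jE.

Lemma iD_neq0 (x : D) : x != 0 -> iD x != 0.
Proof. by move=> x0; rewrite -(unit_neq0 VE); apply: (rmorph_unit iD); exact: (dv_unit V x0). Qed.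

Lemma vge_iD n (x : D) : vge VE n (iD x) = vge V n x.
Proof.
have [->|x0] := eqVneq x 0; first by rewrite rmorph0 !vge0.
by rewrite !vgeE ?iD_neq0// ViD.
Qed.

Lemma iD_scalar_central (a : F) (x : DE) : x * iD a%:A = iD a%:A * x.
Proof.
have -> : iD a%:A = (a%:A : E)%:A.
  by have := hDE.1 a 1 0; rewrite rmorph0 rmorph1 !addr0.
by rewrite mulr_algl mulr_algr.
Qed.

Lemma BE_of_K (x : DE) : (forall y, x * iD (j y) = iD (j y) * x) -> BE x.
Proof.
move=> hx y; have [dec _] := base_change_decomp hEK; have [c ->] := dec y.
rewrite linear_sum mulr_sumr mulr_suml; apply: eq_bigr => i _.
by rewrite linearZ /= hjE -scalerAr -scalerAl hx.
Qed.

Lemma iD_BE (x : D) : (forall y, x * j y = j y * x) -> BE (iD x).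
Proof. by move=> hx; apply: BE_of_K => y; rewrite -!rmorphM hx. Qed.

Lemma gD_BE g (x : DE) : BE x -> BE (gD g x).
Proof. by move=> hx; apply: BE_of_K => y; rewrite -(gD_base hgD g) -!rmorphM -hjE hx. Qed.

(** Averaging over conjugates by the image of [z] gives an element commuting with [z], hence with
    [EK]. Every unit residue class of [DE] thus meets the centralizer. *)
Lemma unit_near_BE (x : DE) : vunit VE x -> exists2 c, BE c & vge VE 1 (x - c).
Proof.
move=> ux; have zM := ts_zM ts; have uz := root_unit V zM.
have uz' : vunit VE (iD z) by rewrite /vunit iD_neq0 ?(vunit_neq0 uz)// ViD ?(vunit_neq0 uz)//; case/andP: uz.
have zM' : iD z ^+ M' = 1.
  rewrite -rmorphXn (U1_torsion_free hred (r := z ^+ M')) ?rmorph1//; last first.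
    by rewrite exprAC zM expr1n.
  by rewrite -vge_iD rmorphB rmorphXn rmorph1; exact: (vunit_pow hred' uz').
have /andP[x0 /eqP Vx] := ux.
have [] := averaging hred' zM' zM' uz' uz' x0.
  by rewrite Vx; apply: (vge_comm hred'); apply: vunit_vge.
move=> c [cz cx _]; exists c; last by move: cx; rewrite Vx vge_sub_sym.
by apply: BE_of_K; apply: (ts_zgen ts) => // a; exact: iD_scalar_central.
Qed.

Lemma dv_jM y y' : y != 0 -> y' != 0 -> V (j (y * y')) = V (j y) + V (j y').
Proof. by move=> y0 y'0; rewrite rmorphM dvM// fmorph_eq0. Qed.

Lemma U1_of_dv y : vge V 1 (j y - 1) -> U1 (vring_inc v) y.
Proof.
move=> hy.
have hK : GRing.field_axiom K by move=> x x0; rewrite unitfE.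
have [W [eK [kK [redK [avK _]]]]] := valued_algebra_exists hF hK.
apply/(U1_vge hF pi0 vpi avK); have [->|y0] := eqVneq (y - 1) 0; first exact: vge0.
rewrite vgeE//; move: hy.
have jy0 : j (y - 1) != 0 by rewrite fmorph_eq0.
have -> : j y - 1 = j (y - 1) by rewrite rmorphB rmorph1.
rewrite vgeE//.
have := algval_morph hF pi0 vpi avK av (h := j) (rmorph_alg j) y0.
rewrite !intmulnE; have := av_gt0 avK; have := av_gt0 av.
by move: (V _) (W _) => c c'; clear; nia.
Qed.

Lemma theta_unit_pow y : y != 0 -> V (j y) = 0 -> theta y ^+ M = 1.
Proof.
move=> y0 Vy; have [_ hth _ hU] := htame.
have thX n : theta (y ^+ n) = theta y ^+ n.
  elim: n => [|n IH]; first by rewrite !expr0 hth.1.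
  by rewrite !exprS hth.2 ?expf_neq0// IH.
rewrite -thX; apply: hU; apply: U1_of_dv; rewrite rmorphXn; apply: (vunit_pow hred).
by rewrite /vunit fmorph_eq0 y0 Vy /=.
Qed.

Lemma chi_mult : mult_character (theta \o Nr).
Proof. by apply: mult_character_norm hNr _; case: htame. Qed.

Let yb x := Nr (nrdE x).

Lemma Nr_nrd_neq0 x : BE x -> x != 0 -> yb x != 0.
Proof. by move=> hx x0; apply: (field_norm_neq0 hNr); exact: (nrd_neq0 VE hnrdE). Qed.

Lemma dv_NrX x n : BE x -> x != 0 -> V (j (yb (x ^+ n))) = V (j (yb x)) *+ n.
Proof.
move=> hx x0; rewrite /yb; elim: n => [|n IH].
  by rewrite expr0 (nrd_1 hnrdE) (field_norm_1 hNr) rmorph1 dv1.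
rewrite exprS (nrd_mul VE hnrdE hx (sdX hB n hx)) (field_norm_mul hNr) dv_jM ?IH ?mulrS//.
  exact: Nr_nrd_neq0.
by apply: Nr_nrd_neq0; [exact: (sdX hB)|exact: (exp_neq0 VE)].
Qed.

Lemma vge_Q2 : vge VE 1 ((#|k'| ^ 2)%N%:R).
Proof. by rewrite natrX expr2; apply: vgeMl; [exact: vge_nat|exact: (vge_Q hred')]. Qed.

(** With [Q] the cardinality of [k'], the exponent is [Q^2 - 1] and not [Q - 1] so that it exceeds 1
    even for [Q = 2], as the descent in [dv_Nr_U1] requires. *)
Lemma U1_BE_root x : BE x -> vge VE 1 (x - 1) -> exists c,
  [/\ c ^+ (#|k'| ^ 2).-1 * x = 1, vge VE 1 (c - 1) & BE c].
Proof.
move=> hx ux.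
have [|c [cx uc hc]] := U1_root (av_limit av') _ vge_Q2 ux.
  by rewrite expn_gt0 (ltnW (Q_gt1 k')).
by exists c; split=> // y; apply/esym/hc; rewrite hx.
Qed.

(** Nothing relates the norms to valuations directly. But a 1-unit is the inverse of a power with
    exponent [Q^2 - 1] of another one, so this integer is divisible by all powers of [Q^2 - 1]. *)
Lemma dv_Nr_U1 x : BE x -> vge VE 1 (x - 1) -> V (j (yb x)) = 0.
Proof.
have step y : BE y -> vge VE 1 (y - 1) -> exists c,
    [/\ BE c, vge VE 1 (c - 1) & V (j (yb y)) = - V (j (yb c)) *+ (#|k'| ^ 2).-1].
  move=> hy uy; have [c [cy uc hc]] := U1_BE_root hy uy; exists c; split=> //.
  have c0 := vunit_neq0 (vunit_U1 uc); have y0 := vunit_neq0 (vunit_U1 uy).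
  have /eqP := congr1 (fun t => V (j (yb t))) cy.
  rewrite {1}/yb (nrd_mul VE hnrdE (sdX hB _ hc) hy) (field_norm_mul hNr) dv_jM; last 2 first.
  - by apply: Nr_nrd_neq0; [exact: (sdX hB)|exact: (exp_neq0 VE)].
  - exact: Nr_nrd_neq0.
  rewrite (dv_NrX _ hc c0) /yb (nrd_1 hnrdE) (field_norm_1 hNr) rmorph1 dv1.
  by rewrite addr_eq0 => /eqP e1; rewrite mulNrn e1 opprK.
have [n] := ubnP `|V (j (yb x))|%N; elim: n x => // n IH x lex hx ux.
have [c [hc uc e1]] := step _ hx ux.
have R1 : (1 < (#|k'| ^ 2).-1)%N.
  by have := Q_gt1 k'; rewrite expnS expn1; move: #|k'| => Q; clear; nia.
have [e0|ne0] := eqVneq (V (j (yb c))) 0; first by rewrite e1 e0 oppr0 mul0rn.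
rewrite e1 IH ?oppr0 ?mul0rn//; move: lex; rewrite e1 intmulnE abszM abszN.
move: ne0 R1; rewrite -absz_gt0 ltnS.
by move: `|V _|%N (_.-1) => a r; clear; nia.
Qed.

(** The [M']-th power of [x] is a 1-unit, so the norm of [x] to [K] is a unit, and [theta] sends
    units to [M]-th roots of unity. *)
Lemma chiE_pow x : BE x -> vunit VE x -> chiE x ^+ M = 1.
Proof.
move=> hx ux; have x0 := vunit_neq0 ux; apply: theta_unit_pow.
  exact: Nr_nrd_neq0.
have := dv_Nr_U1 (sdX hB _ hx) (vunit_pow hred' ux).
by rewrite dv_NrX// -[RHS](mul0rn _ M'); apply: intmulnI; exact: M_gt0.
Qed.

Lemma card_residue_dvd : (M %| M')%N.
Proof.
rewrite -(ts_ord ts) -vge_iD rmorphB rmorphXn rmorph1; apply: (vunit_pow hred').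
have uw := root_unit V (ts_wM ts); have w0 := vunit_neq0 uw.
by rewrite /vunit iD_neq0// ViD//; case/andP: uw.
Qed.

(** [x] is the inverse of a power with exponent [Q^2 - 1], a multiple of [M]. *)
Lemma chiE_U1 x : BE x -> vge VE 1 (x - 1) -> chiE x = 1.
Proof.
move=> hx ux; have [c [cx uc hc]] := U1_BE_root hx ux.
have c0 := vunit_neq0 (vunit_U1 uc); have x0 := vunit_neq0 (vunit_U1 ux).
have := congr1 chiE cx.
rewrite (chiBM hnrdE chi_mult VE (sdX hB _ hc) hx) ?(exp_neq0 VE)//.
rewrite (chiBX hnrdE chi_mult VE)//.
have /dvdnP[t ->] : (M %| (#|k'| ^ 2).-1)%N.
  apply: (dvdn_trans card_residue_dvd); rewrite predn_exp.
  exact: dvdn_mulr.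
rewrite mulnC exprM chiE_pow// ?expr1n ?mul1r; last exact: vunit_U1.
by move=> ->; rewrite /chiB (nrd_1 hnrdE) chi_mult.1.
Qed.

Lemma vge_gD g n (x : DE) : vge VE n (gD g x) = vge VE n x.
Proof.
have [->|x0] := eqVneq x 0; first by rewrite rmorph0 !vge0.
rewrite !vgeE ?VgD// -(unit_neq0 VE); apply: (rmorph_unit (gD g)); exact: (dv_unit VE x0).
Qed.

(* The exponent is 1 modulo [M] since [iD w] generates the residue field of [D]. *)
Lemma gD_residue g : exists2 n, n = 1 %[mod M] &
  forall x : DE, vunit VE x -> vge VE 1 (gD g x - x ^+ n).
Proof.
have [om0 [um0 gen0 ord0]] := residue_generator hred'.
have [om [omM gen ord _]] := teichmuller_generator hred' (av_limit av') um0 gen0 ord0.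
have um : vunit VE om := root_unit V' omM.
have gD_unit x : vunit VE x -> vunit VE (gD g x).
  move=> ux; have x0 := vunit_neq0 ux; have /andP[_ vx] := ux.
  rewrite /vunit -(unit_neq0 VE) (rmorph_unit (gD g)) ?(dv_unit VE x0)//=.
  by rewrite -[VE (gD g x)]/(V' (gD g x)) VgD.
have [n hn] := gen _ (gD_unit _ um).
have gX i : vge VE 1 (gD g (om ^+ i) - om ^+ (n * i)).
  by rewrite rmorphXn exprM; apply: vge_congX => //; exact: vunit_vge (gD_unit _ um).
have gU x : vunit VE x -> vge VE 1 (gD g x - x ^+ n).
  move=> ux; have [i hi] := gen _ ux.
  apply: (@vge_trans _ VE _ _ (gD g (om ^+ i))); first by rewrite -rmorphB vge_gD.
  apply: (@vge_trans _ VE _ _ (om ^+ (n * i))); first exact: gX.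
  rewrite mulnC exprM vge_sub_sym; apply: vge_congX => //; exact: vunit_vge.
exists n => //.
have uw := root_unit V (ts_wM ts); have w0 := vunit_neq0 uw.
have uw' : vunit VE (iD w) by rewrite /vunit iD_neq0// -[VE _]/(V' (iD w)) ViD//; case/andP: uw.
have := gU _ uw'; rewrite (gD_base hgD) -rmorphXn -rmorphB vge_iD => hw.
have := root_powers_cong hred (ts_wM ts) (ts_ord ts) (i := 1) (j := n) hw.
move/eqP; rewrite -[X in X == _]expr1 => /eqP; rewrite expr1 => e1.
by have := root_powers_eq hred (ts_wM ts) (ts_ord ts) 1 n; rewrite expr1 -e1 expr1 eqxx => /esym/eqP ->.
Qed.

Let indE := ind_space (intring_inc fE) jE nrdE (theta \o Nr).
Let hint (x : DE) : integers (alg_map (intring_inc fE) DE) x <-> vge VE 0 x :=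
  integers_over_ext hF pi0 vpi av' x.

Lemma unit_of_dv (n : int) : exists y : units D, V (uval y) = n.
Proof.
have uu := dv_unit V (ts_u0 ts); case: n => n.
  by exists (Units uu ^+ n)%g; rewrite uvalX dvX ?(ts_u0 ts)// (ts_Vu ts) intmulnE mul1r.
exists (Units uu ^+ n.+1)^-1%g => /=.
by rewrite uvalX dvV ?(exp_neq0 V) ?(ts_u0 ts)// dvX ?(ts_u0 ts)// (ts_Vu ts) intmulnE mul1r NegzE.
Qed.

(** Write [x = x0 Y] with [Y] from [D] and [x0] a unit close to [c] in the centralizer. Then
    [gD g x] is [bb uu x], where [bb] is the quotient of [gD g c] by [c] and [uu] a 1-unit; the
    character is 1 on [bb] since [gD g c] is close to [c^n] with [n = 1] modulo [M]. *)
Lemma ind_gD_invariant (f : units DE -> C^o) g x :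
  indE f -> f (units_map (gD g) x) = f x.
Proof.
move=> hf; have [y Vy] := unit_of_dv (VE (uval x)).
pose Y := units_map iD y; pose x0 := (x * Y^-1)%g.
have ex : (x = x0 * Y)%g by rewrite mulgVK.
have gY : units_map (gD g) Y = Y by apply: val_inj; rewrite /= (gD_base hgD).
have ux0 : vunit VE (uval x0).
  rewrite /vunit (unitsP VE) /= dvM ?(inv_neq0 VE) ?(unitsP VE)//; last exact: (unitsP VE Y).
  rewrite dvV ?(unitsP VE Y)// -[VE (iD _)]/(V' (iD (uval y))) ViD ?(unitsP V)// Vy.
  by rewrite subrr.
have [c hc cx0] := unit_near_BE ux0.
have uc : vunit VE c by apply: (vunit_near ux0); rewrite vge_sub_sym.
have c0 := vunit_neq0 uc; pose cU := Units (dv_unit VE c0).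
have [n n1 hn] := gD_residue g.
pose bb := (units_map (gD g) cU * cU^-1)%g.
have hbb : BE (uval bb) by apply: (sdM hB); [exact: gD_BE|exact: (sdV hB)].
pose uu := (bb^-1 * (units_map (gD g) x0 * x0^-1))%g.
have gD_unit (t : DE) : vunit VE t -> vunit VE (gD g t).
  move=> ut; have t0 := vunit_neq0 ut; have /andP[_ vt] := ut.
  rewrite /vunit -(unit_neq0 VE) (rmorph_unit (gD g)) ?(dv_unit VE t0)//=.
  by rewrite -[VE (gD g t)]/(V' (gD g t)) VgD.
have ubb : vunit VE (uval bb) by apply: vunitM; [exact: gD_unit|exact: vunitV].
have huu : vge VE 1 (uval uu - 1).
  rewrite /= -[X in _ - X](dmulVf VE (vunit_neq0 ubb)) -mulrBr.
  apply: vgeMl; first exact: vunit_vge (vunitV ubb).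
  apply: vge_congM; rewrite ?vunit_vge ?vunitV ?gD_unit//.
    by rewrite -rmorphB vge_gD.
  exact: vge_congV.
have e1 : units_map (gD g) x = (bb * uu * x)%g.
  have -> : (bb * uu = units_map (gD g) x0 * x0^-1)%g by rewrite /uu mulgA mulgV mul1g.
  have eY : (Y = x0^-1 * x)%g by rewrite [in RHS]ex mulgA mulVg mul1g.
  by rewrite -mulgA -eY -[in RHS]gY -units_mapM -ex.
rewrite e1 (ind_mul hint x hf hbb huu).
suff -> : (theta \o Nr) (nrdE (uval bb)) = 1 by rewrite mul1r.
have hgc : BE (gD g c) by exact: gD_BE.
have hcV : BE c^-1 by exact: (sdV hB).
have hcn : BE (c ^+ n) by exact: (sdX hB).
have cn0 : c ^+ n != 0 by exact: (exp_neq0 VE).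
have chic : chiE (c ^+ n) = chiE c.
  rewrite (chiBX hnrdE chi_mult VE)// -(expr_mod n (chiE_pow hc uc)) n1.
  by rewrite (expr_mod 1 (chiE_pow hc uc)) expr1.
have gc0 := vunit_neq0 (gD_unit _ uc).
have e2 : chiE (gD g c) = chiE (c ^+ n).
  have hq : BE ((c ^+ n)^-1 * gD g c) by apply: (sdM hB) => //; exact: (sdV hB).
  have q1 : vge VE 1 ((c ^+ n)^-1 * gD g c - 1).
    rewrite -[X in _ - X](dmulVf VE cn0) -mulrBr; apply: vgeMl; last exact: hn.
    by apply: vunit_vge; apply: vunitV; exact: vunitX.
  have -> : gD g c = c ^+ n * ((c ^+ n)^-1 * gD g c) by rewrite mulrA (dmulfV VE)// mul1r.
  rewrite (chiBM hnrdE chi_mult VE)// ?(mulf_neq0 VE) ?(inv_neq0 VE)//.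
  by rewrite [X in _ * X]chiE_U1// mulr1.
change (chiE (gD g c * c^-1) = 1).
rewrite (chiBM hnrdE chi_mult VE)// ?(inv_neq0 VE)// e2 chic.
rewrite -(chiBM hnrdE chi_mult VE)// ?(inv_neq0 VE)// (dmulfV VE)//.
by rewrite /chiB (nrd_1 hnrdE) chi_mult.1.
Qed.

Lemma dim_centralizer_base_change :
  (\dim (centralizer jE) <= \dim (centralizer j))%N.
Proof.
rewrite -[X in (_ <= X)%N]card_ord.
apply: (@dim_le_spanning E DE (centralizer jE) 'I_(\dim (centralizer j))
  (fun i => iD (vbasis (centralizer j))`_i)) => x /centralizerP hx.
have [dec free] := base_change_decomp hDE; have [c ec] := dec x.
have cC i : c i \in centralizer j.
  apply/centralizerP => y; apply/eqP; rewrite -subr_eq0; apply/eqP; move: i.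
  apply: free; under eq_bigr => i _ do rewrite rmorphB !rmorphM scalerBr scalerAl scalerAr.
  by rewrite sumrB -mulr_suml -mulr_sumr -ec -hjE hx subrr.
exists (fun i => \sum_(t < \dim {:E}) (vbasis {:E})`_t * (coord (vbasis (centralizer j)) i (c t))%:A).
under eq_bigr => i _ do rewrite scaler_suml.
rewrite exchange_big [LHS]ec; apply: eq_bigr => t _ /=.
rewrite {1}[c t](coord_vbasis (cC t)) rmorph_sum scaler_sumr; apply: eq_bigr => i _.
by have := hDE.1 (coord (vbasis (centralizer j)) i (c t)) (vbasis (centralizer j))`_i 0;
  rewrite rmorph0 !addr0 => ->; rewrite scalerA.
Qed.

Lemma piX_inj : injective (fun n => pi ^+ n).
Proof.
move=> n n' /(congr1 (field_dval v)); rewrite !(dvX (field_dval v))// !intmulnE.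
by rewrite [field_dval v pi]vpi !mul1r; case.
Qed.

(** Both sides are the product of the [h] conjugates of [w] by powers of [b], although the two norms
    come from unrelated splittings. *)
Lemma nrdE_iD_w : nrdE (iD w) = iEK (nrd w).
Proof.
have b0 := ts_b0 ts; have wB := ts_wB ts; have bB := ts_bB ts.
have wneq i i' : (i < i' < h)%N -> w ^+ ((N ^ m) ^ i) != w ^+ ((N ^ m) ^ i').
  move=> /andP[ii' i'h]; rewrite -!expnM; 
  apply: (wNX_neq pi0 vpi (ts_wM ts) (ts_u0 ts) (ts_Vu ts) (ts_uw ts) (ts_order ts)).
  by rewrite -(ts_mh ts) !ltn_pmul2l ?(ts_m0 ts)// ii'.
have infK : injective (fun n => (pi ^+ n)%:A : K).
  by move=> n n' /(@fmorph_inj _ _ (in_alg K)); exact: piX_inj.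
have infE : injective (fun n => ((pi ^+ n)%:A : E)%:A : EK).
  by move=> n n' /(@fmorph_inj _ _ (in_alg EK)) /(@fmorph_inj _ _ (in_alg E)); exact: piX_inj.
have e1 := nrd_root_of_unity V hnrd infK wB bB b0 (ts_bw ts) wneq (ts_dim ts).
have e2 : jE (nrdE (iD w)) = \prod_(i < h) iD w ^+ ((N ^ m) ^ i).
  apply: (nrd_root_of_unity VE hnrdE infE (iD_BE wB) (iD_BE bB) (iD_neq0 b0)).
  - by rewrite -rmorphXn -!rmorphM (ts_bw ts).
  - move=> i i' /wneq; rewrite -subr_eq0 => /iD_neq0.
    by rewrite rmorphB !rmorphXn subr_eq0.
  - apply: (leq_trans dim_centralizer_base_change).
    by rewrite (base_change_dim hEK) (ts_dim ts).
apply: (fmorph_inj jE); apply: (etrans e2); apply/esym; apply: (etrans (hjE _)).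
rewrite e1 rmorph_prod; by apply: eq_bigr => i _; rewrite rmorphXn.
Qed.

(** Origin of the exponent [l]: the norm to [K] of an element of [K] is its [l]-th power. *)
Lemma chiE_iD_w l : \dim {:E} = l -> chiE (iD w) = theta (nrd w) ^+ l.
Proof.
move=> hl; rewrite /chiB nrdE_iD_w /=.
have [dec free] := base_change_decomp hEK.
have eE (x : 'I_(\dim {:E}) -> K) :
    \sum_(t < \dim {:E}) iEK (x t) * ((vbasis {:E})`_t)%:A =
    \sum_(t < \dim {:E}) (vbasis {:E})`_t *: iEK (x t).
  by apply: eq_bigr => t _; rewrite mulr_algr.
have thX n y : y != 0 -> theta (y ^+ n) = theta y ^+ n.
  have [_ hth _ _] := htame; move=> y0.
  elim: n => [|n IH]; first by rewrite !expr0 hth.1.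
  by rewrite !exprS hth.2 ?expf_neq0// IH.
rewrite (field_norm_base hNr (eps := fun t : 'I_(\dim {:E}) => ((vbasis {:E})`_t)%:A)).
- by rewrite hl thX// (nrd_neq0 V hnrd (ts_wB ts))// (root_neq0 V (ts_wM ts)).
- by move=> y; have [c ->] := dec y; exists c; rewrite eE.
- by move=> x; rewrite eE; exact: free.
Qed.

End TameBaseChange.

(** * Multiplicity-free restriction to the roots of unity *)

Section IndStructure.
Variables (o : comNzRingType) (F : fieldType) (io : {rmorphism o -> F}).
Variables (K : fieldExtType F) (A : falgType F) (j : {lrmorphism K -> A}) (nrd : A -> K).
Hypothesis hnrd : reduced_norm j nrd.
Variables (C : fieldType) (chi : K -> C).
Hypothesis hchi : mult_character chi.
Variable V : divval A.
Hypothesis hint : forall x, integers (alg_map io A) x <-> vge V 0 x.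
Local Notation B := (fun x : A => forall y, x * j y = j y * x).
Local Notation ind := (ind_space io j nrd chi).
Hypothesis unit_near_B : forall x : A, vunit V x -> exists2 b, B b & vge V 1 (x - b).
Variables (w u b : units A) (N m : nat).
Hypotheses (wB : B (uval w)) (Vu : V (uval u) = 1) (uw : (u * w = w ^+ N * u)%g).
Hypotheses (bB : B (uval b)) (Vb : V (uval b) = m%:Z).
Implicit Types (x y g : units A) (f : units A -> C^o).
Local Notation lambda := (chiB nrd chi (uval w)).

Lemma dv_unitsM x y : V (uval (x * y)%g) = V (uval x) + V (uval y).
Proof. by rewrite /= dvM ?(unitsP V). Qed.

Lemma dv_unitsV x : V (uval x^-1%g) = - V (uval x).
Proof. by rewrite /= dvV ?(unitsP V). Qed.

Lemma dv_unitsX x n : V (uval (x ^+ n)%g) = V (uval x) *+ n.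
Proof. by rewrite uvalX dvX ?(unitsP V). Qed.

Lemma ind_right f u1 g : ind f -> vge V 1 (uval u1 - 1) -> f (g * u1)%g = f g.
Proof.
move=> hf hu; have -> : (g * u1 = (g * u1 * g^-1) * g)%g by rewrite mulgVK.
by apply: (ind_leftU hnrd hchi hint) => //; apply: vge_U1J => //; exact: unitsP.
Qed.

Lemma J_act x n : V (uval x) = n * m%:Z ->
  exists2 c : C, c != 0 & forall f y, ind f -> f (x * y)%g = c * f y.
Proof.
move=> Vx; have [b' [u' [hb hu ->]]] := J_decomp unit_near_B bB Vb Vx.
exists (chiB nrd chi (uval b')); first exact: (chiB_neq0 hnrd hchi V hb (unitsP V b')).
by move=> f y hf; exact: (ind_mul hint y hf hb hu).
Qed.

(** The constant does not depend on [f]. Functions in the induced space are therefore determined by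
    their values at the [u^i] with [i < m]. *)
Lemma ind_coset x y n : V (uval x) = V (uval y) + n * m%:Z ->
  exists2 c : C, c != 0 & forall f, ind f -> f x = c * f y.
Proof.
move=> h; have [|c c0 hc] := @J_act (x * y^-1)%g n.
  by rewrite dv_unitsM dv_unitsV h addrAC subrr add0r.
by exists c => // f hf; rewrite -hc// mulgVK.
Qed.

Lemma uX_mul_w i : (u ^+ i * w = w ^+ (N ^ i) * u ^+ i)%g.
Proof.
have uwX s : (u * w ^+ s = w ^+ (N * s) * u)%g.
  elim: s => [|s IH]; first by rewrite muln0 !expg0 mulg1 mul1g.
  by rewrite expgS mulgA uw -mulgA IH mulgA -expgnDr mulnS.
elim: i => [|i IH]; first by rewrite expn0 expg1 !expg0 mulg1 mul1g.
by rewrite expgS -mulgA IH mulgA uwX -mulgA -expnS -expgS.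
Qed.

Lemma ind_w f x i n : ind f -> V (uval x) = i%:Z + n * m%:Z ->
  f (x * w)%g = lambda ^+ (N ^ i) * f x.
Proof.
move=> hf Vx; have [|c c0 hc] := @J_act (x * (u ^+ i)^-1)%g n.
  by rewrite dv_unitsM dv_unitsV dv_unitsX Vx Vu intmulnE mul1r addrAC subrr add0r.
have -> : (x * w = (x * (u ^+ i)^-1) * (w ^+ (N ^ i) * u ^+ i))%g.
  by rewrite -uX_mul_w mulgA mulgVK.
rewrite hc// -[in RHS](mulgVK (u ^+ i)%g x) hc// mulrCA; congr (_ * _).
have hwX : B (uval (w ^+ (N ^ i))%g) by rewrite uvalX; exact: (sdX (centralizer_sub_division V j)).
rewrite (ind_left hint _ hf hwX); congr (_ * _).
by rewrite -[LHS]/(chiB nrd chi _) uvalX (chiBX hnrd hchi V _ wB (unitsP V w)).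
Qed.

End IndStructure.

(** * Schur's lemma for absolutely irreducible representations *)

Section AbsIrreducible.
Variables (K C : fieldType) (c : {rmorphism K -> C}).
Hypothesis closedC : GRing.closed_field_axiom C.
Variables (G : groupType) (V : lmodType K) (rho : group_rep G V).
Hypothesis irr : rep_abs_irreducible rho.
Variables (n : nat) (co : {linear V -> 'rV[K]_n}) (e : 'I_n -> V).
Hypotheses (coE : forall x, x = \sum_i co x 0 i *: e i) (co_e : forall i, co (e i) = delta_mx 0 i).

Lemma eigenvector_exists (A : 'M[C]_n) : (0 < n)%N ->
  exists a, exists2 x : 'rV_n, x != 0 & x *m A = a *: x.
Proof.
move=> n0; pose P := char_poly A.
have [a ha] := closedC (fun i => - P`_i) n0.
have : root P a.
  rewrite /root horner_coef size_char_poly big_ord_recr /=.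
  have /eqP := monicP (char_poly_monic A); rewrite lead_coefE size_char_poly /= => /eqP ->.
  by rewrite mul1r ha -big_split /= big1// => i _; rewrite mulNr subrr.
rewrite -eigenvalue_root_char => /eigenvalueP[x hx x0].
by exists a, x.
Qed.

(** Matrices act on row vectors from the right, hence the reversed product in [rep_mxM]. *)
Definition rep_mx g : 'M[K]_n := \matrix_(i, j) co (rho g (e i)) 0 j.

Lemma co_rep g x : co (rho g x) = co x *m rep_mx g.
Proof.
rewrite {1}[x]coE !linear_sum; apply/rowP => i; rewrite summxE mxE.
by apply: eq_bigr => k _; rewrite !linearZ !mxE.
Qed.

Lemma co_inj x y : co x = co y -> x = y.
Proof. by move=> h; rewrite [x]coE [y]coE h. Qed.

Lemma rep_mx1 : rep_mx 1%g = 1%:M.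
Proof. by apply/matrixP => i k; rewrite mxE rep_act1 co_e !mxE eqxx eq_sym. Qed.

Lemma rep_mxM g h : rep_mx (g * h)%g = rep_mx h *m rep_mx g.
Proof.
apply/row_matrixP => i; rewrite row_mul.
have rowE t : row i (rep_mx t) = co (rho t (e i)) by apply/rowP => k; rewrite !mxE.
by rewrite !rowE rep_actM co_rep.
Qed.

Let ext g : {linear 'rV[C]_n -> 'rV[C]_n} := mulmxr (map_mx c (rep_mx g)).

Lemma ext1 x : ext 1%g x = x.
Proof. by rewrite /= rep_mx1 map_mx1 mulmx1. Qed.
Lemma extM g h x : ext (g * h)%g x = ext g (ext h x).
Proof. by rewrite /= rep_mxM map_mxM mulmxA. Qed.
Definition ext_rep : group_rep G 'rV[C]_n := GroupRep ext1 extM.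

Definition ext_incl (x : V) : 'rV[C]_n := map_mx c (co x).

Lemma ext_base_change : base_change c ext_incl.
Proof.
split=> [a x y|Q h hh]; first by rewrite /ext_incl linearP map_mxD map_mxZ.
have h0 : h 0 = 0.
  by have := hh 1 0 0; rewrite rmorph1 !scale1r addr0 => /esym/eqP; rewrite -subr_eq0 addrK => /eqP.
have hZ a x : h (a *: x) = c a *: h x by rewrite -[a *: x]addr0 hh h0 addr0.
have hD x y : h (x + y) = h x + h y by rewrite -[x]scale1r hh rmorph1 !scale1r.
pose kf (r : 'rV[C]_n) := \sum_i r 0 i *: h (e i).
have kl : linear kf.
  move=> a r s; rewrite /kf scaler_sumr -big_split; apply: eq_bigr => i _ /=.
  by rewrite !mxE scalerDl scalerA.
pose kL := GRing.isLinear.Build _ _ _ _ kf kl.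
pose k : {linear 'rV[C]_n -> Q} := HB.pack kf kL.
exists k => [x|k' hk' r].
  rewrite /= /kf {2}[x]coE (big_morph h hD h0); apply: eq_bigr => i _.
  by rewrite hZ mxE.
rewrite /= /kf {1}[r]row_sum_delta linear_sum; apply: eq_bigr => i _.
by rewrite linearZ /= -hk' /ext_incl co_e map_delta_mx.
Qed.

Lemma ext_equivariant g x : ext_rep g (ext_incl x) = ext_incl (rho g x).
Proof. by rewrite /= /ext_incl co_rep map_mxM. Qed.

(** Over the algebraically closed [C], the matrix of [rho t] has an eigenvector, and the eigenspace
    is stable, hence everything. *)
Lemma abs_irreducible_scalar t : (forall g x, rho t (rho g x) = rho g (rho t x)) ->
  exists a : C, map_mx c (rep_mx t) = a%:M.
Proof.
move=> comm; have [[x0 hx0] irrW] := irr ext_base_change ext_equivariant.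
have n0 : (0 < n)%N.
  by rewrite lt0n; apply/eqP => n0; apply: hx0; apply/rowP; case=> i hi; exfalso; move: hi; rewrite n0.
have [a [x x_neq0 hx]] := eigenvector_exists (map_mx c (rep_mx t)) n0.
exists a; pose S := ker_pred (mulmxr (map_mx c (rep_mx t) - a%:M) : {linear 'rV_n -> 'rV_n}).
have kerP y : (y \in S) = (y *m map_mx c (rep_mx t) == a *: y).
  by rewrite /S inE /= /mulmxr /= mulmxBr mul_mx_scalar subr_eq0.
have [|h|h] := irrW S.
- move=> g y; rewrite !kerP /= => /eqP hy; rewrite -mulmxA -map_mxM.
  have -> : rep_mx g *m rep_mx t = rep_mx t *m rep_mx g.
    rewrite -!rep_mxM; apply/matrixP => i k; rewrite !mxE.
    by rewrite !rep_actM comm.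
  by rewrite map_mxM mulmxA hy scalemxAl.
- by move: x_neq0; rewrite (h x) ?eqxx// kerP hx.
apply/row_matrixP => i; have := h (delta_mx 0 i); rewrite kerP -rowE => /eqP ->.
by rewrite rowE mul_mx_scalar.
Qed.

End AbsIrreducible.

Lemma int_mod_nat (a : int) (m : nat) : (0 < m)%N ->
  exists (i : 'I_m) (n : int), a = (i : nat)%:Z + n * m%:Z.
Proof.
move=> m0; have mz : m%:Z != 0 by rewrite eqz_nat -lt0n.
have := modz_ge0 a mz; have := ltz_pmod a (m0 : 0 < m%:Z).
have := divz_eq a m%:Z; case: (a %% m%:Z)%Z => // i ea im _.
by exists (Ordinal (im : (i < m)%N)), (a %/ m%:Z)%Z; rewrite addrC.
Qed.

(** * The eigenvalues of w on pi are distinct *)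

Section DivisionSide.
Variables (F : fieldType) (v : discrete_valuation F) (p q : nat).
Hypothesis hF : local_field v p q.
Variables (pi : F).
Hypotheses (pi0 : pi != 0) (vpi : v pi = 1).
Variables (D : falgType F) (d : nat) (V : divval D) (e : nat).
Hypothesis av : alg_val v V e.
Variables (k : finFieldType) (red : D -> k).
Hypothesis hred : residue_map V red.
Variables (K : fieldExtType F) (C : fieldType) (theta : K -> C).
Hypothesis hth : mult_character theta.
Variables (j : {lrmorphism K -> D}) (nrd : D -> K).
Hypothesis hnrd : reduced_norm j nrd.
Variables (w u b z : D) (N m h : nat).
Hypothesis ts : tame_structure V k j q d w u b z N m h.
Variables (L : fieldType) (c : {rmorphism C -> L}).
Hypothesis closedL : GRing.closed_field_axiom L.
Variables (W : lmodType C) (rho : group_rep (units D) W).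
Hypothesis irr : rep_abs_irreducible rho.
Hypothesis nontriv : exists x : W, x <> 0.
Hypothesis hind : ind_iso (vring_inc v) j nrd theta rho.
Local Notation B := (fun x : D => forall y, x * j y = j y * x).
Local Notation lambda := (theta (nrd w)).
Local Notation ind := (ind_space (vring_inc v) j nrd theta).

Let hint (x : D) : integers (alg_map (vring_inc v) D) x <-> vge V 0 x :=
  integers_vge hF pi0 vpi av x.
Let w0 : w != 0 := root_neq0 V (ts_wM ts).
Let wU : units D := Units (dv_unit V w0).
Let uU : units D := Units (dv_unit V (ts_u0 ts)).
Let bU : units D := Units (dv_unit V (ts_b0 ts)).

Let uwU : (uU * wU = wU ^+ N * uU)%g.
Proof.
by apply: val_inj; change (u * w = uval (wU ^+ N)%g * u); rewrite uvalX (ts_uw ts).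
Qed.

Lemma unit_near_centralizer (x : D) : vunit V x -> exists2 y, B y & vge V 1 (x - y).
Proof.
move=> /(ts_gen ts)[i hi]; exists (w ^+ i) => //.
exact: (sdX (centralizer_sub_division V j) _ (ts_wB ts)).
Qed.

Let near := unit_near_centralizer.

(** Given equality, [rho (u^delta)] would commute with the action of [w], of 1-units and of powers
    of [u], which generate the group. Schur's lemma would make it a scalar, yet it moves the support
    of [f0] off itself. *)
Lemma lambda_pow_neq delta : (0 < delta < m)%N -> lambda ^+ (N ^ delta) != lambda.
Proof.
move=> /andP[d0 dm]; apply/eqP => hl.
have m0 := ts_m0 ts; have wB := ts_wB ts.
have [phi [phi_inj phi_range phi_rho]] := hind.
have indP x : ind (phi x) by rewrite -phi_range; exists x.
have phiM x g y : phi (rho g x) y = phi x (y * g)%g by rewrite phi_rho.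
have [x0 /eqP x0_neq0] := nontriv.
have [g0 hg0] : exists g, phi x0 g != 0.
  apply: contrapT => no; move/eqP: x0_neq0; apply; apply: phi_inj; rewrite linear0.
  by apply/funext => g; apply/eqP/negPn/negP => hg; apply: no; exists g.
(* Since the induced space is nonzero, the two transformation rules can be compared at a point [g0]
   where a function does not vanish. *)
have triv y : B y -> vge V 1 (y - 1) -> chiB nrd theta y = 1.
  move=> hy uy; have y0 := vunit_neq0 (vunit_U1 uy).
  pose Y := Units (dv_unit V y0); apply: (mulIf hg0); rewrite mul1r.
  rewrite -[RHS](ind_leftU hnrd hth hint (u := Y) g0 (indP x0))//.
  by rewrite (ind_left hint (b := Y) g0 (indP x0) hy).
have Va0 : vge V 1 (pi%:A : D).
  have Vp : V (pi%:A : D) = e%:Z by rewrite (av_base av)// vpi intmulnE mul1r.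
  by rewrite /vge /= Vp; apply/orP; right; exact: (av_gt0 av).
have [f0 if0 [f01 f0J]] := ind_fun_exists hnrd hth hint pi0 Va0 triv.
have [v0 ev0] : exists v0, phi v0 = f0.
  by have := if0; rewrite -phi_range => -[v0 _ <-]; exists v0.
have f0_mod y : f0 y != 0 -> exists n : int, V (uval y) = n * m%:Z.
  move=> /f0J[b' [u' [hb hu ->]]]; have [n hn] := ts_div ts (unitsP V b') hb.
  by exists n; rewrite dv_unitsM hn; have /andP[_ /eqP ->] := vunit_U1 hu; rewrite addr0.
(* The translates of [f0] by powers of [u] form the basis dual to the evaluations at [u^i]. *)
pose ei (i : 'I_m) := rho (uU ^+ i)^-1%g v0.
have VuX n : V (uval (uU ^+ n)%g) = n%:Z.
  by rewrite dv_unitsX /= (ts_Vu ts) intmulnE mul1r.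
have dual (i i' : 'I_m) : phi (ei i) (uU ^+ i')%g = (i == i')%:R.
  rewrite phiM ev0; have [->|ne] := eqVneq i i'; first by rewrite mulgV.
  apply/eqP/negPn/negP => /f0_mod[n]; rewrite dv_unitsM dv_unitsV !VuX => en.
  move/eqP: ne; apply; apply/val_inj => /=.
  move: en (ltn_ord i) (ltn_ord i') m0; move: (val i) (val i') => a a'; clear.
  by case: n => [[|n]|n]; nia.
pose co_fun x : 'rV[C]_m := \row_i phi x (uU ^+ i)%g.
have co_lin : linear co_fun.
  by move=> a x y; apply/rowP => i; rewrite !mxE linearP.
pose co : {linear W -> 'rV[C]_m} :=
  HB.pack co_fun (GRing.isLinear.Build _ _ _ _ co_fun co_lin).
have coE x : x = \sum_i co x 0 i *: ei i.
  apply: phi_inj; apply/funext => y.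
  have [i [n Vy]] := int_mod_nat (V (uval y)) m0.
  have [|a a0 ha] := ind_coset hnrd hth hint near (b := bU) (x := y) (y := (uU ^+ i)%g)
    (m := m) (n := n) (ts_bB ts) (ts_Vb ts).
    by rewrite VuX.
  rewrite ha// linear_sum /= fct_sumE (bigD1 i)//= big1 ?addr0 => [|i' ne].
    rewrite linearZ /= mxE.
    change (a * phi x (uU ^+ i)%g = phi x (uU ^+ i)%g * phi (ei i) y).
    by rewrite ha// dual eqxx mulr1 mulrC.
  rewrite linearZ /=; change (co_fun x 0 i' * phi (ei i') y = 0).
  by rewrite ha// dual (negbTE ne) !mulr0.
have co_e i : co (ei i) = delta_mx 0 i.
  by apply/rowP => i'; rewrite !mxE dual eqxx eq_sym.
pose t := (uU ^+ delta)%g.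
have comm g x : rho t (rho g x) = rho g (rho t x).
  apply: phi_inj; apply/funext => y; rewrite !phiM; move: g x y.
  pose P g := forall x y, phi x (y * t * g)%g = phi x (y * g * t)%g.
  have PM g g' : P g -> P g' -> P (g * g')%g.
    move=> hg hg' x y.
    by rewrite [in LHS]mulgA -phiM hg phiM [in RHS]mulgA -[in RHS]hg' -phiM // phiM.
  have Pw : P wU.
    move=> x y; have [i [n Vy]] := int_mod_nat (V (uval y)) m0.
    rewrite (ind_w hnrd hth hint near (w := wU) (u := uU) (b := bU) wB (ts_Vu ts) uwU (ts_bB ts) (ts_Vb ts)
      (i := i + delta) (n := n))//; last by rewrite dv_unitsM VuX Vy PoszD addrAC.
    rewrite -[in RHS]phiM (ind_w hnrd hth hint near (w := wU) (u := uU) (b := bU) wB (ts_Vu ts) uwU (ts_bB ts) (ts_Vb ts)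
      (i := i) (n := n))// phiM; congr (_ * _).
    have -> : chiB nrd theta (uval wU) = lambda by [].
    by rewrite addnC expnD exprM hl.
  have PU g : vge V 1 (uval g - 1) -> P g.
    move=> hg x y; rewrite (ind_right hnrd hth hint _ (indP x) hg).
    by rewrite -[in RHS]phiM (ind_right hnrd hth hint _ (indP _) hg) phiM.
  have PwX n : P (wU ^+ n)%g.
    by elim: n => [|n IH]; [move=> x y; rewrite expg0 !mulg1|rewrite expgS; exact: PM].
  have Pu0 g : vunit V (uval g) -> P g.
    move=> /(ts_gen ts)[i hi]; have -> : (g = wU ^+ i * ((wU ^+ i)^-1 * g))%g.
      by rewrite mulgA mulgV mul1g.
    apply: PM; first exact: PwX.
    have wi0 : w ^+ i != 0 by exact: (exp_neq0 V).
    apply: PU; change (vge V 1 ((uval (wU ^+ i)%g)^-1 * uval g - 1)); rewrite uvalX /=.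
    rewrite -[X in _ - X](dmulVf V wi0) -mulrBr; apply: vgeMl => //.
    by apply: vunit_vge; apply/vunitV/vunitX/root_unit/(ts_wM ts).
  have Pcomm g : (t * g = g * t)%g -> P g.
    by move=> hg x y; rewrite -mulgA hg mulgA.
  have tuX n : (t * uU ^+ n = uU ^+ n * t)%g by rewrite /t -!expgnDr addnC.
  have Pg y g : (t * y = y * t)%g -> V (uval y) = V (uval g) -> P g.
    move=> hy hV; rewrite -(mulKVg y g); apply: PM; first exact: Pcomm.
    by apply: Pu0; rewrite /vunit (unitsP V) dv_unitsM dv_unitsV hV addNr eqxx.
  move=> g; case eg: (V (uval g)) => [n|n].
    by apply: (Pg (uU ^+ n)%g); rewrite ?VuX.
  apply: (Pg (uU ^+ n.+1)^-1%g); last by rewrite dv_unitsV VuX eg NegzE.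
  by apply: (mulgI (uU ^+ n.+1)%g); rewrite !mulgA mulgV mul1g -tuX mulgK.
have [a ha] := abs_irreducible_scalar c closedL irr coE co_e comm.
pose i0 := Ordinal m0.
have e0 : ei i0 = v0 by rewrite /ei expg0 invg1 rep_act1.
(* The scalar is read at 1, where the translate of [f0] has the value [f0 (u^delta)], which is 0 as
   [m] does not divide [delta]. *)
have a0 : a = 0.
  have /matrixP/(_ i0 i0) := ha; rewrite !mxE eqxx mulr1n => <-.
  rewrite e0 phiM ev0 /= expg0 mul1g.
  have [->|/f0_mod[n]] := eqVneq (f0 t) 0; first by rewrite rmorph0.
  rewrite VuX => en; exfalso.
  by move: en d0 dm (m0); clear; case: n => [[|n]|n]; nia.
have r0 : rep_mx rho co ei t = 0.
  by apply: (map_mx_inj (f := c)); rewrite ha a0 map_mx0 raddf0.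
have t0 : rho t v0 = 0.
  by apply: (co_inj coE); rewrite (co_rep rho coE) r0 mulmx0 linear0.
have := rep_act1 rho v0; rewrite -(mulVg t) rep_actM t0 linear0 => v00.
by move: f01; rewrite -ev0 -v00 linear0 => /eqP; rewrite eq_sym oner_eq0.
Qed.

Lemma lambda_X n : theta (nrd (w ^+ n)) = lambda ^+ n.
Proof. exact: (chiBX hnrd hth V n (ts_wB ts) w0). Qed.

Lemma lambda_X_card : lambda ^+ #|k|.-1 = 1.
Proof. by rewrite -lambda_X (ts_wM ts) (nrd_1 hnrd) hth.1. Qed.

(** As [l] is prime to [M], [lambda] is a power of [lambda^l], and raising to the power [N^(d - i)]
    cancels [N^i] because [w^(N^d) = w]. An equality would thus contradict [lambda_pow_neq]. *)
Lemma lambda_conj_neq l i i' : (0 < l)%N -> coprime l #|k|.-1 -> (i < i' < m)%N ->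
  (lambda ^+ l) ^+ (N ^ i) != (lambda ^+ l) ^+ (N ^ i').
Proof.
move=> l0 co /andP[ii' i'm]; set mu := lambda ^+ l; apply/eqP => e1.
have md : (m <= d)%N.
  rewrite -(ts_mh ts) leq_pmulr// lt0n; apply/eqP => h0.
  by have [d0 _ _] := ts_order ts; move: d0; rewrite -(ts_mh ts) h0 muln0.
have mu_d : mu ^+ (N ^ d) = mu.
  have [_ wd _] := ts_order ts.
  by rewrite /mu exprAC -lambda_X wd.
have mu_delta : mu ^+ (N ^ (i' - i)) = mu.
  rewrite -[RHS]mu_d -(subnK (ltnW (leq_trans ii' (leq_trans (ltnW i'm) md)))) addnC.
  rewrite expnD exprM e1 -{1}mu_d.
  have <- : mu ^+ (N ^ (d + (i' - i))) = (mu ^+ (N ^ i')) ^+ (N ^ (d - i)).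
    by rewrite -exprM -expnD; congr (_ ^+ (_ ^ _)); move: ii' i'm md; lia.
  by rewrite expnD exprM.
have [s hs] : exists s, lambda = mu ^+ s.
  case: (egcdnP #|k|.-1 l0) => s t es _; rewrite (eqP co) in es; exists s.
  by rewrite -exprM mulnC es exprD mulnC exprM lambda_X_card expr1n mul1r expr1.
have hd : (0 < i' - i < m)%N by rewrite subn_gt0 ii' (leq_ltn_trans (leq_subr _ _) i'm).
by have /eqP := lambda_pow_neq hd; apply; rewrite hs exprAC mu_delta.
Qed.

End DivisionSide.

(** * Integers of the maximal unramified extension *)

Section Ladic.
Variables (Ql : fieldType) (w : discrete_valuation Ql) (l : nat).
Hypotheses (hQl : ladic_numbers w l) (l_prime : prime l).
Local Notation W := (field_dval w).

Lemma ladic_val_nat n : (0 < n)%N -> n%:R != 0 :> Ql /\ W n%:R = (logn l n)%:Z.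
Proof. exact: la_val. Qed.

Lemma ladic_vge_nat n : vge W 1 (n%:R : Ql) = (l %| n)%N.
Proof.
case: n => [|n]; first by rewrite vge0 dvdn0.
have [n0 hn] := ladic_val_nat (ltn0Sn n).
rewrite vgeE// hn; have := pfactor_dvdn 1 l_prime (ltn0Sn n).
by rewrite expn1 => ->.
Qed.

Lemma ladic_vge_int (a : int) : vge W 1 (a%:~R : Ql) = (l %| `|a|)%N.
Proof.
case: a => n; first by rewrite ladic_vge_nat.
by rewrite NegzE mulrNz vgeN abszN absz_nat -ladic_vge_nat.
Qed.

(** Rationals are dense, and one that is integral at [l] is congruent to an integer because its
    denominator is invertible modulo [l]. *)
Lemma ladic_local_field : local_field w l l.
Proof.
have l0 := prime_gt0 l_prime.
split=> //; first exact: la_complete hQl; last by move: (ladic_vge_nat l); rewrite dvdnn.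
pose s (i : 'I_l) : vring w := (i : nat)%:R.
have sE i : vring_val (s i) = (i : nat)%:R :> Ql by exact: (rmorph_nat (vring_inc w)).
exists s => x; have hx : vge W 0 (vring_val x) by case: x.
have [r /= hr'] := la_dense hQl (vring_val x) 1.
have hr : vge W 1 (vring_val x - ratr r) := hr'.
have rE : ratr r = (numq r)%:~R / (denq r)%:~R :> Ql by [].
have den0 : (denq r)%:~R != 0 :> Ql.
  have : (0 < `|denq r|)%N by rewrite absz_gt0 denq_neq0.
  by move=> /ladic_val_nat[+ _]; rewrite pmulrn gtz0_abs ?denq_gt0.
have hr0 : vge W 0 (ratr r : Ql) by apply: (vge_of_cong hx); rewrite vge_sub_sym.
have nd : ~~ (l %| `|denq r|)%N.
  apply/negP => hd; have := coprime_num_den r; rewrite /coprime.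
  have hn : (l %| `|numq r|)%N.
    rewrite -ladic_vge_int; have -> : (numq r)%:~R = ratr r * (denq r)%:~R :> Ql.
      by rewrite rE mulfVK.
    by apply: vgeMl => //; rewrite ladic_vge_int.
  move=> /eqP cop; have : (l %| gcdn `|numq r| `|denq r|)%N by rewrite dvdn_gcd hn.
  by rewrite cop dvdn1; move: l_prime; case: eqP => // ->.
have [c hc] : exists c : int, vge W 1 ((denq r)%:~R * c%:~R - 1 : Ql).
  have cop : coprimez (denq r) l by rewrite coprimezE coprime_sym prime_coprime.
  have /coprimezP[[c t] /= hct] := cop.
  exists c; have -> : (denq r)%:~R * c%:~R - 1 = (denq r * c - 1)%:~R :> Ql.
    by rewrite rmorphB rmorphM rmorph1.
  rewrite ladic_vge_int.
  have -> : denq r * c - 1 = - t * l%:Z by rewrite -hct mulrC opprD addrA subrr sub0r mulNr.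
  by rewrite mulNr abszN abszM dvdn_mull.
have [i hi] : exists i : 'I_l, vge W 1 (vring_val x - (i : nat)%:R).
  have lz : l%:Z != 0 by rewrite eqz_nat -lt0n.
  have h1 : 0 <= (numq r * c %% l%:Z)%Z by exact: modz_ge0.
  have h2 : (numq r * c %% l%:Z)%Z < l%:Z by exact: ltz_pmod.
  have h3 := divz_eq (numq r * c) l%:Z.
  case: (numq r * c %% l%:Z)%Z h1 h2 h3 => // i _ il e1.
  exists (Ordinal (il : (i < l)%N)); apply: (vge_trans hr) => /=.
  apply: (@vge_trans _ W _ _ ((numq r * c)%:~R)).
    have -> : ratr r - (numq r * c)%:~R = - (ratr r * ((denq r)%:~R * c%:~R - 1)) :> Ql.
      by rewrite mulrBr mulr1 opprB mulrA [ratr r * _]divfK// rmorphM.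
    by rewrite vgeN; apply: vgeMl.
  rewrite e1 rmorphD /= -pmulrn addrK ladic_vge_int abszM; exact: dvdn_mull.
exists i; split=> [|i' hi']; first by move: hi; rewrite -sE.
apply/val_inj/eqP; have : vge W 1 ((i : nat)%:R - (i' : nat)%:R : Ql).
  apply: (vge_trans (y := vring_val x)); first by rewrite vge_sub_sym.
  by rewrite -sE.
rewrite !pmulrn -rmorphB ladic_vge_int => hd; rewrite -eqz_nat -subr_eq0 -absz_eq0.
have lt : (`|(i : nat)%:Z - (i' : nat)%:Z| < l)%N.
  by have := ltn_ord i; have := ltn_ord i'; move: (val i) (val i'); clear; lia.
by apply: contraLR hd => nz; rewrite gtnNdvd// lt0n.
Qed.

End Ladic.

Section MaxUnramified.
Variables (Ql : fieldType) (w : discrete_valuation Ql) (l : nat).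
Hypotheses (hQl : ladic_numbers w l) (l_prime : prime l).
Variables (Kc Cl : fieldType) (iQ : {rmorphism Ql -> Kc}) (iKc : {rmorphism Kc -> Cl}).
Hypothesis hKc : max_unramified w iQ iKc.
Local Notation W := (field_dval w).
Local Notation O := (ext_integers w iQ).
Local Notation inc := (ext_integers_inc w iQ).

Lemma l_neq0 : l%:R != 0 :> Kc.
Proof.
have [l0 _] := ladic_val_nat hQl (prime_gt0 l_prime).
by rewrite -(rmorph_nat iQ) fmorph_eq0.
Qed.

Lemma l_not_unit (a : O) : l%:R * inc a != 1.
Proof.
apply/eqP => h; have /asboolP ha : inc a \in integral_pred (iQ \o vring_inc w) by case: (a).
have [l0 vl] := ladic_val_nat hQl (prime_gt0 l_prime).
have ea : inc a = iQ (l%:R^-1).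
  by rewrite fmorphV rmorph_nat; apply: (mulfI l_neq0); rewrite h mulfV ?l_neq0.
have : vge W 0 (l%:R^-1 : Ql).
  apply: (integral_vge (f := vring_inc w)); first by case.
  case: ha => P Pm; rewrite ea map_poly_comp => rP; exists P => //.
  by move: rP; rewrite fmorph_root.
rewrite vgeE ?invr_eq0// (dvV W l0) vl.
by have := logn_prime l l_prime; rewrite eqxx => ->.
Qed.

(** Every element of [Kc] lies in a finite unramified extension of [Ql], where [l] remains a
    uniformizer. In effect the integers of [Kc] form a discrete valuation ring with uniformizer
    [l]. *)
Lemma integral_or_inverse (a : Kc) : a != 0 ->
  (exists c : O, a = inc c) \/ (exists c : O, a^-1 = l%:R * inc c).
Proof.
move=> a0; have [L [h [unr hQ [y hy]]]] := (mu_image hKc (iKc a)).1 (ex_intro _ a erefl).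
have hL : GRing.field_axiom L by move=> x x0; rewrite unitfE.
have hw := ladic_local_field hQl l_prime.
have [V [e [kL [red [av _]]]]] := valued_algebra_exists hw hL.
have e1 : e = 1%N := unramified_index hw av unr.
have [l0 vl] := ladic_val_nat hQl (prime_gt0 l_prime).
have vl1 : W l%:R = 1 by rewrite vl; have := logn_prime l l_prime; rewrite eqxx => ->.
have y0 : y != 0 by apply: contraNneq a0 => y0; rewrite -(fmorph_eq0 iKc) -hy y0 rmorph0.
have transfer (x : L) (c : Kc) : h x = iKc c -> vge V 0 x -> exists c' : O, c = inc c'.
  move=> hx /(integers_vge hw l0 vl1 av)[P Pm rP].
  suff hc : c \in integral_pred (iQ \o vring_inc w) by exists (IntRing hc).
  apply/asboolP; exists P => //; rewrite -(fmorph_root iKc) -hx -map_poly_comp.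
  rewrite (_ : map_poly _ P = map_poly h (map_poly (alg_map (vring_inc w) L) P)) ?fmorph_root//.
  by rewrite -map_poly_comp; apply: eq_map_poly => r /=; rewrite hQ.
have [hV|] := boolP (vge V 0 y); first by left; apply: transfer hy hV.
rewrite vgeE// -ltNge => hV; right.
have Vl : V (l%:R : L) = 1.
  by rewrite -(rmorph_nat (in_alg L)) (av_base av)// e1; exact: vl1.
have Vl0 : l%:R != 0 :> L by rewrite -(rmorph_nat (in_alg L)) fmorph_eq0.
have [||c hc] := transfer (l%:R * y)^-1 (l%:R * a)^-1.
- by rewrite !fmorphV !rmorphM !rmorph_nat hy.
- rewrite vgeE ?invr_eq0 ?mulf_neq0// (dvV V) ?mulf_neq0// (dvM V)// Vl.
  by move: hV; move: (V y); lia.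
by exists c; rewrite -hc invfM mulrA mulfV ?l_neq0// mul1r.
Qed.

End MaxUnramified.

(** * Stable lattices and Tate cohomology *)

Lemma geometric_sum (R : fieldType) (x : R) (M : nat) : x ^+ M = 1 -> x != 1 ->
  \sum_(s < M) x ^+ s = 0.
Proof.
move=> xM x1; apply/eqP; have := subrX1 x M; rewrite xM subrr => /esym/eqP.
by rewrite mulf_eq0 subr_eq0 (negbTE x1).
Qed.

(** * Submodules of a lattice whose eigenlines are permuted transitively *)

Section LatticeSubmodules.
Variables (O : comNzRingType) (C : fieldType) (inc : {rmorphism O -> C}).
Variables (G X : groupType) (iota : G -> X) (deg : X -> int) (degG : G -> int).
Hypotheses (iota1 : iota 1%g = 1%g)
  (iotaM : forall g g', iota (g * g')%g = (iota g * iota g')%g).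
Hypothesis degM : forall y g, deg (y * iota g)%g = deg y + degG g.
Hypothesis degG_onto : forall a, exists g, degG g = a.
Variables (l M N m : nat) (lambda : O) (w : G).
Hypotheses (l0 : (0 < l)%N) (m0 : (0 < m)%N) (co : coprime l M) (lambdaM : inc lambda ^+ M = 1).
Hypothesis lambda_neq : forall i i', (i < i' < m)%N ->
  inc lambda ^+ (N ^ i) != inc lambda ^+ (N ^ i').
Hypothesis int_or_inv : forall a : C, a != 0 ->
  (exists c, a = inc c) \/ (exists c, a^-1 = l%:R * inc c).
Local Notation E := (rscal inc (X -> C^o)).
Variable L : submodClosed E.
Definition shift g (x : E) : E := fun y => x (y * iota g)%g.
Hypothesis L_shift : forall g x, x \in L -> shift g x \in L.
Hypothesis L_w : forall (x : E) y i (n : int), x \in L -> deg y = i%:Z + n * m%:Z ->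
  x (y * iota w)%g = inc lambda ^+ (N ^ i) * x y.
Hypothesis L_coset : forall y y' (n : int), deg y = deg y' + n * m%:Z ->
  exists c : C, forall x : E, x \in L -> x y = c * x y'.
Variable S : E -> Prop.
Hypotheses (S_L : forall x, S x -> x \in L) (S_lin : forall a x y, S x -> S y -> S (a *: x + y))
  (S_shift : forall g x, S x -> S (shift g x)) (S_l : forall x, x \in L -> S (l%:R *: x)).
Definition in_lL x := exists2 y, y \in L & x = l%:R *: y.

Lemma rscalE a (x : E) y : (a *: x) y = inc a * x y. Proof. by []. Qed.

Lemma rsumE (I : Type) (r : seq I) (P : pred I) (F : I -> E) y :
  (\sum_(i <- r | P i) F i) y = \sum_(i <- r | P i) F i y.
Proof. by elim/big_rec2: _ => // i a b _ <-. Qed.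

Lemma S_0 : S 0.
Proof. by rewrite -(scaler0 _ l%:R); apply: S_l; exact: rpred0. Qed.

Lemma S_Z a x : S x -> S (a *: x).
Proof. by move=> hx; rewrite -[a *: x]addr0; apply: S_lin => //; exact: S_0. Qed.

Lemma S_D x y : S x -> S y -> S (x + y).
Proof. by move=> hx hy; rewrite -[x]scale1r; exact: S_lin. Qed.

Lemma S_sum (I : finType) (F : I -> E) : (forall i, S (F i)) -> S (\sum_i F i).
Proof. by move=> h; apply: (big_ind S) => // *; [exact: S_0|exact: S_D]. Qed.

Lemma in_lL_lin a x y : in_lL x -> in_lL y -> in_lL (a *: x + y).
Proof.
move=> [x' hx ->] [y' hy ->]; exists (a *: x' + y'); first by rewrite rpredD ?rpredZ.
by rewrite scalerDr !scalerA mulrC.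
Qed.

Lemma in_lL_shift g x : in_lL x -> in_lL (shift g x).
Proof. by move=> [y hy ->]; exists (shift g y) => //; exact: L_shift. Qed.

Lemma shift_shift g g' x : shift g (shift g' x) = shift (g * g')%g x.
Proof. by apply/funext => y; rewrite /shift iotaM mulgA. Qed.

Lemma shift1 x : shift 1%g x = x.
Proof. by apply/funext => y; rewrite /shift iota1 mulg1. Qed.

Definition proj i (x : E) : E :=
  \sum_(s < M) lambda ^+ (N ^ i * (M - s)) *: shift (w ^+ s)%g x.

Lemma L_wX (x : E) y i (n : int) s : x \in L -> deg y = i%:Z + n * m%:Z ->
  shift (w ^+ s)%g x y = inc lambda ^+ (N ^ i * s) * x y.
Proof.
move=> hx hy; elim: s => [|s IH]; first by rewrite expg0 shift1 muln0 mul1r.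
rewrite expgS -shift_shift; change (shift (w ^+ s)%g x (y * iota w)%g = inc lambda ^+ (N ^ i * s.+1) * x y).
by rewrite (L_w (L_shift _ hx) hy) IH mulrA -exprD mulnS.
Qed.

Lemma proj_L i x : x \in L -> proj i x \in L.
Proof. by move=> hx; apply: rpred_sum => s _; rewrite rpredZ// L_shift. Qed.

Lemma S_proj i x : S x -> S (proj i x).
Proof. by move=> hx; apply: S_sum => s; apply/S_Z/S_shift. Qed.

(** In degrees congruent to [i'], [w] acts by [lambda^(N^i')]; the sum is geometric, with ratio 1
    only when [i = i']. *)
Lemma proj_eq (i i' : 'I_m) (n : int) (x : E) y : x \in L -> deg y = i'%:Z + n * m%:Z ->
  proj i x y = (if i == i' then M%:R * x y else 0).
Proof.
move=> hx hy; rewrite /proj rsumE; pose a := inc lambda ^+ (N ^ i); pose a' := inc lambda ^+ (N ^ i').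
have aM : a ^+ M = 1 by rewrite /a exprAC lambdaM expr1n.
have a'M : a' ^+ M = 1 by rewrite /a' exprAC lambdaM expr1n.
have [->|Mpos] := posnP M; first by rewrite big_ord0 mul0r if_same.
have a0 : a != 0.
  by apply: contra_eq_neq aM => ->; rewrite expr0n gtn_eqF// eq_sym oner_eq0.
have -> : \sum_(s < M) (lambda ^+ (N ^ i * (M - s)) *: shift (w ^+ s)%g x) y =
    (\sum_(s < M) (a' / a) ^+ s) * x y.
  rewrite mulr_suml; apply: eq_bigr => s _.
  rewrite rscalE (L_wX _ hx hy) mulrA rmorphXn /= !exprM -/a -/a'; congr (_ * _).
  rewrite expr_div_n mulrC; congr (_ * _); apply: (mulIf (expf_neq0 s a0)).
  have sM : (s <= M)%N by exact: ltnW.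
  by rewrite -exprD (subnK sM) aM mulVf// expf_neq0.
have [e|ne] := eqVneq i i'.
  have -> : a' = a by rewrite /a' -e.
  by rewrite divff// (eq_bigr (fun=> 1)) ?sumr_const ?card_ord// => s _; rewrite expr1n.
rewrite geometric_sum ?mul0r//; first by rewrite expr_div_n aM a'M divr1.
suff ne' : a' != a by apply: contraNneq ne' => e; rewrite -[a'](divfK a0) e mul1r.
have [lt|lt|e] := ltngtP (i : nat) i'.
- by rewrite eq_sym; apply: lambda_neq; rewrite lt /=.
- by apply: lambda_neq; rewrite lt /=.
by move: ne; rewrite (val_inj e) eqxx.
Qed.

Lemma sum_proj x : x \in L -> \sum_(i < m) proj i x = M%:R *: x.
Proof.
move=> hx; apply/funext => y; rewrite rsumE rscalE rmorph_nat.
have [i' [n hy]] := int_mod_nat (deg y) m0.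
rewrite (bigD1 i')//= (proj_eq _ hx hy) eqxx big1 ?addr0// => i ne.
by rewrite (proj_eq _ hx hy) (negbTE ne).
Qed.

(** It undoes, modulo [l], the factor [M] carried by [proj]. *)
Lemma bezout_split : exists s t : O, forall x : E, x = s *: (M%:R *: x) + l%:R *: (t *: x).
Proof.
case: (egcdnP M l0) => a b e _; rewrite (eqP co) in e.
have h1 : a%:R * l%:R = b%:R * M%:R + 1 :> O by rewrite -!natrM e natrD.
exists (- b%:R), a%:R => x; rewrite !scalerA -scalerDl [l%:R * _]mulrC h1 mulNr addKr.
by rewrite scale1r.
Qed.

(** An element of [S] outside [l L] has a component outside [l L], which a shift carries to any
    other eigenline. There every component of an element of [L] is an integral multiple of it, for
    otherwise the shifted component would be divisible by [l]. *)
Lemma submodule_trivial : (forall x, S x -> in_lL x) \/ (forall x, x \in L -> S x).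
Proof.
have [|no] := pselect (forall x, S x -> in_lL x); [by left|right].
have [x Sx nx] : exists2 x, S x & ~ in_lL x.
  by apply: contrapT => h; apply: no => x Sx; apply: contrapT => nx; apply: h; exists x.
have [s [t st]] := bezout_split.
have lL0 : in_lL 0 by exists 0; rewrite ?rpred0 ?scaler0.
have lLD a b : in_lL a -> in_lL b -> in_lL (a + b).
  by move=> ha hb; rewrite -[a]scale1r; exact: in_lL_lin.
have lLZ a b : in_lL b -> in_lL (a *: b).
  by move=> hb; rewrite -[_ *: b]addr0; apply: in_lL_lin.
have lL_sum (I : finType) (f : I -> E) : (forall i, in_lL (f i)) -> in_lL (\sum_i f i).
  by move=> h; apply: (big_ind in_lL) => // a b; exact: lLD.
have [i ni] : exists i : 'I_m, ~ in_lL (proj i x).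
  apply: contrapT => h; apply: nx; rewrite (st x); apply: lLD.
    apply: lLZ; rewrite -(sum_proj (S_L Sx)); apply: lL_sum => i.
    by apply: contrapT => hi; apply: h; exists i.
  by exists (t *: x) => //; rewrite rpredZ// S_L.
suff main i' y : y \in L -> S (proj (i' : 'I_m) y).
  move=> y hy; rewrite (st y); apply: S_D; last by apply: S_l; rewrite rpredZ.
  by apply: S_Z; rewrite -(sum_proj hy); apply: S_sum => i'; exact: main.
(* A shift by this degree takes functions supported in degrees congruent to [i] to functions
   supported in degrees congruent to [i']. *)
move=> hy; have [g hg] := degG_onto ((i : nat)%:Z - (i' : nat)%:Z).
pose x2 := shift g (proj i x); pose y1 := proj i' y.
have Sx2 : S x2 by apply/S_shift/S_proj.
have Lx2 := S_L Sx2; have Ly1 : y1 \in L := proj_L _ hy.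
have nx2 : ~ in_lL x2.
  by move=> /(in_lL_shift g^-1%g); rewrite shift_shift mulVg shift1.
have [y0 hy0] : exists y0, x2 y0 != 0.
  apply: contrapT => h; apply: nx2; suff -> : x2 = 0 by [].
  by apply/funext => z; apply/eqP/negPn/negP => hz; apply: h; exists z.
have supp2 z : x2 z != 0 -> exists n : int, deg z = (i' : nat)%:Z + n * m%:Z.
  move=> hz; have [i1 [n hn]] := int_mod_nat (deg (z * iota g)%g) m0.
  move: hz; rewrite /x2 /shift (proj_eq _ (S_L Sx) hn); case: (eqVneq i i1) => [e _|_]; last by rewrite eqxx.
  by exists n; move: hn; rewrite degM hg -e; move: (deg z) (n * _); clear; lia.
have supp1 z : y1 z != 0 -> exists n : int, deg z = (i' : nat)%:Z + n * m%:Z.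
  move=> hz; have [i1 [n hn]] := int_mod_nat (deg z) m0.
  by exists n; move: hz; rewrite /y1 (proj_eq _ hy hn); case: (eqVneq i' i1) => [->//|_]; rewrite eqxx.
have [n0 hn0] := supp2 _ hy0.
pose a := y1 y0 / x2 y0.
have ya z : y1 z = a * x2 z.
  have [[n hn]|no'] := pselect (exists n : int, deg z = (i' : nat)%:Z + n * m%:Z).
    have [|c hc] := @L_coset z y0 (n - n0).
      by rewrite hn hn0 mulrBl; move: (n * _) (n0 * _); clear; lia.
    by rewrite !hc// /a mulrCA divfK.
  have -> : y1 z = 0 by apply/eqP/negPn/negP => /supp1.
  by have -> : x2 z = 0 by [apply/eqP/negPn/negP => /supp2]; rewrite mulr0.
clearbody a; have [a0|a0] := eqVneq a 0.
  suff -> : proj i' y = 0 by exact: S_0.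
  by apply/funext => z; rewrite [LHS]ya a0 mul0r.
(* In the second case the inverse of [a] is [l c], and [x2 = l (c y1)] would lie in [l L]. *)
have [[c hc]|[c hc]] := int_or_inv a0.
  suff -> : proj i' y = c *: x2 by apply: S_Z.
  by apply/funext => z; rewrite [LHS]ya hc.
case: nx2; exists (c *: y1); first by rewrite rpredZ.
by apply/funext => z; rewrite !rscalE ya rmorph_nat !mulrA -hc mulVf// mul1r.
Qed.

End LatticeSubmodules.

Lemma smvalZ (R : comNzRingType) (V : lmodType R) (S : submodClosed V) a (x : submod S) :
  smval (a *: x) = a *: smval x.
Proof. by []. Qed.

Lemma submod_torsion_free (O : comNzRingType) (C : fieldType) (f : {rmorphism O -> C})
    (V : lmodType C) (S : submodClosed (rscal f V)) a (x : submod S) :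
  f a != 0 -> a *: x = 0 -> x = 0.
Proof.
move=> a0 /(congr1 (@smval _ _ S)); rewrite smvalZ => h; apply: val_inj.
have {}h : f a *: (smval x : V) = 0 by [].
by move/eqP: h; rewrite scaler_eq0 (negbTE a0) => /eqP.
Qed.

(** * Tate cohomology of a trivial action *)

Section TrivialTate.
Variables (O : comNzRingType) (Mo : lmodType O) (l : nat) (s : {linear Mo -> Mo}).
Hypothesis hs : forall x, s x = x.

Lemma ker_one_sub_all x : x \in ker_pred (one_sub s).
Proof. by rewrite inE /= /one_sub_fun hs subrr. Qed.

Lemma tate_norm_trivial x : tate_norm l s x = l%:R *: x.
Proof.
rewrite /= /tate_norm_fun (eq_bigr (fun=> x)) ?sumr_const ?card_ord ?scaler_nat//.
by move=> i _; elim: (nat_of_ord i) => //= n ->.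
Qed.

(** With [s] trivial, the kernel of [1 - s] is everything and the norm is multiplication by [l], so
    [tate0] is [Mo] modulo [l Mo]. *)
Definition tate_class (x : Mo) : tate0 l s :=
  subquot_class (im_pred (tate_norm l s)) (ker_one_sub_all x).

Lemma tate_class_surj y : exists x, y = tate_class x.
Proof.
have [x [Ax ->]] := subquotP y; exists x.
by congr subquot_class; exact: bool_irrelevance.
Qed.

Lemma tate_class_lin a x y :
  tate_class (a *: x + y) = a *: tate_class x + tate_class y.
Proof.
by rewrite /tate_class /subquot_class -qprojZ -qprojD; congr qproj; apply: val_inj.
Qed.

Lemma tate_class_eq0 x : tate_class x = 0 <-> exists y, x = l%:R *: y.
Proof.
split=> [/subquot_class_eq0/asboolP[y <-]|[y ->]]; first by exists y; rewrite tate_norm_trivial.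
by apply/subquot_class_eq0/asboolP; exists y; rewrite tate_norm_trivial.
Qed.

Lemma tate1_trivial : (forall x : Mo, l%:R *: x = 0 -> x = 0) ->
  forall y : tate1 l s, y = 0.
Proof.
move=> tf y; have [x [Ax ->]] := subquotP y; apply/subquot_class_eq0.
have -> : x = 0 by apply: tf; rewrite -tate_norm_trivial; apply/eqP; exact: Ax.
exact: rpred0.
Qed.

Lemma tate_class_rep (G : groupType) (rho : group_rep G Mo)
    (rho_s : forall g x, s (rho g x) = rho g (s x)) g x :
  tate0_rep l rho_s g (tate_class x) = tate_class (rho g x).
Proof.
rewrite /tate_class /subquot_class /= /subquot_map /=.
rewrite [LHS]quotmod_mapE; first by congr qproj; apply: val_inj.
by move=> z; exact: im_norm_stable.
Qed.

End TrivialTate.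

(** A vector [b] of the basis works: from [b = l y], comparing coefficients at [b] would make [l]
    invertible. This is what makes the quotient by [l] nonzero. *)
Lemma lattice_indivisible (O : comNzRingType) (C : fieldType) (f : {rmorphism O -> C})
    (V : lmodType C) (W : set V) (L : submodClosed (rscal f V)) (l : nat) :
  is_lattice W L -> (exists2 x, W x & x != 0) -> (forall a, l%:R * f a != 1) ->
  exists2 x : rscal f V, x \in L & forall y, y \in L -> x <> l%:R *: y.
Proof.
move=> [B [free -> LB]] [x [s sB ex] x0] nu.
have [b Bb] : exists b, B b.
  case: s ex sB => [ex|t s _ sB]; first by move: x0; rewrite ex big_nil eqxx.
  by exists t.2; have [] := sB t (mem_head _ _).
exists b.
  apply/LB; exists [:: (1, b)]; last by rewrite big_seq1 /= scale1r.
  by move=> t; rewrite inE => /eqP ->; split=> //; exists 1 => //; rewrite rmorph1.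
move=> y /LB[r rB ey] eb.
have {}eb : b = l%:R *: (y : V) by rewrite [LHS]eb -(rmorph_nat f).
(* Coefficients of the relation [l y - b = 0]; those of [y] are collected because [r] may repeat
   vectors. *)
pose c (z : V) := l%:R * (\sum_(t <- r | t.2 == z) t.1) - (z == b)%:R.
pose s' := undup (b :: [seq t.2 | t <- r]).
have bs' : b \in s' by rewrite mem_undup mem_head.
have us' : uniq s' by exact: undup_uniq.
have sumb (F : V -> V) z : z \in s' -> \sum_(z' <- s' | z == z') F z' = F z.
  move=> zs; rewrite big_mkcond (bigD1_seq z)//= eqxx big1 ?addr0// => z' ne.
  by rewrite eq_sym (negbTE ne).
have /(_ b bs') : {in s', forall z, c z = 0}.
  apply: free => //.
    move=> z; rewrite mem_undup inE => /orP[/eqP -> //|/mapP[t tr ->]].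
    by have [] := rB t tr.
  under eq_bigr => z _ do rewrite scalerBl -scalerA scaler_suml.
  rewrite sumrB -scaler_sumr.
  have -> : \sum_(z <- s') (z == b)%:R *: z = b.
    rewrite -[RHS](sumb id b bs') [RHS]big_mkcond; apply: eq_bigr => z _.
    by rewrite eq_sym; case: eqP => _; rewrite ?scale1r ?scale0r.
  rewrite (exchange_big_dep predT)//= [X in l%:R *: X](_ : _ = y) ?eb ?subrr//.
  rewrite ey big_seq [RHS]big_seq; apply: eq_bigr => t tr.
  by rewrite (sumb (fun z => t.1 *: z))// mem_undup inE map_f ?orbT.
rewrite /c eqxx => /eqP; rewrite subr_eq0.
have [a ->] : exists a, \sum_(t <- r | t.2 == b) t.1 = f a.
  elim: r rB {ey c s' bs' us' sumb} => [|t r IH] rB; first by exists 0; rewrite big_nil rmorph0.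
  have [t' t'r|a ha] := IH; first by apply: rB; rewrite inE t'r orbT.
  have [[a' _ ha'] _] := rB t (mem_head _ _).
  rewrite big_cons ha; case: ifP => _; last by exists a.
  by exists (a' + a); rewrite rmorphD ha'.
by apply/negP; exact: nu.
Qed.

(** * Application to the stable lattice in Pi *)

Theorem corollary3p5
  (* the local field F and the central division algebra D *)
  (F : fieldType) (v : discrete_valuation F) (p q : nat)
  (hF : local_field v p q)
  (D : falgType F) (d : nat) (hD : central_division D d)
  (* the Galois extension E / F of degree l *)
  (l : nat) (l_prime : prime l) (l_neq_p : l != p) (l_ndvd_d : ~~ (l %| d)%N)
  (E : splittingFieldType F) (hE : galois 1%VS {:E}) (hEl : \dim {:E} = l)
  (* D_E = D (x) E with its Galois action *)
  (DE : falgType E) (iD : {rmorphism D -> DE})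
  (hDE : base_change (in_alg E) iD)
  (gD : gal_of {:E} -> {rmorphism DE -> DE}) (hgD : galois_action iD gD)
  (* the maximal unramified extension Kc of the l-adic numbers *)
  (Ql : fieldType) (w : discrete_valuation Ql) (hQl : ladic_numbers w l)
  (Kc Cl : fieldType) (iQ : {rmorphism Ql -> Kc}) (iKc : {rmorphism Kc -> Cl})
  (hKc : max_unramified w iQ iKc)
  (* the admissible tame pair (K / F, theta), and the representation pi of D^* *)
  (K : fieldExtType F) (theta : K -> Kc)
  (htame : tame_pair (vring_inc v) theta)
  (hadm : admissible theta)
  (htheta : forall x, x != 0 -> exists a, theta x = ext_integers_inc w iQ a)
  (j : {lrmorphism K -> D}) (nrd : D -> K) (hnrd : reduced_norm j nrd)
  (V : lmodType Kc) (pi : group_rep (units D) V)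
  (pi_irr : rep_abs_irreducible pi)
  (pi_depth0 : depth_zero (vring_inc v) pi)
  (pi_integral : integral_rep (ext_integers_inc w iQ) pi)
  (pi_ind : ind_iso (vring_inc v) j nrd theta pi)
  (* EK = E (x) K, embedded in D_E, and theta o Nr_{EK/K} *)
  (EK : fieldExtType E) (iEK : {rmorphism K -> EK})
  (hEK : base_change (in_alg E) iEK)
  (jE : {lrmorphism EK -> DE}) (hjE : forall x, jE (iEK x) = iD (j x))
  (nrdE : DE -> EK) (hnrdE : reduced_norm jE nrdE)
  (Nr : EK -> K) (hNr : field_norm iEK Nr)
  (l_ndvd_q : ~~ (l %| q ^ d - 1)%N)
  (* the stable lattice L in Pi *)
  (L : submodClosed (rscal (ext_integers_inc w iQ) (units DE -> Kc^o)))
  (hL : is_lattice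
          (ind_space (intring_inc (alg_map (vring_inc v) E)) jE nrdE
             (theta \o Nr)) L)
  (L_stable : rep_stable
                (rscal_rep (ext_integers_inc w iQ) (rtrans (units DE) Kc)) L)
  (L_gal : forall g x, x \in L ->
             rscal_map (ext_integers_inc w iQ) (gal_fun gD Kc g) x \in L)
  (sigma : gal_of {:E}) (hsigma : generator 'Gal({:E} / 1) sigma) :
  rep_irreducible (lattice_tate0_rep hgD L_stable L_gal l sigma) /\
  (forall x : lattice_tate1 L_gal l sigma, x = 0).
Proof.
have [hA _ _] := hD.
have [unrK hth _ _] := htame.
have [varpi p0 vp] := dval_onto v.
have [VD [e [k [red [av hred]]]]] := valued_algebra_exists hF hA.
have [wD [u [b [z [N [m [h [ts ed]]]]]]]] :=
  tame_structure_exists hF p0 vp av hred hD unrK j.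
have lp := prime_gt0 l_prime.
have co : coprime l #|k|.-1 by rewrite prime_coprime// (ts_card ts) -subn1.
have [V' [k' [red' [av' hred' ViD VgD]]]] := base_change_valuation hF p0 vp hD av hred
  l_prime l_neq_p l_ndvd_d co hE hEl hDE hgD hsigma.
have hchi := chi_mult htame hNr.
have hint := integers_over_ext hF p0 vp av'.
have near (x : DE) := @unit_near_BE F q D d VD k red hred K j wD u b z N m h ts E DE iD hDE
  V' k' red' hred' ViD EK iEK hEK jE hjE x.
set inc := ext_integers_inc w iQ.
set indE := ind_space _ _ _ _ in hL.
have w0 := root_neq0 VD (ts_wM ts).
pose wU := Units (dv_unit VD w0).
pose uU := Units (dv_unit VD (ts_u0 ts)).
pose bU := Units (dv_unit VD (ts_b0 ts)).
have L_ind x : x \in L -> indE x.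
  have [B [_ -> LB]] := hL; move=> /LB[s sB ->]; exists s => // t ts'.
  by have [_ Bt] := sB t ts'.
have [f0 if0 f01] : exists2 f, indE f & f 1%g = 1.
  have a0 : (varpi%:A : E) != 0 by rewrite (fmorph_eq0 (in_alg E)).
  have Va0 : vge (V' : divval DE) 1 ((varpi%:A : E)%:A : DE).
    have Vp : V' (varpi%:A : over_base DE) = e%:Z by rewrite (av_base av')// vp intmulnE mul1r.
    by apply/orP; right; move: Vp; rewrite /= => ->; exact: (av_gt0 av).
  have [|f hf [f1 _]] := ind_fun_exists hnrdE hchi hint a0 Va0; last by exists f.
  exact: (chiE_U1 hF p0 vp av hred htame ts av' hred' ViD hnrdE hNr).
(* All functions in the lattice are [sigma]-invariant, so both cohomology groups are those of a
   trivial action. *)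
have sg_triv x : lattice_gal L_gal sigma x = x.
  apply: val_inj; apply/funext => y.
  exact: (ind_gD_invariant hF p0 vp av hred htame ts hDE hgD av' hred' ViD VgD hEK hjE hnrdE
    hNr (sigma^-1)%g y (L_ind _ (smvalP x))).
split; last first.
  apply: tate1_trivial => // x; apply: submod_torsion_free.
  by rewrite rmorph_nat (l_neq0 hQl l_prime iQ).
pose cls x (Lx : x \in L) := tate_class l sg_triv (Submod Lx).
split.
  have [|x Lx nx] := lattice_indivisible hL _ (l_not_unit hQl l_prime (iQ := iQ)).
    by exists f0 => //; apply/eqP => e0; move/eqP: f01; rewrite e0 eq_sym oner_eq0.
  exists (cls x Lx) => /tate_class_eq0[y ey]; apply: (nx (smval y)) (smvalP y) _.
  by rewrite -smvalZ -ey.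
move=> S hS.
(* The preimage of [S] in the lattice, as a predicate on the ambient functions; it contains
   [l L]. *)
pose St (x : rscal inc (units DE -> Kc^o)) := exists Lx : x \in L, cls x Lx \in S.
have cls_irr x (Lx Lx' : x \in L) : cls x Lx = cls x Lx'.
  by congr tate_class; exact: val_inj.
have clsP y : exists x (Lx : x \in L), y = cls x Lx.
  have [x ->] := tate_class_surj sg_triv y; exists (smval x), (smvalP x).
  by congr tate_class; exact: val_inj.
(* [theta] has integral values, so the eigenvalue lifts to the integers of [Kc], over which [proj]
   is defined. *)
have [lam0 hlam0] := htheta _ (nrd_neq0 VD hnrd (ts_wB ts) w0).
pose lam := lam0 ^+ l.
have hlam : inc lam = theta (nrd wD) ^+ l by rewrite rmorphXn hlam0.
have hlamE : chiB nrdE (theta \o Nr) (uval (units_map iD wU)) = inc lam.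
  by rewrite hlam; exact: (chiE_iD_w p0 vp htame hnrd ts hDE V' hEK hjE hnrdE hNr hEl).
have wBE : forall y, uval (units_map iD wU) * jE y = jE y * uval (units_map iD wU).
  exact: (iD_BE hEK hjE (ts_wB ts)).
have bBE : forall y, uval (units_map iD bU) * jE y = jE y * uval (units_map iD bU).
  exact: (iD_BE hEK hjE (ts_bB ts)).
have VuE : (V' : divval DE) (uval (units_map iD uU)) = 1.
  exact: (etrans (ViD _ (ts_u0 ts)) (ts_Vu ts)).
have VbE : (V' : divval DE) (uval (units_map iD bU)) = m%:Z.
  exact: (etrans (ViD _ (ts_b0 ts)) (ts_Vb ts)).
have uwE : (units_map iD uU * units_map iD wU = units_map iD wU ^+ N * units_map iD uU)%g.
  apply: val_inj; change (iD u * iD wD = uval (units_map iD wU ^+ N)%g * iD u).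
  by rewrite uvalX -[uval _]/(iD wD) -rmorphXn -!rmorphM (ts_uw ts).
have nontriv : exists x : V, x <> 0 by case: pi_depth0 => _ [].
have [trivL|allL] : (forall x, St x -> in_lL l L x) \/ (forall x, x \in L -> St x).
  apply: (@submodule_trivial _ _ inc (units D) (units DE) (units_map iD)
    (fun y => V' (uval y)) (fun g => VD (uval g)) _ _ _ _ l #|k|.-1 N m lam wU).
  - exact: units_map1.
  - exact: units_mapM.
  - move=> y g; rewrite (dv_unitsM (V' : divval DE)); congr (_ + _).
    by apply: ViD; exact: (unitsP VD).
  - by move=> a; have [g hg] := unit_of_dv ts a; exists g.
  - exact: lp.
  - exact: (ts_m0 ts).
  - exact: co.
  - by rewrite hlam exprAC (lambda_X_card hth hnrd ts) expr1n.
  - move=> i i' hii'; rewrite hlam.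
    exact: (lambda_conj_neq hF p0 vp av hth hnrd ts iKc (mu_closed hKc) pi_irr nontriv pi_ind lp co hii').
  - by move=> a; exact: (integral_or_inverse hQl l_prime hKc).
  - by move=> g x Lx; exact: (L_stable (units_map iD g)).
  - move=> x y i n Lx hy; rewrite -hlamE.
    by apply: (ind_w hnrdE hchi hint near wBE VuE uwE bBE VbE (n := n)) => //; exact: L_ind.
  - move=> y y' n hy; have [c _ hc] := ind_coset hnrdE hchi hint near bBE VbE hy.
    by exists c => x /L_ind; exact: hc.
  - by move=> x [].
  - move=> a x y [Lx Sx] [Ly Sy]; have Lxy : a *: x + y \in L by rewrite rpredD ?rpredZ.
    exists Lxy; have -> : cls _ Lxy = a *: cls x Lx + cls y Ly.
      by rewrite -tate_class_lin; congr tate_class; exact: val_inj.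
    by rewrite rpredD ?rpredZ.
  - move=> g x [Lx Sx]; have Lgx : shift (units_map iD) g x \in L by exact: (L_stable (units_map iD g)).
    exists Lgx; have <- : lattice_tate0_rep hgD L_stable L_gal l sigma g (cls x Lx) = cls _ Lgx.
      by rewrite [LHS]tate_class_rep; congr tate_class; exact: val_inj.
    exact: hS.
  - move=> x Lx; have Llx : l%:R *: x \in L by rewrite rpredZ.
    exists Llx; suff -> : cls _ Llx = 0 by rewrite rpred0.
    by apply/tate_class_eq0; exists (Submod Lx); exact: val_inj.
- left=> y; have [x [Lx ->]] := clsP y => Sx; apply/tate_class_eq0.
  have [y' Ly' ey'] := trivL x (ex_intro _ Lx Sx); exists (Submod Ly'); exact: val_inj.
- right=> y; have [x [Lx ->]] := clsP y; have [Lx' Sx] := allL x Lx.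
  by rewrite (cls_irr x Lx Lx').
Qed.
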